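(* Let $\Psi$ be an Orlicz function and $\phi\colon\mathbb D\to\mathbb D$ analytic. If $C_\phi\colon\mathscr B^\Psi\to\mathscr B^\Psi$ is compact, then $$\frac{\Psi^{-1}\big(1/(1-|\phi(a)|)^2\big)}{\Psi^{-1}\big(1/(1-|a|)^2\big)}\longrightarrow0\quad\text{as }|a|\to1^-.$$ Conversely, if $\Psi$ satisfies $\Delta^2$, this condition implies that $C_\phi\colon\mathscr B^\Psi\to\mathscr B^\Psi$ is compact.
   Context: An Orlicz function is a continuous, strictly convex, increasing $\Psi\colon[0,\infty)\to[0,\infty)$ with $\Psi(0)=0$ and $\Psi(x)/x\to\infty$. $d\mathscr A=dx\,dy/\pi$ is normalized area measure on $\mathbb D$. The Bergman–Orlicz space $\mathscr B^\Psi$ is the space of analytic $f$ on $\mathbb D$ belonging to $L^\Psi(\mathbb D,\mathscr A)$, with norm $\|f\|_\Psi=\inf\{C>0:\int_{\mathbb D}\Psi(|f|/C)\,d\mathscr A\le1\}$. $C_\phi f=f\circ\phi$ (bounded on $\mathscr B^\Psi$). $\Delta^2$: $\exists\alpha>1$, $\Psi(x)^2\le\Psi(\alpha x)$ for large $x$. *)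

(* Defs.v *)
From HB Require Import structures.
From mathcomp Require Import all_boot all_order all_algebra.
From mathcomp Require Import all_classical all_reals all_analysis.
Set Implicit Arguments. Unset Strict Implicit. Unset Printing Implicit Defensive.
Import Order.TTheory GRing.Theory Num.Theory.
Import numFieldNormedType.Exports.
Local Open Scope classical_set_scope.
Local Open Scope ring_scope.

Section Defs.
Variable R : realType.

Definition cadd (z w : R * R) : R * R := (z.1 + w.1, z.2 + w.2).
Definition csub (z w : R * R) : R * R := (z.1 - w.1, z.2 - w.2).
Definition cmul (z w : R * R) : R * R :=
  (z.1 * w.1 - z.2 * w.2, z.1 * w.2 + z.2 * w.1).
Definition cabs (z : R * R) : R := Num.sqrt (z.1 ^+ 2 + z.2 ^+ 2).

Definition disk : set (R * R) := [set z | cabs z < 1].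

Definition holomorphic_disk (f : R * R -> R * R) : Prop :=
  forall z, disk z -> exists d : R * R, forall e : R, 0 < e ->
    exists del : R, 0 < del /\ forall h : R * R, cabs h < del ->
      disk (cadd z h) ->
      cabs (csub (f (cadd z h)) (cadd (f z) (cmul d h))) <= e * cabs h.

(* Orlicz function (only its values on [0, +oo) matter) *)
Definition orlicz (Psi : R -> R) : Prop :=
  [/\ {within `[0, +oo[, continuous Psi},
      (forall x y t, 0 <= x -> 0 <= y -> x != y -> 0 < t < 1 ->
          Psi (t * x + (1 - t) * y) < t * Psi x + (1 - t) * Psi y),
      (forall x y, 0 <= x -> x < y -> Psi x < Psi y),
      (forall x, 0 <= x -> 0 <= Psi x) &
      Psi 0 = 0 /\
      (fun x => Psi x / x) @ +oo --> +oo].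

Definition Delta2 (Psi : R -> R) : Prop :=
  exists alpha : R, 1 < alpha /\ exists x0 : R, forall x, x0 <= x ->
    Psi x ^+ 2 <= Psi (alpha * x).

Definition Psi_inv (Psi : R -> R) (y : R) : R :=
  sup [set x : R | 0 <= x /\ Psi x <= y].

(* normalized area measure dA = dx dy / pi, modular functional
   int_D Psi(|f|/C) dA *)
Definition area_lebesgue :=
  ((@lebesgue_measure R) \x (@lebesgue_measure R))%E.

Definition modular (Psi : R -> R) (f : R * R -> R * R) (C : R) : \bar R :=
  ((pi^-1)%:E * \int[area_lebesgue]_(z in disk) (Psi (cabs (f z) / C))%:E)%E.

Definition in_BPsi (Psi : R -> R) (f : R * R -> R * R) : Prop :=
  holomorphic_disk f /\ exists C : R, 0 < C /\ (modular Psi f C <= 1)%E.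

Definition BPsi_norm (Psi : R -> R) (f : R * R -> R * R) : R :=
  inf [set C : R | 0 < C /\ (modular Psi f C <= 1)%E].

Definition comp_compact (Psi : R -> R) (phi : R * R -> R * R) : Prop :=
  forall u : nat -> (R * R -> R * R),
    (forall n, in_BPsi Psi (u n) /\ BPsi_norm Psi (u n) <= 1) ->
    exists (sigma : nat -> nat) (g : R * R -> R * R),
      (forall n, (sigma n < sigma n.+1)%N) /\ in_BPsi Psi g /\
      (fun n => BPsi_norm Psi (fun z => csub (u (sigma n) (phi z)) (g z)))
        @ \oo --> 0.

Definition ratio_cond (Psi : R -> R) (phi : R * R -> R * R) : Prop :=
  forall e : R, 0 < e -> exists r : R, r < 1 /\ forall a, disk a -> r < cabs a ->
    Psi_inv Psi (((1 - cabs (phi a)) ^+ 2)^-1) /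
    Psi_inv Psi (((1 - cabs a) ^+ 2)^-1) < e.

End Defs.

(* Main.v *)
Require Import Defs.
From mathcomp Require Import all_boot all_order all_algebra.
From mathcomp Require Import all_classical all_reals all_analysis measurable_realfun.
From mathcomp Require Import ring lra.
Set Implicit Arguments. Unset Strict Implicit. Unset Printing Implicit Defensive.
Import Order.TTheory GRing.Theory Num.Theory.
Import numFieldNormedType.Exports.
Local Open Scope classical_set_scope.
Local Open Scope ring_scope.

(** Two pointwise facts carry the whole argument. Write
    [growth a = Psi^-1 (1 / (1 - |a|)^2)].

    First, a function in the unit ball of the Bergman-Orlicz space is
    [O(growth)]: Goursat's theorem on rectangles bounds [|f z|] by the mean of
    [|f|] over a square of side comparable to [1 - |z|], and convexity of [Psi]
    turns this into the claim.

    Second, for [b] in the disk, [growth b * ((1 - |b|) / (1 - conj b z))^4] is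
    bounded in norm by an absolute constant, since
    [2 |1 - conj b z|^2 >= (1 - |b|)^2 + |z - b|^2] dominates the kernel by a
    product of two one-variable Lorentzians.

    Necessity: these kernels, at points [b = phi a] along which the ratio stays
    away from [0], tend to [0] pointwise, so a norm limit of a subsequence
    composed with [phi] is [0]; evaluating at [a] contradicts the first fact.
    Sufficiency: by Montel's theorem a subsequence of the unit ball converges
    pointwise to a holomorphic [g]; the ratio condition makes the composed
    functions [o(growth)], and two applications of [Delta2] bound
    [Psi (growth a / alpha^2)] by [C + (1 - |a|)^(-1/2)], which is integrable,
    so dominated convergence applies. *)

(** * Complex arithmetic and the topology of the plane *)

Section ComplexPlane.
Context {R : realType}.
Implicit Types (z w v : R * R) (f g : R * R -> R * R).

(** Cauchy's formula is needed only as an inequality. Multiplying by the conjugate of the value at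
    the centre makes that value real and nonnegative, and on each side of a rectangle the relevant
    part of [1 / (w - z)] has one sign and an explicit lower bound, which takes the place of the
    integral [2 pi i]. The functions integrated are difference quotients, continuous at the centre
    but not known to be differentiable there, so Goursat's theorem has to tolerate finitely many
    such points. Iterated quotients give a Taylor remainder whose constant depends on a bound alone;
    in this form it survives limits. [BPsi_norm] is an infimum, equal to [0] when no constant is
    admissible, so a small norm is informative only once some admissible constant is known. For
    this, necessity uses that each test function is bounded. The exponents come from
    [Psi (growth a) = (1 - |a|)^-2]: a fourth power of the kernel has integral of order
    [(1 - |b|)^2], and the exponent [-2] must be halved twice to get past the non-integrable
    [-1]. *)

Lemma caddE z w : Defs.cadd z w = z + w. Proof. by []. Qed.
Lemma csubE z w : Defs.csub z w = z - w. Proof. by []. Qed.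

Lemma cmulC z w : cmul z w = cmul w z.
Proof. by rewrite /cmul; congr pair; ring. Qed.

Lemma cmulA z w v : cmul z (cmul w v) = cmul (cmul z w) v.
Proof. by rewrite /cmul/=; congr pair; ring. Qed.

Lemma cmulDr z w v : cmul z (w + v) = cmul z w + cmul z v.
Proof. by rewrite /cmul/=; congr pair => /=; ring. Qed.

Lemma cmulDl z w v : cmul (w + v) z = cmul w z + cmul v z.
Proof. by rewrite /cmul/=; congr pair => /=; ring. Qed.

Lemma cmulNr z w : cmul z (- w) = - cmul z w.
Proof. by rewrite /cmul/=; congr pair => /=; ring. Qed.

Lemma cmulNl z w : cmul (- z) w = - cmul z w.
Proof. by rewrite cmulC cmulNr cmulC. Qed.

Lemma cmulBl z w v : cmul (w - v) z = cmul w z - cmul v z.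
Proof. by rewrite cmulDl cmulNl. Qed.

Lemma cmul0 z : cmul z 0 = 0.
Proof. by rewrite /cmul/=; congr pair => /=; ring. Qed.

Lemma cabs_ge0 z : 0 <= cabs z.
Proof. exact: sqrtr_ge0. Qed.

Lemma cabs_sqr z : cabs z ^+ 2 = z.1 ^+ 2 + z.2 ^+ 2.
Proof. by rewrite /cabs sqr_sqrtr// addr_ge0// sqr_ge0. Qed.

Lemma cabs0 : cabs (0 : R * R) = 0.
Proof. by rewrite /cabs/= expr0n/= addr0 sqrtr0. Qed.

Lemma cabs_eq0 z : cabs z = 0 -> z = 0.
Proof.
move=> z0; have := cabs_sqr z; rewrite z0 expr0n/= => /esym/eqP.
rewrite paddr_eq0 ?sqr_ge0// !sqrf_eq0 => /andP[/eqP h1 /eqP h2].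
by case: z h1 h2 {z0} => a b /= -> ->.
Qed.

Lemma cabs_gt0 z : z <> 0 -> 0 < cabs z.
Proof.
by move=> z0; rewrite lt_neqAle cabs_ge0 andbT; apply/eqP => /esym/cabs_eq0.
Qed.

Lemma cabsM z w : cabs (cmul z w) = cabs z * cabs w.
Proof.
rewrite /cabs -sqrtrM ?addr_ge0 ?sqr_ge0//; congr Num.sqrt.
by rewrite /cmul/=; ring.
Qed.

Lemma cabsN z : cabs (- z) = cabs z.
Proof. by rewrite /cabs/= !sqrrN. Qed.

Lemma cabsBC z w : cabs (z - w) = cabs (w - z).
Proof. by rewrite -cabsN opprB. Qed.

Lemma cabs_le z (c : R) : 0 <= c -> z.1 ^+ 2 + z.2 ^+ 2 <= c ^+ 2 -> cabs z <= c.
Proof. by move=> c0 h; rewrite -(ler_pXn2r (n := 2))// ?nnegrE ?cabs_ge0// cabs_sqr. Qed.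

Lemma cabs_dot z w : z.1 * w.1 + z.2 * w.2 <= cabs z * cabs w.
Proof.
apply: le_trans (ler_norm _) _.
rewrite -(ler_pXn2r (n := 2))// ?nnegrE ?mulr_ge0 ?cabs_ge0//.
rewrite exprMn !cabs_sqr real_normK ?num_real// -subr_ge0.
have -> : (z.1 ^+ 2 + z.2 ^+ 2) * (w.1 ^+ 2 + w.2 ^+ 2) -
  (z.1 * w.1 + z.2 * w.2) ^+ 2 = (z.1 * w.2 - z.2 * w.1) ^+ 2 by ring.
exact: sqr_ge0.
Qed.

Lemma cabsD z w : cabs (z + w) <= cabs z + cabs w.
Proof.
apply: cabs_le; first by rewrite addr_ge0 ?cabs_ge0.
have := cabs_dot z w; have := cabs_sqr z; have := cabs_sqr w.
by rewrite /= => h1 h2 h3; nra.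
Qed.

Lemma cabs_sub z w : cabs z - cabs w <= cabs (z - w).
Proof. by rewrite lerBlDr -{1}(subrK w z) cabsD. Qed.

Lemma ler_cabs1 z : `|z.1| <= cabs z.
Proof.
rewrite -(ler_pXn2r (n := 2))// ?nnegrE ?cabs_ge0//.
by rewrite cabs_sqr real_normK ?num_real// lerDl sqr_ge0.
Qed.

Lemma ler_cabs2 z : `|z.2| <= cabs z.
Proof.
rewrite -(ler_pXn2r (n := 2))// ?nnegrE ?cabs_ge0//.
by rewrite cabs_sqr real_normK ?num_real// lerDr sqr_ge0.
Qed.

Lemma cabs_le_sum z : cabs z <= `|z.1| + `|z.2|.
Proof.
apply: cabs_le; first by rewrite addr_ge0.
rewrite sqrrD !real_normK ?num_real// -subr_ge0.
suff -> : z.1 ^+ 2 + `|z.1| * `|z.2| *+ 2 + z.2 ^+ 2 - (z.1 ^+ 2 + z.2 ^+ 2) =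
  `|z.1| * `|z.2| *+ 2 by rewrite mulrn_wge0// mulr_ge0.
by ring.
Qed.

Definition cinv z : R * R := (z.1 / cabs z ^+ 2, - z.2 / cabs z ^+ 2).

Lemma cmulV z : z <> 0 -> cmul z (cinv z) = (1, 0).
Proof.
move=> /cabs_gt0 z0; have : z.1 ^+ 2 + z.2 ^+ 2 != 0.
  by rewrite -cabs_sqr; apply: lt0r_neq0; rewrite exprn_gt0.
by rewrite /cmul /cinv cabs_sqr/= => h; congr pair; field.
Qed.

Lemma cmul1 z : cmul z (1, 0) = z.
Proof. by case: z => a b; rewrite /cmul/=; congr pair; ring. Qed.

Lemma cmulVK z w : w <> 0 -> cmul (cmul z (cinv w)) w = z.
Proof. by move=> w0; rewrite -cmulA (cmulC _ w) cmulV// cmul1. Qed.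

Lemma cabsV z : z <> 0 -> cabs (cinv z) = (cabs z)^-1.
Proof.
move=> z0; have zp := cabs_gt0 z0; have := cabsM z (cinv z).
rewrite cmulV//.
have -> : cabs ((1, 0) : R * R) = 1 by rewrite /cabs/= expr1n expr0n/= addr0 sqrtr1.
by move=> h; apply: (mulfI (lt0r_neq0 zp)); rewrite -h mulfV ?lt0r_neq0.
Qed.

(** The topology of [R * R] is given by the larger coordinate. Comparing that with [cabs] up to a
    factor 2 makes epsilon-delta arguments in the modulus available. *)
Lemma ccontP f z : {for z, continuous f} <->
  forall e, 0 < e -> exists2 d, 0 < d & forall w, cabs (w - z) < d -> cabs (f w - f z) < e.
Proof.
split=> [cf e e0|h].
  have e2 : 0 < e / 2 by rewrite divr_gt0.
  have /cvgrPdist_lt/(_ _ e2) /nbhs_ballP[d/= d0 dz] := cf.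
  exists d => // w wd; apply: le_lt_trans (cabs_le_sum _) _ => /=.
  have : `|f z - f w| < e / 2.
    apply: dz; split => /=; rewrite /ball/= distrC.
      exact: le_lt_trans (ler_cabs1 (w - z)) wd.
    exact: le_lt_trans (ler_cabs2 (w - z)) wd.
  rewrite prod_normE/= gt_max distrC => /andP[h1].
  by rewrite distrC => h2; lra.
apply/cvgrPdist_lt => e e0; have [d d0 dz] := h _ e0.
apply/(@nbhs_ballP R (R * R)%type); exists (d / 2); first by rewrite /= divr_gt0.
move=> w [/= h1 h2].
have /dz hw : cabs (w - z) < d.
  apply: le_lt_trans (cabs_le_sum _) _ => /=.
  by move: h1 h2; rewrite /ball/= distrC => h1; rewrite distrC => h2; lra.
rewrite prod_normE/= gt_max; rewrite -(opprB (f w).1) normrN -(opprB (f w).2) normrN.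
by rewrite (le_lt_trans (ler_cabs1 (f w - f z)))// (le_lt_trans (ler_cabs2 (f w - f z))).
Qed.

Lemma continuous_cabs : continuous (@cabs R).
Proof.
move=> z; apply/cvgrPdist_lt => e e0; apply/(@nbhs_ballP R (R * R)%type); exists (e / 2).
  by rewrite /= divr_gt0.
move=> w [/= h1 h2]; have : cabs (z - w) < e.
  apply: le_lt_trans (cabs_le_sum _) _ => /=.
  by move: h1 h2; rewrite /ball/= => h1 h2; lra.
apply: le_lt_trans; rewrite ler_norml cabs_sub andbT lerNl opprB cabsBC.
exact: cabs_sub.
Qed.

Lemma open_disk : open (@disk R).
Proof.
have -> : @disk R = @cabs R @^-1` [set x | x < 1] by [].
by apply: open_comp => [x _|]; [exact: continuous_cabs|exact: open_lt].
Qed.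

Lemma continuous_re f z : {for z, continuous f} -> {for z, continuous (fun w => (f w).1)}.
Proof.
move=> /ccontP cf; apply/cvgrPdist_lt => e /cf[d d0 fd].
apply/(@nbhs_ballP R (R * R)%type); exists (d / 2) => [|w [/= h1 h2]]; first by rewrite /= divr_gt0.
rewrite distrC; apply: le_lt_trans (ler_cabs1 (f w - f z)) _; apply: fd.
apply: le_lt_trans (cabs_le_sum _) _ => /=; rewrite distrC (distrC w.2).
by move: h1 h2; rewrite /ball/=; clear; lra.
Qed.

Lemma continuous_im f z : {for z, continuous f} -> {for z, continuous (fun w => (f w).2)}.
Proof.
move=> /ccontP cf; apply/cvgrPdist_lt => e /cf[d d0 fd].
apply/(@nbhs_ballP R (R * R)%type); exists (d / 2) => [|w [/= h1 h2]]; first by rewrite /= divr_gt0.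
rewrite distrC; apply: le_lt_trans (ler_cabs2 (f w - f z)) _; apply: fd.
apply: le_lt_trans (cabs_le_sum _) _ => /=; rewrite distrC (distrC w.2).
by move: h1 h2; rewrite /ball/=; clear; lra.
Qed.

Lemma continuous_cpair (a b : R * R -> R) z : {for z, continuous a} ->
  {for z, continuous b} -> {for z, continuous (fun w => (a w, b w))}.
Proof.
move=> ca cb; exact: (@cvg_pair _ _ _ (nbhs z) (nbhs (a z)) (nbhs (b z)) _ _ _ a b ca cb).
Qed.

Lemma continuous_cmul f g z : {for z, continuous f} -> {for z, continuous g} ->
  {for z, continuous (fun w => cmul (f w) (g w))}.
Proof.
move=> cf cg; apply: continuous_cpair.
  apply: (@cvgB R R); apply: cvgM.
  - exact: continuous_re cf.
  - exact: continuous_re cg.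
  - exact: continuous_im cf.
  - exact: continuous_im cg.
apply: (@cvgD R R); apply: cvgM.
- exact: continuous_re cf.
- exact: continuous_im cg.
- exact: continuous_im cf.
- exact: continuous_re cg.
Qed.

Lemma continuous_cinv f z : {for z, continuous f} -> f z <> 0 ->
  {for z, continuous (fun w => cinv (f w))}.
Proof.
move=> cf fz.
have ca : {for z, continuous (fun w => (cabs (f w) ^+ 2)^-1)}.
  apply: (@cvgV R); first by rewrite sqrf_eq0 lt0r_neq0// cabs_gt0.
  apply: (@cvgM R); apply: (@continuous_comp _ _ _ f (@cabs R)) => //; exact: continuous_cabs.
apply: continuous_cpair; first by apply: (@cvgM R) => //; exact: continuous_re.
by apply: (@cvgM R) => //; apply: (@cvgN R R); exact: continuous_im.
Qed.
End ComplexPlane.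

(** * Complex differentiability through continuous difference quotients *)

Section ComplexDifferentiability.
Context {R : realType}.
Implicit Types (z w v : R * R) (f g : R * R -> R * R).

(* Caratheodory's form of complex differentiability: the difference quotient
   extends continuously to [z]. *)
Definition cdiff f z := exists2 Q : R * R -> R * R,
  {for z, continuous Q} & forall w, f w = f z + cmul (Q w) (w - z).

Lemma continuous_csub (c z : R * R) : {for z, continuous (fun w : R * R => w - c)}.
Proof. by apply: (@cvgB R (R * R)%type); [exact: cvg_id|exact: cvg_cst]. Qed.

Lemma continuous_cadd f g z : {for z, continuous f} -> {for z, continuous g} ->
  {for z, continuous (fun w => f w + g w)}.
Proof. by move=> cf cg; apply: (@cvgD R (R * R)%type). Qed.

Lemma continuous_copp f z : {for z, continuous f} -> {for z, continuous (fun w => - f w)}.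
Proof. by move=> cf; apply: (@cvgN R (R * R)%type). Qed.

Lemma continuous_ccst (c z : R * R) : {for z, continuous (fun=> c : R * R)}.
Proof. exact: cvg_cst. Qed.

Lemma continuous_csubr f (c z : R * R) : {for z, continuous f} ->
  {for z, continuous (fun w => f w - c)}.
Proof. by move=> cf; apply: (@cvgB R (R * R)%type); [exact: cf|exact: cvg_cst]. Qed.

Lemma cdiff_continuous f z : cdiff f z -> {for z, continuous f}.
Proof.
move=> [Q cQ fE]; have -> : f = fun w => f z + cmul (Q w) (w - z).
  by apply/funext => w; rewrite -fE.
apply: continuous_cadd; first exact: continuous_ccst.
exact: (continuous_cmul cQ (@continuous_csub z z)).
Qed.

Lemma cdiff_cst (c : R * R) z : cdiff (fun=> c) z.
Proof.
exists (fun=> 0); first exact: cvg_cst.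
by move=> w; rewrite cmulC cmul0 addr0.
Qed.

Lemma cdiff_id z : cdiff id z.
Proof.
exists (fun=> (1, 0)); first exact: cvg_cst.
by move=> w; rewrite cmulC cmul1 addrC subrK.
Qed.

Lemma cdiffD f g z : cdiff f z -> cdiff g z -> cdiff (fun w => f w + g w) z.
Proof.
move=> [Q cQ fE] [P cP gE]; exists (fun w => Q w + P w).
  exact: (@cvgD R (R * R)%type).
by move=> w; rewrite fE gE cmulDl addrACA.
Qed.

Lemma cdiffM f g z : cdiff f z -> cdiff g z -> cdiff (fun w => cmul (f w) (g w)) z.
Proof.
move=> df [P cP gE]; have cf := cdiff_continuous df; case: df => [Q cQ fE].
exists (fun w => cmul (Q w) (g z) + cmul (f w) (P w)).
  apply: continuous_cadd; last exact: continuous_cmul.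
  by apply: continuous_cmul => //; exact: continuous_ccst.
move=> w; rewrite gE cmulDr {1}fE !cmulDl -addrA; congr (_ + (_ + _)).
  by rewrite -!cmulA (cmulC (g z)).
by rewrite -cmulA.
Qed.

Lemma cdiffN f z : cdiff f z -> cdiff (fun w => - f w) z.
Proof.
move=> df; have := cdiffM (cdiff_cst (-1, 0) z) df; congr (cdiff _ z).
by apply/funext => w; rewrite /cmul; case: (f w) => a b /=; congr pair => /=; ring.
Qed.

Lemma cdiffB f g z : cdiff f z -> cdiff g z -> cdiff (fun w => f w - g w) z.
Proof. by move=> df dg; apply: cdiffD => //; exact: cdiffN. Qed.

(** Differentiability is local, but [cdiff] asks for its equation at every [w]. Away from [z] the
    given [Q] is replaced by the true quotient, which does not affect continuity at [z]. *)
Lemma cdiff_near f z (Q : R * R -> R * R) (d : R) : 0 < d -> {for z, continuous Q} ->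
  (forall w, cabs (w - z) < d -> f w = f z + cmul (Q w) (w - z)) -> cdiff f z.
Proof.
move=> d0 /ccontP cQ fE.
exists (fun w => if cabs (w - z) < d then Q w else cmul (f w - f z) (cinv (w - z))).
  apply/ccontP => e e0; have [d1 d10 h] := cQ _ e0.
  exists (Num.min d d1); first by rewrite lt_min d0.
  by move=> w; rewrite lt_min => /andP[-> /h]; rewrite subrr cabs0 d0.
move=> w; case: ifPn => [/fE//|wz]; rewrite cmulVK; first by rewrite addrC subrK.
by move=> wz0; move: wz; rewrite wz0 cabs0 d0.
Qed.

Lemma cdiffV f z : f z <> 0 -> cdiff f z -> cdiff (fun w => cinv (f w)) z.
Proof.
move=> fz df; have cf := cdiff_continuous df; case: df => [Q cQ fE].
have /ccontP/(_ _ (cabs_gt0 fz))[d d0 hd] := cf.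
(* The quotient of [1 / f] is [- Q w / (f w * f z)], valid only where [f w] is nonzero; hence the
   local criterion. *)
have cP : {for z, continuous (fun w => - cmul (Q w) (cmul (cinv (f w)) (cinv (f z))))}.
  apply: (continuous_copp (continuous_cmul cQ (continuous_cmul (continuous_cinv cf fz) _))).
  exact: continuous_ccst.
apply: (cdiff_near d0 cP).
move=> w /hd wz; have fw : f w <> 0.
  by move=> fw0; move: wz; rewrite fw0 sub0r cabsN ltxx.
have QE : cmul (Q w) (w - z) = f w - f z by rewrite fE addrAC subrr add0r.
have -> : cmul (- cmul (Q w) (cmul (cinv (f w)) (cinv (f z)))) (w - z) =
   - cmul (cmul (Q w) (w - z)) (cmul (cinv (f w)) (cinv (f z))).
  by rewrite cmulNl -cmulA (cmulC _ (w - z)) cmulA.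
rewrite QE cmulBl cmulA cmulV// (cmulC (1, 0)) cmul1 (cmulC (cinv (f w))) cmulA.
by rewrite cmulV// (cmulC (1, 0)) cmul1 opprB addrC subrK.
Qed.

Lemma cdiff_comp f g z : cdiff f z -> cdiff g (f z) -> cdiff (g \o f) z.
Proof.
move=> df [P cP gE]; have cf := cdiff_continuous df; case: df => [Q cQ fE].
exists (fun w => cmul (P (f w)) (Q w)).
  apply: (continuous_cmul _ cQ); exact: (@continuous_comp _ _ _ f P).
move=> w /=; rewrite gE -cmulA; congr (_ + cmul _ _).
by rewrite fE addrAC subrr add0r.
Qed.

(** The definition tests only increments that stay in the disk. Since the disk is open, this proviso
    is vacuous close to each of its points. *)
Lemma holomorphic_diskP f : holomorphic_disk f <-> forall z, disk z -> cdiff f z.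
Proof.
split=> h z Dz.
  have [d hd] := h z Dz.
  exists (fun w => if w == z then d else cmul (f w - f z) (cinv (w - z))).
    apply/ccontP => e e0; have e2 : 0 < e / 2 by rewrite divr_gt0.
    have [del [del0 {}hd]] := hd _ e2.
    have /nbhs_ballP[r/= r0 rD] := open_disk Dz.
    exists (Num.min del r); first by rewrite lt_min del0.
    move=> w; rewrite lt_min eqxx => /andP[wdel wr].
    case: eqP => [_|/eqP wz]; first by rewrite subrr cabs0.
    have w0 : w - z <> 0 by apply/eqP; rewrite subr_eq0.
    have Dw : disk w.
      apply: rD; split => /=; rewrite /ball/= distrC.
        exact: le_lt_trans (ler_cabs1 (w - z)) wr.
      exact: le_lt_trans (ler_cabs2 (w - z)) wr.
    have := hd (w - z); rewrite wdel caddE (addrC z) subrK => /(_ isT Dw).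
    rewrite csubE opprD addrA => hw.
    have hw2 : cmul (cmul (f w - f z) (cinv (w - z)) - d) (w - z) =
      f w - f z - cmul d (w - z).
      by rewrite cmulBl cmulVK.
    move: hw; rewrite -hw2 cabsM ler_pM2r ?cabs_gt0// => /le_lt_trans; apply.
    by rewrite ltr_pdivrMr//; lra.
  move=> w; case: eqP => [->|/eqP wz]; first by rewrite subrr cmul0 addr0.
  by rewrite cmulVK; [rewrite addrC subrK|apply/eqP; rewrite subr_eq0].
have [Q /ccontP cQ fE] := h z Dz; exists (Q z) => e e0.
have [del del0 hd] := cQ _ e0; exists del; split => // k kdel _.
rewrite caddE csubE fE (addrC z) addrK.
have := hd (k + z); rewrite addrK => /(_ kdel) hk.
have -> : f z + cmul (Q (k + z)) k - Defs.cadd (f z) (cmul (Q z) k) =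
   cmul (Q (k + z) - Q z) k.
  by rewrite caddE opprD addrACA subrr add0r cmulBl.
by rewrite cabsM ler_wpM2r ?cabs_ge0// ltW.
Qed.
End ComplexDifferentiability.

(** * Integrals over segments and over the boundary of a rectangle *)

Section SegmentIntegrals.
Context {R : realType}.
Implicit Types (F : R * R -> R * R) (g h : R -> R) (a b c d m k : R).
Notation mu := (@lebesgue_measure R).

Definition cts_on a b g := forall x, a <= x <= b -> {for x, continuous g}.

Lemma cts_integrable a b g : cts_on a b g -> mu.-integrable `[a, b] (EFin \o g).
Proof.
move=> cg; apply: continuous_compact_integrable; first exact: segment_compact.
by apply: continuous_in_subspaceT => x; rewrite inE/= in_itv/= => /cg.
Qed.

Lemma Rint_split a m b g : a <= m <= b -> cts_on a b g ->
  \int[mu]_(x in `[a, b]) g x = \int[mu]_(x in `[a, m]) g x + \int[mu]_(x in `[m, b]) g x.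
Proof.
move=> /andP[am mb] cg.
have := @Rintegral_itvB R g (BLeft a) (BRight b) m (cts_integrable cg).
rewrite !bnd_simp => /(_ am mb) => /(canRL (subrK _)) ->.
rewrite addrC; congr (_ + _); apply: Rintegral_itv_obnd_cbnd.
apply: integrableS (cts_integrable cg) => //.
apply: subset_itv => //; by rewrite bnd_simp.
Qed.

Lemma Rint_cst a b k : a <= b -> \int[mu]_(x in `[a, b]) (cst k x) = k * (b - a).
Proof.
move=> ab; rewrite Rintegral_cst//= lebesgue_measure_itv/= lte_fin.
by case: ltgtP ab => // ->; rewrite subrr.
Qed.

Lemma cts_cst a b k : cts_on a b (cst k).
Proof. move=> x _; exact: cvg_cst. Qed.

Lemma ctsB a b g h : cts_on a b g -> cts_on a b h -> cts_on a b (fun x => g x - h x).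
Proof. by move=> cg ch x xab; apply: (@cvgB R R); [exact: cg|exact: ch]. Qed.

Lemma Rint_le a b g h : cts_on a b g -> cts_on a b h ->
  (forall x, a <= x <= b -> g x <= h x) ->
  \int[mu]_(x in `[a, b]) g x <= \int[mu]_(x in `[a, b]) h x.
Proof.
by move=> cg ch gh; apply: le_Rintegral => //; exact: cts_integrable.
Qed.

Lemma RintB a b g h : cts_on a b g -> cts_on a b h ->
  \int[mu]_(x in `[a, b]) (g x - h x) = \int[mu]_(x in `[a, b]) g x - \int[mu]_(x in `[a, b]) h x.
Proof. by move=> cg ch; apply: RintegralB => //; exact: cts_integrable. Qed.

Lemma Rint_near_cst a b g k (e : R) : a <= b -> cts_on a b g ->
  (forall x, a <= x <= b -> `|g x - k| <= e) ->
  `|\int[mu]_(x in `[a, b]) g x - k * (b - a)| <= e * (b - a).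
Proof.
move=> ab cg ge.
have h1 : \int[mu]_(x in `[a, b]) (cst (k - e) x) <= \int[mu]_(x in `[a, b]) g x.
  apply: Rint_le => //; first exact: cts_cst.
  by move=> x /ge; rewrite ler_norml /= => /andP[]; lra.
have h2 : \int[mu]_(x in `[a, b]) g x <= \int[mu]_(x in `[a, b]) (cst (k + e) x).
  apply: Rint_le => //; first exact: cts_cst.
  by move=> x /ge; rewrite ler_norml /= => /andP[]; lra.
by move: h1 h2; rewrite !Rint_cst// => h1 h2; rewrite ler_norml; apply/andP; split; lra.
Qed.

Lemma slice_re1 F x c : {for (x, c), continuous F} ->
  {for x, continuous (fun x => (F (x, c)).1)}.
Proof.
move=> cF; apply: (@continuous_comp _ _ R (fun x : R => (x, c)) (fun z => (F z).1)).
  exact: (@cvg_pair _ _ _ (nbhs x) (nbhs x) (nbhs c) _ _ _ id (fun=> c) cvg_id (@cvg_cst _ c _ (nbhs x) _)).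
exact: continuous_re.
Qed.

Lemma slice_im2 F x c : {for (x, c), continuous F} ->
  {for c, continuous (fun c => (F (x, c)).2)}.
Proof.
move=> cF; apply: (@continuous_comp _ _ R (fun c : R => (x, c)) (fun z => (F z).2)).
  exact: (@cvg_pair _ _ _ (nbhs c) (nbhs x) (nbhs c) _ _ _ (fun=> x) id (@cvg_cst _ x _ (nbhs c) _) cvg_id).
exact: continuous_im.
Qed.

Definition cts_rect a b c d F := forall x y, a <= x <= b -> c <= y <= d ->
  {for (x, y), continuous F}.

(* Real part of the contour integral of [F dz]; the imaginary part is [contour (- i F)]. *)
Definition contour F a b c d : R :=
  \int[mu]_(x in `[a, b]) ((F (x, c)).1 - (F (x, d)).1) -
  \int[mu]_(y in `[c, d]) ((F (b, y)).2 - (F (a, y)).2).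

Lemma contour_splitx F a b c d m : a <= m <= b -> c <= d -> cts_rect a b c d F ->
  contour F a b c d = contour F a m c d + contour F m b c d.
Proof.
move=> amb cd cF; have /andP[am mb] := amb; have ab := le_trans am mb.
rewrite /contour (Rint_split amb); last first.
  by apply: ctsB => x xab; apply: slice_re1; apply: cF => //; rewrite ?lexx ?cd.
have ct x : a <= x <= b -> cts_on c d (fun y => (F (x, y)).2).
  by move=> xab y ycd; apply: slice_im2; apply: cF.
rewrite !(@RintB c d); try by apply: ct; rewrite ?lexx ?am ?mb ?ab.
by ring.
Qed.

Lemma contour_splity F a b c d m : c <= m <= d -> a <= b -> cts_rect a b c d F ->
  contour F a b c d = contour F a b c m + contour F a b m d.
Proof.
move=> cmd ab cF; have /andP[cm md] := cmd; have cd := le_trans cm md.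
rewrite /contour (@Rint_split c m d)//; last first.
  by apply: ctsB => x xab; apply: slice_im2; apply: cF => //; rewrite ?lexx ?ab.
have ct y : c <= y <= d -> cts_on a b (fun x => (F (x, y)).1).
  by move=> xab y' ycd; apply: slice_re1; apply: cF.
rewrite !(@RintB a b); try by apply: ct; rewrite ?lexx ?cm ?md ?cd.
by ring.
Qed.

(** An affine map has zero contour: its horizontal and vertical parts both equal
    [be.2 * (b - a) * (d - c)] and cancel. Only the error [e] is left, once for each of the four
    sides. *)
Lemma contour_near_affine F a b c d (al be : R * R) (p : R * R) e :
  a <= b -> c <= d -> cts_rect a b c d F ->
  (forall z, a <= z.1 <= b -> c <= z.2 <= d ->
    cabs (F z - (al + cmul be (z - p))) <= e) ->
  `|contour F a b c d| <= 2 * e * ((b - a) + (d - c)).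
Proof.
move=> ab cd cF hF.
have cx y : c <= y <= d -> cts_on a b (fun x => (F (x, y)).1).
  by move=> xab y' ycd; apply: slice_re1; apply: cF.
have cy x : a <= x <= b -> cts_on c d (fun y => (F (x, y)).2).
  by move=> xab y ycd; apply: slice_im2; apply: cF.
have h1 : `|\int[mu]_(x in `[a, b]) ((F (x, c)).1 - (F (x, d)).1) -
    (be.2 * (d - c)) * (b - a)| <= (2 * e) * (b - a).
  apply: Rint_near_cst => //; first by apply: ctsB; apply: cx; rewrite lexx cd.
  move=> x xab.
  have /= g1 := le_trans (ler_cabs1 _) (hF (x, c) xab _).
  have /= g2 := le_trans (ler_cabs1 _) (hF (x, d) xab _).
  move: g1 g2; rewrite !lexx cd => /(_ isT) + /(_ isT); rewrite !ler_norml.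
  by move=> /andP[? ?] /andP[? ?]; apply/andP; split; lra.
have h2 : `|\int[mu]_(y in `[c, d]) ((F (b, y)).2 - (F (a, y)).2) -
    (be.2 * (b - a)) * (d - c)| <= (2 * e) * (d - c).
  apply: Rint_near_cst => //; first by apply: ctsB; apply: cy; rewrite lexx ab.
  move=> y ycd.
  have /= g1 := le_trans (ler_cabs2 _) (hF (a, y) _ ycd).
  have /= g2 := le_trans (ler_cabs2 _) (hF (b, y) _ ycd).
  move: g1 g2; rewrite !lexx ab => /(_ isT) + /(_ isT); rewrite !ler_norml.
  by move=> /andP[? ?] /andP[? ?]; apply/andP; split; lra.
rewrite /contour; move: h1 h2; rewrite !ler_norml.
set u := Rintegral _ _ _; set v := Rintegral _ _ _.
by move=> /andP[? ?] /andP[? ?]; apply/andP; split; lra.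
Qed.
End SegmentIntegrals.

(** * Goursat's theorem on rectangles, with finitely many exceptional points *)

Section Goursat.
Context {R : realType}.
Implicit Types (F : R * R -> R * R) (a b c d m k w : R).

Lemma nested_segments (u l : nat -> R) : (forall n, 0 <= l n) ->
  (forall n, u n <= u n.+1) -> (forall n, u n.+1 + l n.+1 <= u n + l n) ->
  exists p, forall n, u n <= p <= u n + l n.
Proof.
move=> l0 hu hl.
have umono (n m : nat) : (n <= m)%N -> u n <= u m.
  by move=> /subnK <-; elim: (m - n)%N => // k IH; exact: le_trans IH (hu _).
have vmono (n m : nat) : (n <= m)%N -> u m + l m <= u n + l n.
  by move=> /subnK <-; elim: (m - n)%N => // k IH; exact: le_trans (hl _) IH.
have uv (n m : nat) : u n <= u m + l m.
  have [nm|mn] := leqP n m; first by rewrite (le_trans (umono _ _ nm))// lerDl.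
  by rewrite (le_trans _ (vmono _ _ (ltnW mn)))// lerDl.
have hs n : ubound (range u) (u n + l n) by move=> _ [m _ <-].
exists (sup (range u)) => n; apply/andP; split.
  by apply: ub_le_sup; [exists (u 0 + l 0)|exists n].
by apply: ge_sup => //; exists (u 0); exists 0%N.
Qed.

Lemma half_pow_small (S e : R) : 0 <= S -> 0 < e -> exists n : nat, S / 2 ^+ n < e.
Proof.
move=> S0 e0; have Se : 0 <= S / e by rewrite divr_ge0// ltW.
exists (Num.Def.archi_bound (S / e)); rewrite ltr_pdivrMr ?exprn_gt0// mulrC -ltr_pdivrMr//.
apply: lt_le_trans (archi_boundP Se) _.
by rewrite -natrX ler_nat ltnW// ltn_expl.
Qed.

Lemma contour_degx F a c d : contour F a a c d = 0.
Proof.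
rewrite /contour [X in _ - X](_ : _ = 0).
  by rewrite set_itv1 Rintegral_set1 subr0.
rewrite -[RHS](Rintegral_set0 lebesgue_measure (fun=> 0)) /Rintegral integral_set0.
by under eq_integral do rewrite subrr; rewrite integral0.
Qed.

Lemma contour_degy F a b c : contour F a b c c = 0.
Proof.
rewrite /contour [X in X - _](_ : _ = 0).
  by rewrite set_itv1 Rintegral_set1 subr0.
rewrite -[RHS](Rintegral_set0 lebesgue_measure (fun=> 0)) /Rintegral integral_set0.
by under eq_integral do rewrite subrr; rewrite integral0.
Qed.

Lemma cts_rectS F a b c d a' b' c' d' : a <= a' -> b' <= b -> c <= c' -> d' <= d ->
  cts_rect a b c d F -> cts_rect a' b' c' d' F.
Proof.
move=> aa bb cc dd cF x y /andP[? ?] /andP[? ?]; apply: cF.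
  by apply/andP; split; lra.
by apply/andP; split; lra.
Qed.

(** The contours of the four quarters add up to the whole, because the inner sides cancel; so they
    cannot all be smaller than a quarter of it. *)
Lemma contour_quarter F a b c d w k : 0 <= w -> 0 <= k -> b = a + 2 * w -> d = c + 2 * k ->
  cts_rect a b c d F ->
  exists x y, [/\ (x = a \/ x = a + w), (y = c \/ y = c + k) &
   `|contour F a b c d| <= 4 * `|contour F x (x + w) y (y + k)|].
Proof.
move=> w0 k0 -> -> cF; apply: contrapT => hN.
have h x y : (x = a \/ x = a + w) -> (y = c \/ y = c + k) ->
    4 * `|contour F x (x + w) y (y + k)| < `|contour F a (a + 2 * w) c (c + 2 * k)|.
  by move=> hx hy; rewrite ltNge; apply/negP => hle; apply: hN; exists x, y.
have := h a c (or_introl erefl) (or_introl erefl).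
have := h a _ (or_introl erefl) (or_intror erefl).
have := h _ c (or_intror erefl) (or_introl erefl).
have := h _ _ (or_intror erefl) (or_intror erefl).
have -> : contour F a (a + 2 * w) c (c + 2 * k) =
  contour F a (a + w) c (c + k) + contour F a (a + w) (c + k) (c + k + k) +
  (contour F (a + w) (a + w + w) c (c + k) +
   contour F (a + w) (a + w + w) (c + k) (c + k + k)).
  rewrite (@contour_splitx _ F a _ _ _ (a + w))//; try by (try (apply/andP; split)); lra.
  have -> : a + 2 * w = a + w + w by ring.
  have -> : c + 2 * k = c + k + k by ring.
  rewrite (@contour_splity _ F a (a + w) _ _ (c + k))//; last 3 first.
  - by apply/andP; split; lra.
  - by lra.
  - by apply: cts_rectS cF; lra.
  rewrite (@contour_splity _ F (a + w) _ _ _ (c + k))//.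
  - by apply/andP; split; lra.
  - by lra.
  - by apply: cts_rectS cF; lra.
move=> h1 h2 h3 h4.
have tri (p q r t : R) : `|p + q + (r + t)| <= `|p| + `|q| + `|r| + `|t|.
  by have := ler_normD (p + q) (r + t); have := ler_normD p q; have := ler_normD r t; lra.
have := tri (contour F a (a + w) c (c + k)) (contour F a (a + w) (c + k) (c + k + k))
  (contour F (a + w) (a + w + w) c (c + k)) (contour F (a + w) (a + w + w) (c + k) (c + k + k)).
by lra.
Qed.

Theorem goursat F a b c d : a <= b -> c <= d ->
  (forall x y, a <= x <= b -> c <= y <= d -> cdiff F (x, y)) -> contour F a b c d = 0.
Proof.
move=> ab cd dF; apply: contrapT => /eqP; rewrite -normr_gt0 => K0.
set K := `|contour F a b c d| in K0.
have cF : cts_rect a b c d F by move=> x y hx hy; apply: cdiff_continuous; exact: dF.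
pose W n : R := (b - a) / 2 ^+ n; pose H n : R := (d - c) / 2 ^+ n.
have p2 n : 0 < 2 ^+ n :> R by rewrite exprn_gt0.
have W0 n : 0 <= W n by rewrite divr_ge0 ?subr_ge0// ltW.
have H0 n : 0 <= H n by rewrite divr_ge0 ?subr_ge0// ltW.
have WS n : W n = 2 * W n.+1.
  by rewrite /W exprS; field; rewrite lt0r_neq0.
have HS n : H n = 2 * H n.+1.
  by rewrite /H exprS; field; rewrite lt0r_neq0.
(* [z] is the lower left corner of a piece at level [n]; the factor [(2 ^+ n) ^+ 2] records that
   each subdivision loses at most a factor 4. *)
pose Inv n (z : R * R) := [/\ a <= z.1, z.1 + W n <= b, c <= z.2, z.2 + H n <= d &
   K <= (2 ^+ n) ^+ 2 * `|contour F z.1 (z.1 + W n) z.2 (z.2 + H n)| ].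
(* The invariant is a premise inside the existential, so that [choice] yields a total successor
   function. *)
have step (nz : nat * (R * R)) : exists z' : R * R, Inv nz.1 nz.2 ->
   [/\ Inv nz.1.+1 z', nz.2.1 <= z'.1, z'.1 + W nz.1.+1 <= nz.2.1 + W nz.1,
      nz.2.2 <= z'.2 & z'.2 + H nz.1.+1 <= nz.2.2 + H nz.1].
  case: nz => n z /=.
  have [[az zb cz zd hK]|nI] := pselect (Inv n z); last by exists 0 => /nI.
  have := @contour_quarter F z.1 (z.1 + W n) z.2 (z.2 + H n) (W n.+1) (H n.+1) (W0 _) (H0 _).
  rewrite {1}(WS n) {1}(HS n) => /(_ erefl erefl (cts_rectS az zb cz zd cF)) [x [y [hx hy hq]]].
  exists (x, y) => _ /=.
  have x1 : z.1 <= x by case: hx => ->; rewrite ?lerDl.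
  have x2 : x + W n.+1 <= z.1 + W n by rewrite (WS n); have := W0 n.+1; case: hx => ->; lra.
  have y1 : z.2 <= y by case: hy => ->; rewrite ?lerDl.
  have y2 : y + H n.+1 <= z.2 + H n by rewrite (HS n); have := H0 n.+1; case: hy => ->; lra.
  split => //; split => //=; [exact: le_trans az x1|exact: le_trans x2 zb
    |exact: le_trans cz y1|exact: le_trans y2 zd|].
  apply: le_trans hK _.
  rewrite (exprS 2 n).
  have -> : (2 * 2 ^+ n) ^+ 2 * `|contour F x (x + W n.+1) y (y + H n.+1)| =
   (2 ^+ n) ^+ 2 * (4 * `|contour F x (x + W n.+1) y (y + H n.+1)|) by ring.
  by rewrite ler_wpM2l// sqr_ge0.
have [st hst] := choice step.
pose s := fix s n := if n is m.+1 then st (m, s m) else (a, c).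
have Is n : Inv n (s n).
  elim: n => [|n IH]; last by have [] := hst (n, s n) IH.
  by rewrite /Inv /= /W /H expr0 !divr1 expr1n mul1r (addrC a) (addrC c) !subrK.
have [px hpx] : exists p, forall n, (s n).1 <= p <= (s n).1 + W n.
  by apply: nested_segments => // n; have [] := hst (n, s n) (Is n).
have [py hpy] : exists p, forall n, (s n).2 <= p <= (s n).2 + H n.
  by apply: nested_segments => // n; have [] := hst (n, s n) (Is n).
have [Q /ccontP cQ FE] : cdiff F (px, py).
  have [] := Is 0%N => /=; move: (hpx 0%N) (hpy 0%N) => /= /andP[? ?] /andP[? ?] ? ? ? ? ?.
  by apply: dF; apply/andP; split; lra.
pose S := (b - a) + (d - c).
have S0 : 0 <= S by rewrite /S; lra.
(* A piece at level [n] has half-perimeter [S / 2^n], so the affine estimate gives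
   [K <= 4^n * 2 e (S / 2^n)^2 = 2 e S^2], and this [e] makes the right side smaller than [K]. *)
pose e := K / (2 * S ^+ 2 + 1).
have S1 : 0 < 2 * S ^+ 2 + 1 by have := sqr_ge0 S; lra.
have e0 : 0 < e by rewrite divr_gt0.
have [del del0 hdel] := cQ _ e0.
have [n hn] := half_pow_small S0 del0.
have [az zb cz zd hK] := Is n.
have SE : S / 2 ^+ n = W n + H n by rewrite /S mulrDl.
have := @contour_near_affine _ F (s n).1 ((s n).1 + W n) (s n).2 ((s n).2 + H n)
  (F (px, py)) (Q (px, py)) (px, py) (e * (S / 2 ^+ n)).
rewrite !lerDl => /(_ (W0 n) (H0 n) (cts_rectS az zb cz zd cF)) hc.
have {}hc : `|contour F (s n).1 ((s n).1 + W n) (s n).2 ((s n).2 + H n)| <=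
   2 * (e * (S / 2 ^+ n)) * (S / 2 ^+ n).
  rewrite {2}SE -[X in _ * (X + _)](addrK (s n).1) -[X in _ * (_ + X)](addrK (s n).2).
  rewrite (addrC (W n)) (addrC (H n)); apply: hc => z hz1 hz2.
  have zS : cabs (z - (px, py)) <= S / 2 ^+ n.
    apply: le_trans (cabs_le_sum _) _; rewrite SE; apply: lerD => /=.
      have := hpx n; rewrite ler_norml; move: hz1 => /andP[h1 h2] /andP[h3 h4].
      clear -h1 h2 h3 h4; by apply/andP; split; lra.
    have := hpy n; rewrite ler_norml; move: hz2 => /andP[h1 h2] /andP[h3 h4].
    clear -h1 h2 h3 h4; by apply/andP; split; lra.
  rewrite FE opprD addrACA subrr add0r -cmulBl cabsM; apply: ler_pM => //; try exact: cabs_ge0.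
  by apply/ltW/hdel; exact: le_lt_trans zS hn.
have : K <= 2 * e * S ^+ 2.
  apply: le_trans hK _; apply: le_trans (_ : _ <= (2 ^+ n) ^+ 2 * (2 * (e * (S / 2 ^+ n)) * (S / 2 ^+ n))) _.
    by rewrite ler_wpM2l// sqr_ge0.
  by rewrite le_eqVlt; apply/orP; left; apply/eqP; field; rewrite lt0r_neq0.
have -> : 2 * e * S ^+ 2 = K * ((2 * S ^+ 2) / (2 * S ^+ 2 + 1)).
  by rewrite /e; field; rewrite lt0r_neq0.
rewrite leNgt => /negP; apply; rewrite gtr_pMr// ltr_pdivrMr// mul1r; lra.
Qed.

(** Meant for difference quotients, which are continuous everywhere but differentiable only off
    their centres. A rectangle shrinking to an exceptional point has vanishing contour by continuity
    alone. The points form a list because quotients of quotients occur. *)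
Theorem goursat_punctured F (s : seq (R * R)) a b c d : a <= b -> c <= d ->
  cts_rect a b c d F ->
  (forall x y, a <= x <= b -> c <= y <= d -> (x, y) \notin s -> cdiff F (x, y)) ->
  contour F a b c d = 0.
Proof.
elim: s a b c d => [|p s IH] a b c d ab cd cF dF.
  by apply: goursat => // x y hx hy; exact: dF.
have IH' a' b' c' d' : a' <= b' -> c' <= d' -> a <= a' -> b' <= b -> c <= c' -> d' <= d ->
   (forall x y, a' <= x <= b' -> c' <= y <= d' -> (x, y) != p) -> contour F a' b' c' d' = 0.
  move=> ab' cd' aa bb cc dd hp; apply: IH => //; first exact: cts_rectS cF.
  move=> x y hx hy xys; apply: dF; last by rewrite in_cons negb_or hp.
    by move: hx => /andP[? ?]; apply/andP; split; lra.
  by move: hy => /andP[? ?]; apply/andP; split; lra.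
have [/andP[px py]|pN] := boolP ((a <= p.1 <= b) && (c <= p.2 <= d)); last first.
  apply: IH' => // x y hx hy; apply: contra pN => /eqP <- /=.
  by rewrite hx hy.
have [/andP[ap pb] /andP[cp pd]] := (px, py).
(* Four strips are cut off around [p]. Each is either degenerate, with contour zero, or misses [p]
   and falls under the induction hypothesis. *)
have shrink del : 0 < del -> contour F a b c d =
    contour F (Num.max a (p.1 - del)) (Num.min b (p.1 + del))
              (Num.max c (p.2 - del)) (Num.min d (p.2 + del)).
  move=> del0; set a' := Num.max _ _; set b' := Num.min _ _.
  set c' := Num.max _ _; set d' := Num.min _ _.
  have aa : a <= a' by rewrite /a' le_max lexx.
  have bb : b' <= b by rewrite /b' ge_min lexx.
  have cc : c <= c' by rewrite /c' le_max lexx.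
  have dd : d' <= d by rewrite /d' ge_min lexx.
  have ap' : a' <= p.1 by rewrite /a' ge_max ap; lra.
  have pb' : p.1 <= b' by rewrite /b' le_min pb; lra.
  have cp' : c' <= p.2 by rewrite /c' ge_max cp; lra.
  have pd' : p.2 <= d' by rewrite /d' le_min pd; lra.
  have L : contour F a a' c d = 0.
    have [->|na] := eqVneq a' a; first exact: contour_degx.
    have a'E : a' = p.1 - del.
      by move: na; rewrite /a'; case: (leP a (p.1 - del)) => //; rewrite eqxx.
    apply: IH' => //; first lra.
    move=> x y /andP[? ?] _; apply/eqP => /(congr1 fst) /=; lra.
  have Rr : contour F b' b c d = 0.
    have [->|na] := eqVneq b' b; first exact: contour_degx.
    have b'E : b' = p.1 + del.
      by move: na; rewrite /b'; case: (leP b (p.1 + del)) => //; rewrite eqxx.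
    apply: IH' => //; first lra.
    move=> x y /andP[? ?] _; apply/eqP => /(congr1 fst) /=; lra.
  have B : contour F a' b' c c' = 0.
    have [->|na] := eqVneq c' c; first exact: contour_degy.
    have c'E : c' = p.2 - del.
      by move: na; rewrite /c'; case: (leP c (p.2 - del)) => //; rewrite eqxx.
    apply: IH' => //; first exact: le_trans ap' pb'.
      exact: le_trans (le_trans cp' pd') dd.
    move=> x y _ /andP[? ?]; apply/eqP => /(congr1 snd) /=; lra.
  have T : contour F a' b' d' d = 0.
    have [->|na] := eqVneq d' d; first exact: contour_degy.
    have d'E : d' = p.2 + del.
      by move: na; rewrite /d'; case: (leP d (p.2 + del)) => //; rewrite eqxx.
    apply: IH' => //; first exact: le_trans ap' pb'.
      exact: le_trans cc (le_trans cp' pd').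
    move=> x y _ /andP[? ?]; apply/eqP => /(congr1 snd) /=; lra.
  rewrite (@contour_splitx _ F a b c d a')//; last by rewrite aa; lra.
  rewrite (@contour_splitx _ F a' b c d b')//; last 2 first.
  - by rewrite bb andbT; lra.
  - exact: cts_rectS cF.
  rewrite (@contour_splity _ F a' b' c d c')//; last 3 first.
  - by rewrite cc; lra.
  - by lra.
  - exact: cts_rectS cF.
  rewrite (@contour_splity _ F a' b' c' d d')//; last 3 first.
  - by rewrite dd andbT; lra.
  - by lra.
  - by apply: cts_rectS cF => //; lra.
  by rewrite L Rr B T !add0r !addr0.
have /ccontP/(_ 1 ltr01)[del1 del10 hdel] : {for p, continuous F}.
  by rewrite (surjective_pairing p); exact: cF.
apply/eqP; rewrite -normr_eq0 -[_ == 0]negbK; apply/negP => /eqP/eqP n0.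
have K0 : 0 < `|contour F a b c d| by rewrite lt_neqAle eq_sym n0 normr_ge0.
set K := `|contour F a b c d| in K0 n0.
(* The bound [del1 / 4] keeps the small rectangle where [F] is within 1 of [F p]; its contour is
   then at most [8 * del], and [K / 16] makes that at most [K / 2]. *)
pose del := Num.min (del1 / 4) (K / 16).
have del0 : 0 < del by rewrite lt_min !divr_gt0.
have dd1 : del <= del1 / 4 by rewrite /del ge_min lexx.
have dK : del <= K / 16 by rewrite /del ge_min lexx orbT.
have : K <= 2 * 1 * (del * 2 + del * 2).
  rewrite /K (shrink _ del0).
  set a' := Num.max _ _; set b' := Num.min _ _.
  set c' := Num.max _ _; set d' := Num.min _ _.
  have aa : a <= a' by rewrite /a' le_max lexx.
  have bb : b' <= b by rewrite /b' ge_min lexx.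
  have cc : c <= c' by rewrite /c' le_max lexx.
  have dd : d' <= d by rewrite /d' ge_min lexx.
  have ap' : a' <= p.1 by rewrite /a' ge_max ap; lra.
  have pb' : p.1 <= b' by rewrite /b' le_min pb; lra.
  have cp' : c' <= p.2 by rewrite /c' ge_max cp; lra.
  have pd' : p.2 <= d' by rewrite /d' le_min pd; lra.
  have a1 : p.1 - del <= a' by rewrite /a' le_max lexx orbT.
  have b1 : b' <= p.1 + del by rewrite /b' ge_min lexx orbT.
  have c1 : p.2 - del <= c' by rewrite /c' le_max lexx orbT.
  have d1 : d' <= p.2 + del by rewrite /d' ge_min lexx orbT.
  apply: le_trans (@contour_near_affine _ F a' b' c' d' (F p) 0 p 1 (le_trans ap' pb')
    (le_trans cp' pd') (cts_rectS aa bb cc dd cF) _) _; last first.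
  - by clear -a1 b1 c1 d1; lra.
  - move=> z /andP[z1 z2] /andP[z3 z4]; rewrite cmulC cmul0 addr0; apply/ltW/hdel.
    apply: le_lt_trans (cabs_le_sum _) _ => /=.
    have : `|z.1 - p.1| <= del.
      by rewrite ler_norml; clear -z1 z2 a1 b1; apply/andP; split; lra.
    have : `|z.2 - p.2| <= del.
      by rewrite ler_norml; clear -z3 z4 c1 d1; apply/andP; split; lra.
    by clear -dd1 del10; lra.
by lra.
Qed.
End Goursat.

(** * A Cauchy inequality on rectangles *)

Section CauchyInequality.
Context {R : realType}.
Implicit Types (F : R * R -> R * R) (a b c d m k : R) (z v w : R * R).
Notation mu := (@lebesgue_measure R).

Lemma cdiff_eq_near (f g : R * R -> R * R) z d : 0 < d ->
  (forall v, cabs (v - z) < d -> f v = g v) -> cdiff g z -> cdiff f z.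
Proof.
move=> d0 fg [Q cQ gE]; apply: (cdiff_near d0 cQ) => v vz.
by rewrite !fg ?subrr ?cabs0.
Qed.

Lemma continuous_eq_near (f g : R * R -> R * R) z d : 0 < d ->
  (forall v, cabs (v - z) < d -> f v = g v) -> {for z, continuous g} -> {for z, continuous f}.
Proof.
move=> d0 fg /ccontP cg; apply/ccontP => e /cg[d1 d10 h].
exists (Num.min d d1); first by rewrite lt_min d0.
by move=> v; rewrite lt_min => /andP[vd /h]; rewrite !fg ?subrr ?cabs0.
Qed.

Lemma diffquot_off (f Q : R * R -> R * R) z v :
  (forall w, f w = f z + cmul (Q w) (w - z)) -> v <> z ->
  forall w, cabs (w - v) < cabs (v - z) -> Q w = cmul (f w - f z) (cinv (w - z)).
Proof.
move=> fE vz w wv; rewrite fE addrAC subrr add0r.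
rewrite -cmulA cmulV ?cmul1// => /eqP; rewrite subr_eq0 => /eqP wz.
by move: wv; rewrite wz cabsBC ltxx.
Qed.

Lemma diffquot_cdiff (f Q : R * R -> R * R) z v :
  (forall w, f w = f z + cmul (Q w) (w - z)) -> v <> z -> cdiff f v -> cdiff Q v.
Proof.
move=> fE vz df; have vz0 : v - z <> 0 by apply/eqP; rewrite subr_eq0; apply/eqP.
apply: (cdiff_eq_near (cabs_gt0 vz0) (diffquot_off fE vz)).
apply: cdiffM; first by apply: cdiffB => //; exact: cdiff_cst.
by apply: cdiffV => //; apply: cdiffB; [exact: cdiff_id|exact: cdiff_cst].
Qed.

Lemma diffquot_continuous (f Q : R * R -> R * R) z v :
  (forall w, f w = f z + cmul (Q w) (w - z)) -> v <> z ->
  {for v, continuous f} -> {for v, continuous Q}.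
Proof.
move=> fE vz cf; have vz0 : v - z <> 0 by apply/eqP; rewrite subr_eq0; apply/eqP.
apply: (continuous_eq_near (cabs_gt0 vz0) (diffquot_off fE vz)).
apply: continuous_cmul; first exact: continuous_csubr.
by apply: continuous_cinv => //; exact: continuous_csub.
Qed.

(** Here [t] is the distance from the centre to the line of a side and [r] the offset along it, so
    the left side is the normal part of [(g - g0) / (w - z)]. Cauchy-Schwarz and [|w - z| >= s]
    control the term in [g]; [t / (t^2 + r^2) >= 1 / (18 s)] controls the term in [g0]. *)
Lemma kernel_side_bound (g : R * R) (g0 t r s : R) : 0 <= g0 -> 0 < s -> s <= t <= 3 * s ->
  `|r| <= 3 * s ->
  ((g.1 - g0) * t + g.2 * r) / (t ^+ 2 + r ^+ 2) <= cabs g / s - g0 / (18 * s).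
Proof.
move=> g00 s0 /andP[st ts]; rewrite ler_norml => /andP[r1 r2].
have t0 : 0 < t by lra.
pose N := cabs (t, r); have NE : N ^+ 2 = t ^+ 2 + r ^+ 2 by rewrite cabs_sqr.
have N0 : 0 <= N := cabs_ge0 _.
have Nt : t <= N by apply: le_trans (ler_cabs1 (t, r)); rewrite /= ler_norm.
have Np : 0 < N by lra.
have h1 : g.1 * t + g.2 * r <= cabs g * N := cabs_dot g (t, r).
have -> : (g.1 - g0) * t + g.2 * r = (g.1 * t + g.2 * r) - g0 * t by ring.
rewrite mulrBl; apply: lerB.
  rewrite -NE ler_pdivrMr ?exprn_gt0//; apply: le_trans h1 _.
  have -> : cabs g / s * N ^+ 2 = (cabs g * N) * (N / s).
    by field; rewrite lt0r_neq0.
  by rewrite ler_peMr ?mulr_ge0 ?cabs_ge0// ler_pdivlMr// mul1r; lra.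
rewrite ler_pdivrMr ?mulr_gt0//.
have -> : g0 * t / (t ^+ 2 + r ^+ 2) * (18 * s) = g0 * ((18 * s * t) / (t ^+ 2 + r ^+ 2)).
  by ring.
rewrite ler_peMr// ler_pdivlMr ?mul1r; last by rewrite -NE exprn_gt0.
have : r ^+ 2 <= (3 * s) ^+ 2 by nra.
by nra.
Qed.

Lemma cts_cabs_x F a b y : (forall x, a <= x <= b -> {for (x, y), continuous F}) ->
  cts_on a b (fun x => cabs (F (x, y))).
Proof.
move=> cF x /cF cx.
apply: (@continuous_comp _ _ R (fun x : R => (x, y)) (fun z => cabs (F z))).
  exact: (@cvg_pair _ _ _ (nbhs x) (nbhs x) (nbhs y) _ _ _ id (fun=> y) cvg_id (@cvg_cst _ y _ (nbhs x) _)).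
by apply: (@continuous_comp _ _ R F (@cabs R)) => //; exact: continuous_cabs.
Qed.

Lemma cts_cabs_y F a b x : (forall y, a <= y <= b -> {for (x, y), continuous F}) ->
  cts_on a b (fun y => cabs (F (x, y))).
Proof.
move=> cF y /cF cx.
apply: (@continuous_comp _ _ R (fun y : R => (x, y)) (fun z => cabs (F z))).
  exact: (@cvg_pair _ _ _ (nbhs y) (nbhs x) (nbhs y) _ _ _ (fun=> x) id (@cvg_cst _ x _ (nbhs y) _) cvg_id).
by apply: (@continuous_comp _ _ R F (@cabs R)) => //; exact: continuous_cabs.
Qed.

Lemma Rint_le_affine a b (g h1 h2 : R -> R) (u k : R) : a <= b ->
  cts_on a b g -> cts_on a b h1 -> cts_on a b h2 ->
  (forall x, a <= x <= b -> g x <= u * (h1 x + h2 x) - k) ->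
  \int[mu]_(x in `[a, b]) g x <=
  u * (\int[mu]_(x in `[a, b]) h1 x + \int[mu]_(x in `[a, b]) h2 x) - k * (b - a).
Proof.
move=> ab cg c1 c2 h.
have c12 : cts_on a b (fun x => h1 x + h2 x).
  by move=> x xab; apply: (@cvgD R R); [exact: c1|exact: c2].
have cu : cts_on a b (fun x => u * (h1 x + h2 x)).
  by move=> x xab; apply: (@cvgM R); [exact: cvg_cst|exact: c12].
apply: le_trans (Rint_le cg (ctsB cu (@cts_cst _ a b k)) h) _.
rewrite RintB//; last exact: cts_cst.
rewrite RintegralZl//; last exact: cts_integrable.
rewrite RintegralD//; [|exact: cts_integrable|exact: cts_integrable].
by rewrite -(Rint_cst k ab).
Qed.

(** The difference quotient of [G = conj (F z) * F] at [z] has zero contour by punctured Goursat.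
    Bounding its integrand on each side by [kernel_side_bound], with [g0 = |F z|^2], and cancelling
    one factor [|F z|] leaves the inequality. *)
Theorem cauchy_rect F (s : seq (R * R)) a b c d z r : 0 < r ->
  z.1 - 3 * r <= a <= z.1 - r -> z.1 + r <= b <= z.1 + 3 * r ->
  z.2 - 3 * r <= c <= z.2 - r -> z.2 + r <= d <= z.2 + 3 * r ->
  cts_rect a b c d F ->
  (forall x y, a <= x <= b -> c <= y <= d -> (x, y) \notin s -> cdiff F (x, y)) ->
  cdiff F z ->
  4 * r * cabs (F z) <= 9 *
   (\int[mu]_(x in `[a, b]) cabs (F (x, c)) + \int[mu]_(x in `[a, b]) cabs (F (x, d)) +
   (\int[mu]_(y in `[c, d]) cabs (F (a, y)) + \int[mu]_(y in `[c, d]) cabs (F (b, y)))).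
Proof.
move=> r0 /andP[a1 a2] /andP[b1 b2] /andP[c1 c2] /andP[d1 d2] cF dF dz.
have [Fz0|Fz0] := eqVneq (F z) 0.
  rewrite Fz0 cabs0 mulr0 mulr_ge0// !addr_ge0// Rintegral_ge0// => x _; exact: cabs_ge0.
pose lam : R * R := ((F z).1, - (F z).2).
have cabs_lam : cabs lam = cabs (F z) by rewrite /cabs /lam /= sqrrN.
pose G w := cmul lam (F w).
have GF w : cabs (G w) = cabs (F z) * cabs (F w) by rewrite /G cabsM cabs_lam.
pose g0 := cabs (F z) ^+ 2.
have Gz : G z = (g0, 0).
  by rewrite /G /cmul /lam /g0 cabs_sqr /=; congr pair; ring.
have cG : cts_rect a b c d G.
  move=> x y hx hy; apply: continuous_cmul; last exact: cF.
  exact: continuous_ccst.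
have dG w : cdiff F w -> cdiff G w by move=> dw; apply: cdiffM => //; exact: cdiff_cst.
have [Q cQ GE] : cdiff G z by exact: dG.
(* [contour] is a real part. The part of the integral of [Q] in which [1 / (w - z)] has a definite
   sign is the imaginary one, that is, the contour of [- i Q]. *)
pose H w := cmul (0, -1) (Q w).
have H1 w : (H w).1 = (Q w).2 by rewrite /H /cmul /=; ring.
have H2 w : (H w).2 = - (Q w).1 by rewrite /H /cmul /=; ring.
have cQ' : cts_rect a b c d Q.
  move=> x y hx hy; have [->//|xyz] := pselect ((x, y) = z).
  by apply: (diffquot_continuous GE xyz); exact: cG.
have H0 : contour H a b c d = 0.
  apply: (@goursat_punctured _ _ (z :: s)); [lra|lra| |].
    by move=> x y hx hy; apply: continuous_cmul; [exact: continuous_ccst|exact: cQ'].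
  move=> x y hx hy; rewrite in_cons negb_or => /andP[/eqP xyz xys].
  apply: cdiffM; first exact: cdiff_cst.
  by apply: (diffquot_cdiff GE xyz); apply: dG; exact: dF.
have QE x y : (x, y) <> z -> Q (x, y) = cmul (G (x, y) - G z) (cinv ((x, y) - z)).
  move=> xyz; apply: (diffquot_off GE xyz).
  by rewrite subrr cabs0; apply: cabs_gt0; apply/eqP; rewrite subr_eq0; apply/eqP.
have g00 : 0 <= g0 by rewrite sqr_ge0.
pose k := g0 / (18 * r).
have up x y t u : t ^+ 2 + u ^+ 2 = (x - z.1) ^+ 2 + (y - z.2) ^+ 2 ->
   r <= t <= 3 * r -> `|u| <= 3 * r ->
  (((G (x, y)).1 - g0) * t + (G (x, y)).2 * u) / ((x - z.1) ^+ 2 + (y - z.2) ^+ 2) <=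
   cabs (F z) / r * cabs (F (x, y)) - k.
  move=> tu ht hu; rewrite -tu.
  apply: le_trans (kernel_side_bound _ g00 r0 ht hu) _.
  by rewrite GF /k mulrAC.
have Q2 x y : (x, y) <> z -> (Q (x, y)).2 =
   (((G (x, y)).1 - g0) * - (y - z.2) + (G (x, y)).2 * (x - z.1)) / ((x - z.1) ^+ 2 + (y - z.2) ^+ 2).
  by move=> /QE ->; rewrite Gz /cmul /cinv cabs_sqr /=; ring.
have Q1 x y : (x, y) <> z -> (Q (x, y)).1 =
   (((G (x, y)).1 - g0) * (x - z.1) + (G (x, y)).2 * (y - z.2)) / ((x - z.1) ^+ 2 + (y - z.2) ^+ 2).
  by move=> /QE ->; rewrite Gz /cmul /cinv cabs_sqr /=; ring.
set m := cabs (F z) / r in up *.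
have bx x : a <= x <= b -> (H (x, c)).1 - (H (x, d)).1 <=
    m * (cabs (F (x, c)) + cabs (F (x, d))) - 2 * k.
  move=> /andP[x1 x2].
  have n1 : (x, c) <> z by move=> /(congr1 snd) /=; lra.
  have n2 : (x, d) <> z by move=> /(congr1 snd) /=; lra.
  have xz : `|x - z.1| <= 3 * r by rewrite ler_norml; apply/andP; split; lra.
  have u1 : (H (x, c)).1 <= m * cabs (F (x, c)) - k.
    rewrite H1 Q2//; apply: up => //; first by ring.
    by apply/andP; split; lra.
  have u2 : - (H (x, d)).1 <= m * cabs (F (x, d)) - k.
    rewrite H1 Q2// -mulNr [X in X / _](_ : _ =
      ((G (x, d)).1 - g0) * (d - z.2) + (G (x, d)).2 * - (x - z.1)); last by ring.
    apply: up; first by ring.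
      by apply/andP; split; lra.
    by rewrite normrN.
  by lra.
have by_ y : c <= y <= d -> (H (a, y)).2 - (H (b, y)).2 <=
    m * (cabs (F (a, y)) + cabs (F (b, y))) - 2 * k.
  move=> /andP[y1 y2].
  have n1 : (a, y) <> z by move=> /(congr1 fst) /=; lra.
  have n2 : (b, y) <> z by move=> /(congr1 fst) /=; lra.
  have yz : `|y - z.2| <= 3 * r by rewrite ler_norml; apply/andP; split; lra.
  have u1 : (H (a, y)).2 <= m * cabs (F (a, y)) - k.
    rewrite H2 Q1// -mulNr [X in X / _](_ : _ =
      ((G (a, y)).1 - g0) * - (a - z.1) + (G (a, y)).2 * - (y - z.2)); last by ring.
    apply: up; first by ring.
      by apply/andP; split; lra.
    by rewrite normrN.
  have u2 : - (H (b, y)).2 <= m * cabs (F (b, y)) - k.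
    rewrite H2 Q1// opprK; apply: up => //.
    by apply/andP; split; lra.
  by lra.
have ab : a <= b by lra.
have cd : c <= d by lra.
have cH : cts_rect a b c d H.
  by move=> x y hx hy; apply: continuous_cmul; [exact: continuous_ccst|exact: cQ'].
have sx y : c <= y <= d -> cts_on a b (fun x => (H (x, y)).1).
  by move=> hy x hx; apply: slice_re1; exact: cH.
have sy x : a <= x <= b -> cts_on c d (fun y => (H (x, y)).2).
  by move=> hx y hy; apply: slice_im2; exact: cH.
have fx y : c <= y <= d -> cts_on a b (fun x => cabs (F (x, y))).
  by move=> hy; apply: cts_cabs_x => x hx; exact: cF.
have fy x : a <= x <= b -> cts_on c d (fun y => cabs (F (x, y))).
  by move=> hx; apply: cts_cabs_y => y hy; exact: cF.
have aab : a <= a <= b by rewrite lexx.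
have bab : a <= b <= b by rewrite lexx andbT.
have ccd : c <= c <= d by rewrite lexx.
have dcd : c <= d <= d by rewrite lexx andbT.
have Ix := Rint_le_affine ab (ctsB (sx _ ccd) (sx _ dcd)) (fx _ ccd) (fx _ dcd) bx.
have Iy := Rint_le_affine cd (ctsB (sy _ aab) (sy _ bab)) (fy _ aab) (fy _ bab) by_.
move: H0; rewrite /contour => /eqP; rewrite subr_eq0 => /eqP H0.
move: Iy; rewrite RintB; [|exact: sy|exact: sy].
rewrite -opprB -RintB; [|exact: sy|exact: sy].
rewrite -H0 => Iy; move: Ix Iy.
move: (Rintegral _ _ _) => X.
set P1 := Rintegral _ _ _; set P2 := Rintegral _ _ _.
set P3 := Rintegral _ _ _; set P4 := Rintegral _ _ _ => Ix Iy.
have Fp : 0 < cabs (F z) by apply: cabs_gt0; exact/eqP.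
have k0 : 0 <= k by rewrite divr_ge0// mulr_ge0// ltW.
(* Width and height are both at least [2 * r]. *)
have : 2 * k * (4 * r) <= m * (P1 + P2 + (P3 + P4)).
  have : 0 <= 2 * k * ((b - a) + (d - c) - 4 * r) by apply: mulr_ge0; [clear -k0; lra|clear -a2 b1 c2 d1; lra].
  by move: Ix Iy; clear; lra.
rewrite /k /m /g0.
have -> : 2 * (cabs (F z) ^+ 2 / (18 * r)) * (4 * r) = cabs (F z) / r * (r * 4 * cabs (F z) / 9).
  by field; rewrite lt0r_neq0.
rewrite ler_pM2l ?divr_gt0//; lra.
Qed.
End CauchyInequality.

(** * Lipschitz and second-order Taylor bounds from a bound on the function *)

Section TaylorEstimate.
Context {R : realType}.
Implicit Types (F f : R * R -> R * R) (z v w : R * R) (M r e : R).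
Notation mu := (@lebesgue_measure R).

Definition in_square z r w := `|w.1 - z.1| <= r /\ `|w.2 - z.2| <= r.

Lemma in_squareP z r w : in_square z r w <->
  (z.1 - r <= w.1 <= z.1 + r) /\ (z.2 - r <= w.2 <= z.2 + r).
Proof.
by rewrite /in_square !ler_norml; split => -[/andP[? ?] /andP[? ?]]; split; apply/andP; split; lra.
Qed.

Lemma cabs_in_square z r w : cabs (w - z) <= r -> in_square z r w.
Proof.
by move=> h; split; apply: le_trans h; [exact: (ler_cabs1 (w - z))|exact: (ler_cabs2 (w - z))].
Qed.

(** On the boundary of the square the difference quotient [Q] of [F] at [z] is at most [2 M / r].
    Seen from [w] the sides lie at distances between [r / 2] and [3 (r / 2)], so [cauchy_rect]
    carries the bound inside: each side integral is at most [4 M], whence [|Q w| <= 72 M / r]. *)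
Lemma lipschitz_punctured F (s : seq (R * R)) z w r M : 0 < r ->
  (forall v, in_square z r v -> {for v, continuous F}) ->
  (forall v, in_square z r v -> v \notin s -> cdiff F v) ->
  (forall v, in_square z r v -> cabs (F v) <= M) ->
  in_square z (r / 2) w -> cdiff F z -> cdiff F w ->
  cabs (F w - F z) <= 72 * M / r * cabs (w - z).
Proof.
move=> r0 cF dF FM wz dz dw.
have [->|wNz] := pselect (w = z); first by rewrite !subrr cabs0 mulr0.
have sqzz : in_square z r z by split; rewrite subrr normr0 ltW.
have M0 : 0 <= M by apply: le_trans (FM z sqzz); exact: cabs_ge0.
have [Q cQ FE] := dz.
have sqE (x y : R) : z.1 - r <= x <= z.1 + r -> z.2 - r <= y <= z.2 + r -> in_square z r (x, y).
  by move=> hx hy; apply/in_squareP.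
have cQ' : cts_rect (z.1 - r) (z.1 + r) (z.2 - r) (z.2 + r) Q.
  move=> x y hx hy; have [->//|xyz] := pselect ((x, y) = z).
  by apply: (diffquot_continuous FE xyz); apply: cF; exact: sqE.
have dQ x y : z.1 - r <= x <= z.1 + r -> z.2 - r <= y <= z.2 + r ->
    (x, y) \notin z :: s -> cdiff Q (x, y).
  move=> hx hy; rewrite in_cons negb_or => /andP[/eqP xyz xys].
  by apply: (diffquot_cdiff FE xyz); apply: dF => //; exact: sqE.
have dQw : cdiff Q w := diffquot_cdiff FE wNz dw.
have [/andP[w1 w2] /andP[w3 w4]] := (in_squareP _ _ _).1 wz.
have Qb v : in_square z r v -> r <= cabs (v - z) -> cabs (Q v) <= 2 * M / r.
  move=> vz rv.
  have vz0 : 0 < cabs (v - z) by lra.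
  have : cabs (Q v) * cabs (v - z) <= 2 * M.
    have : cmul (Q v) (v - z) = F v - F z by rewrite (FE v) addrAC subrr add0r.
    rewrite -cabsM => ->; apply: le_trans (cabsD _ _) _; rewrite cabsN.
    by have := FM _ vz; have := FM _ sqzz; lra.
  rewrite ler_pdivlMr//; apply: le_trans; apply: ler_wpM2l => //; exact: cabs_ge0.
have I (a b : R) (h : R -> R) : a <= b -> cts_on a b h ->
   (forall x, a <= x <= b -> h x <= 2 * M / r) ->
   \int[mu]_(x in `[a, b]) h x <= 2 * M / r * (b - a).
  move=> ab ch hh; rewrite -(Rint_cst _ ab); apply: Rint_le => //; exact: cts_cst.
have zr1 : z.1 - r <= z.1 + r by lra.
have zr2 : z.2 - r <= z.2 + r by lra.
have e1 : z.1 - r <= z.1 - r <= z.1 + r by rewrite lexx.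
have e2 : z.1 - r <= z.1 + r <= z.1 + r by rewrite lexx andbT.
have e3 : z.2 - r <= z.2 - r <= z.2 + r by rewrite lexx.
have e4 : z.2 - r <= z.2 + r <= z.2 + r by rewrite lexx andbT.
have r2 : 0 < r / 2 by lra.
have := @cauchy_rect _ Q (z :: s) (z.1 - r) (z.1 + r) (z.2 - r) (z.2 + r) w (r / 2) r2.
have -> : w.1 - 3 * (r / 2) <= z.1 - r <= w.1 - r / 2 by apply/andP; split; lra.
have -> : w.1 + r / 2 <= z.1 + r <= w.1 + 3 * (r / 2) by apply/andP; split; lra.
have -> : w.2 - 3 * (r / 2) <= z.2 - r <= w.2 - r / 2 by apply/andP; split; lra.
have -> : w.2 + r / 2 <= z.2 + r <= w.2 + 3 * (r / 2) by apply/andP; split; lra.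
move=> /(_ isT isT isT isT cQ' dQ dQw) hC.
have Ix y : z.2 - r <= y <= z.2 + r -> r <= `|y - z.2| ->
   \int[mu]_(x in `[(z.1 - r), (z.1 + r)]) cabs (Q (x, y)) <= 2 * M / r * (z.1 + r - (z.1 - r)).
  move=> hy ry; apply: I => //; first by apply: cts_cabs_x => x hx; exact: cQ'.
  by move=> x hx; apply: Qb; [exact: sqE|apply: le_trans ry (ler_cabs2 ((x, y) - z))].
have Iy x : z.1 - r <= x <= z.1 + r -> r <= `|x - z.1| ->
   \int[mu]_(y in `[(z.2 - r), (z.2 + r)]) cabs (Q (x, y)) <= 2 * M / r * (z.2 + r - (z.2 - r)).
  move=> hx rx; apply: I => //; first by apply: cts_cabs_y => y hy; exact: cQ'.
  by move=> y hy; apply: Qb; [exact: sqE|apply: le_trans rx (ler_cabs1 ((x, y) - z))].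
have n1 (x : R) : r <= `|x + r - x| by rewrite (_ : x + r - x = r) ?ler_norm//; ring.
have n2 (x : R) : r <= `|x - r - x| by rewrite (_ : x - r - x = - r) ?normrN ?ler_norm//; ring.
have := Ix _ e3 (n2 _); have := Ix _ e4 (n1 _).
have := Iy _ e1 (n2 _); have := Iy _ e2 (n1 _) => h1 h2 h3 h4.
have E (x : R) : 2 * M / r * (x + r - (x - r)) = 4 * M by field; rewrite lt0r_neq0.
move: h1 h2 h3 h4; rewrite !E => h1 h2 h3 h4.
have hQ : cabs (Q w) <= 72 * M / r.
  by rewrite ler_pdivlMr//; move: hC h1 h2 h3 h4; clear; lra.
rewrite (FE w) addrAC subrr add0r cabsM ler_wpM2r ?cabs_ge0//.
Qed.

(** Two rounds of the Lipschitz bound: the first bounds the quotient [Q] by [72 M / r], the second,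
    on squares of half-side [r / 4], makes [Q] itself Lipschitz with constant
    [72 (72 M / r) / (r / 4) = 20736 M / r^2]. *)
Theorem taylor_estimate f z r M : 0 < r ->
  (forall v, in_square z r v -> cdiff f v) ->
  (forall v, in_square z r v -> cabs (f v) <= M) ->
  exists2 d, cabs d <= 72 * M / r &
  forall w, cabs (w - z) < r / 8 ->
    cabs (f w - f z - cmul d (w - z)) <= 20736 * M / r ^+ 2 * cabs (w - z) ^+ 2.
Proof.
move=> r0 df fM.
have sqzz : in_square z r z by split; rewrite subrr normr0 ltW.
have M0 : 0 <= M by apply: le_trans (fM z sqzz); exact: cabs_ge0.
have [Q cQ fE] := df z sqzz.
pose M1 := 72 * M / r.
have sub2 v : in_square z (r / 2) v -> in_square z r v.
  by move=> [h1 h2]; split; [apply: le_trans h1 _|apply: le_trans h2 _]; lra.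
have Qv v : in_square z (r / 2) v -> v <> z -> cabs (Q v) <= M1.
  move=> vz vNz.
  have vz0 : 0 < cabs (v - z).
    by apply: cabs_gt0; apply/eqP; rewrite subr_eq0; apply/eqP.
  have := @lipschitz_punctured f [::] z v r M r0.
  have cf u : in_square z r u -> {for u, continuous f}.
    by move=> hu; apply: cdiff_continuous; exact: df.
  move=> /(_ cf (fun u hu _ => df u hu) fM vz (df _ sqzz) (df _ (sub2 _ vz))).
  by rewrite (fE v) addrAC subrr add0r cabsM ler_pM2r.
have shift t : 0 < t -> (z.1 + t, z.2) <> z by move=> t0 /(congr1 fst) /=; lra.
have shiftz t : 0 < t -> cabs ((z.1 + t, z.2) - z) <= t.
  move=> t0; apply: le_trans (cabs_le_sum _) _ => /=.
  by rewrite subrr normr0 addr0 (addrC z.1) addrK gtr0_norm.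
move/ccontP : (cQ) => cQe.
(* The bound holds off [z] only; it reaches [z] by continuity along the points [(z.1 + t, z.2)]. *)
have Qz : cabs (Q z) <= M1.
  apply/ler_addgt0Pr => e e0; have [d d0 hd] := cQe _ e0.
  pose t := Num.min (d / 2) (r / 2).
  have t0 : 0 < t by rewrite lt_min !divr_gt0.
  have td : t <= d / 2 by rewrite /t ge_min lexx.
  have tr : t <= r / 2 by rewrite /t ge_min lexx orbT.
  have h1 : cabs (Q (z.1 + t, z.2) - Q z) < e.
    by apply: hd; apply: le_lt_trans (shiftz _ t0) _; lra.
  have h2 : cabs (Q (z.1 + t, z.2)) <= M1.
    apply: Qv; last exact: shift.
    by apply: cabs_in_square; apply: le_trans (shiftz _ t0) _.
  have := cabs_sub (Q z) (Q (z.1 + t, z.2)); rewrite cabsBC; lra.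
have cQ2 v : in_square z r v -> {for v, continuous Q}.
  move=> hv; have [->//|vNz] := pselect (v = z).
  by apply: (diffquot_continuous fE vNz); apply: cdiff_continuous; exact: df.
exists (Q z) => // w wz.
have [->|wNz] := pselect (w = z); first by rewrite !subrr cmul0 subr0 cabs0 expr0n/= mulr0.
have r4 : 0 < r / 4 by lra.
have /andP[wz1 wz1'] : - (r / 8) < w.1 - z.1 < r / 8.
  by rewrite -ltr_norml; apply: le_lt_trans wz; exact: (ler_cabs1 (w - z)).
have /andP[wz2 wz2'] : - (r / 8) < w.2 - z.2 < r / 8.
  by rewrite -ltr_norml; apply: le_lt_trans wz; exact: (ler_cabs2 (w - z)).
have sub4 v : in_square w (r / 4) v -> in_square z (r / 2) v.
  move=> /in_squareP[/andP[? ?] /andP[? ?]]; apply/in_squareP.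
  by split; apply/andP; split; lra.
pose L := 72 * M1 / (r / 4).
have L0 : 0 <= L by rewrite /L /M1 divr_ge0 ?(ltW r4)// mulr_ge0// divr_ge0 ?(ltW r0)// mulr_ge0.
(* The Lipschitz bound requires differentiability at both points compared, which for [Q] is not
   known at [z]. The square is therefore centred at [w], and [v] tends to [z] afterwards. *)
have QL v : in_square w (r / 8) v -> v <> z -> cabs (Q v - Q w) <= L * cabs (v - w).
  move=> vw vNz; apply: (@lipschitz_punctured Q [:: z] w v (r / 4) M1) => //.
  - by move=> u /sub4/sub2/cQ2.
  - move=> u /sub4/sub2 hu; rewrite mem_seq1 => /eqP uz.
    by apply: (diffquot_cdiff fE uz); exact: df.
  - move=> u /sub4 hu; have [->//|uNz] := pselect (u = z); exact: Qv.
  - by have -> : r / 4 / 2 = r / 8 by field.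
  - apply: (diffquot_cdiff fE wNz); apply: df; apply/sub2/sub4.
    by split; rewrite subrr normr0 ltW.
  - apply: (diffquot_cdiff fE vNz); apply: df; apply/sub2/sub4.
    by case: vw => h1 h2; split; [apply: le_trans h1 _|apply: le_trans h2 _]; lra.
have main : cabs (Q w - Q z) <= L * cabs (w - z).
  apply/ler_addgt0Pr => e e0.
  have e2 : 0 < e / 2 by lra.
  have [d d0 hd] := cQe _ e2.
  (* The shifted point must be close enough to [z] for the continuity of [Q], lie in the square
     around [w], and satisfy [L * t <= e / 2]. *)
  pose t := Num.min (d / 2) (Num.min (r / 8 - (w.1 - z.1)) (Num.min (r / 8 + (w.1 - z.1)) (e / (2 * (L + 1))))).
  have t0 : 0 < t.
    rewrite !lt_min divr_gt0//=; apply/and3P; split; try lra.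
    by rewrite divr_gt0// mulr_gt0//; lra.
  have td : t <= d / 2 by rewrite /t ge_min lexx.
  have t1 : t <= r / 8 - (w.1 - z.1) by rewrite /t !ge_min lexx !orbT.
  have t2 : t <= r / 8 + (w.1 - z.1) by rewrite /t !ge_min lexx !orbT.
  have te : t * (2 * (L + 1)) <= e.
    by rewrite -ler_pdivlMr ?mulr_gt0//; [rewrite /t !ge_min lexx !orbT|lra].
  have h1 : cabs (Q (z.1 + t, z.2) - Q z) < e / 2.
    by apply: hd; apply: le_lt_trans (shiftz _ t0) _; lra.
  have h2 : cabs (Q (z.1 + t, z.2) - Q w) <= L * cabs ((z.1 + t, z.2) - w).
    apply: QL; last exact: shift.
    clear -t0 t1 t2 wz1 wz1' wz2 wz2'.
    by apply/in_squareP => /=; split; apply/andP; split; lra.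
  have h3 : cabs ((z.1 + t, z.2) - w) <= t + cabs (w - z).
    have -> : (z.1 + t, z.2) - w = ((z.1 + t, z.2) - z) + (z - w) by rewrite addrA subrK.
    apply: le_trans (cabsD _ _) _; rewrite (cabsBC z); apply: lerD => //; exact: shiftz.
  have h4 : cabs (Q w - Q z) <= cabs (Q (z.1 + t, z.2) - Q w) + cabs (Q (z.1 + t, z.2) - Q z).
    have -> : Q w - Q z = (Q w - Q (z.1 + t, z.2)) + (Q (z.1 + t, z.2) - Q z) by rewrite addrA subrK.
    by apply: le_trans (cabsD _ _) _; rewrite (cabsBC (Q w)).
  have h5 : L * cabs ((z.1 + t, z.2) - w) <= L * (t + cabs (w - z)) by rewrite ler_wpM2l.
  by nra.
rewrite (fE w) (addrAC (f z)) subrr add0r -cmulBl cabsM.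
have -> : 20736 * M / r ^+ 2 * cabs (w - z) ^+ 2 = (L * cabs (w - z)) * cabs (w - z).
  by rewrite /L /M1; field; rewrite lt0r_neq0.
by rewrite ler_wpM2r ?cabs_ge0.
Qed.
End TaylorEstimate.

(** * Orlicz functions and their inverses *)

Section OrliczFunctions.
Context {R : realType} (Psi : R -> R).
Hypothesis OPsi : orlicz Psi.
Implicit Types (x y t C : R).

Lemma Psi_lt x y : 0 <= x -> x < y -> Psi x < Psi y.
Proof. by case: OPsi => _ _ h _ _; exact: h. Qed.

Lemma Psi_le x y : 0 <= x -> x <= y -> Psi x <= Psi y.
Proof.
by move=> x0; rewrite le_eqVlt => /predU1P[->//|xy]; exact/ltW/Psi_lt.
Qed.

Lemma Psi_ge0 x : 0 <= x -> 0 <= Psi x.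
Proof. by case: OPsi => _ _ _ h _; exact: h. Qed.

Lemma Psi0 : Psi 0 = 0.
Proof. by case: OPsi => _ _ _ _ []. Qed.

Lemma Psi_gt0 x : 0 < x -> 0 < Psi x.
Proof. by move=> x0; rewrite -Psi0 Psi_lt. Qed.

Lemma Psi_scale x t : 0 <= x -> 0 <= t <= 1 -> Psi (t * x) <= t * Psi x.
Proof.
move=> x0 /andP[t0 t1].
have [->|xn0] := eqVneq x 0; first by rewrite mulr0 Psi0 mulr0.
have [->|tn0] := eqVneq t 0; first by rewrite !mul0r Psi0.
have [->|tn1] := eqVneq t 1; first by rewrite !mul1r.
case: OPsi => _ h _ _ _.
have := h x 0 t x0 (lexx 0) xn0; rewrite !lt_neqAle t0 t1 tn1 eq_sym tn0 => /(_ isT).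
by rewrite Psi0 !mulr0 !addr0 => /andP[].
Qed.

Lemma Psi_mid x y : 0 <= x -> 0 <= y -> Psi ((x + y) / 2) <= (Psi x + Psi y) / 2.
Proof.
move=> x0 y0; have [->|xy] := eqVneq x y.
  by rewrite (_ : (y + y) / 2 = y); [lra|field].
case: OPsi => _ h _ _ _; have h12 : 0 < (2^-1 : R) < 1 by apply/andP; split; lra.
have := h x y 2^-1 x0 y0 xy h12.
have -> : 2^-1 * x + (1 - 2^-1) * y = (x + y) / 2 by field.
by lra.
Qed.

(** For [t > X] convexity and [Psi 0 = 0] give [Psi X / X <= Psi t / t], so the second summand alone
    exceeds [t]. *)
Lemma Psi_tangent X t : 0 < X -> 0 <= t -> t <= X + X / Psi X * Psi t.
Proof.
move=> X0 t0; have PX := Psi_gt0 X0; have := Psi_ge0 t0 => Pt.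
have [tX|Xt] := leP t X.
  by apply: le_trans tX _; rewrite lerDl mulr_ge0// divr_ge0// ltW.
have t0' : 0 < t by lra.
have : Psi X <= X / t * Psi t.
  have {1}-> : X = X / t * t by field; lra.
  apply: Psi_scale => //; apply/andP; split; first by rewrite divr_ge0// ltW.
  by rewrite ler_pdivrMr//; lra.
rewrite mulrAC ler_pdivlMr// (mulrC (Psi X)) => h.
apply: le_trans (_ : _ <= X / Psi X * Psi t) _; last by rewrite lerDr ltW.
by rewrite mulrAC ler_pdivlMr.
Qed.

Lemma Psi_superlinear : exists2 x0, 0 < x0 & forall x, x0 <= x -> x <= Psi x.
Proof.
case: OPsi => _ _ _ _ [_ /cvgryPge/(_ 1)[M [_ hM]]].
exists (Num.max 1 (M + 1)); first by rewrite lt_max ltr01.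
move=> x; rewrite ge_max => /andP[x1 xM].
have : 1 <= Psi x / x by apply: hM; lra.
by rewrite ler_pdivlMr ?mul1r//; lra.
Qed.

Lemma Psi_surj y : 0 <= y -> exists2 x, 0 <= x & Psi x = y.
Proof.
move=> y0; have [x0 x00 h] := Psi_superlinear.
pose b := Num.max x0 y.
have b0 : 0 <= b by rewrite le_max (ltW x00).
have yb : y <= Psi b.
  by apply: le_trans (h b _); rewrite /b le_max lexx ?orbT.
have cP : {within `[0, b], continuous Psi}.
  case: OPsi => c _ _ _ _; apply: continuous_subspaceW c.
  by apply: subset_itvl; rewrite bnd_simp.
have [|c cb <-] := @IVT _ Psi 0 b y b0 cP.
  by rewrite Psi0 ge_min y0 le_max yb orbT.
by exists c => //; move: cb; rewrite in_itv/= => /andP[].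
Qed.

Lemma Psi_invK x : 0 <= x -> Psi_inv Psi (Psi x) = x.
Proof.
move=> x0; rewrite /Psi_inv; apply/eqP; rewrite eq_le; apply/andP; split.
  apply: ge_sup; first by exists x.
  by move=> t [t0 tx]; rewrite leNgt; apply/negP => /(Psi_lt x0); lra.
apply: ub_le_sup; last by [].
by exists x => t [t0 tx]; rewrite leNgt; apply/negP => /(Psi_lt x0); lra.
Qed.

Lemma Psi_inv_ge0 y : 0 <= y -> 0 <= Psi_inv Psi y.
Proof. by move=> /Psi_surj[x x0 <-]; rewrite Psi_invK. Qed.

Lemma PsiK y : 0 <= y -> Psi (Psi_inv Psi y) = y.
Proof. by move=> /Psi_surj[x x0 <-]; rewrite Psi_invK. Qed.

Lemma Psi_inv_gt0 y : 0 < y -> 0 < Psi_inv Psi y.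
Proof.
move=> y0; rewrite lt_neqAle Psi_inv_ge0 ?ltW// andbT; apply/eqP => h.
by have := PsiK (ltW y0); rewrite -h Psi0; lra.
Qed.

Lemma Psi_inv_le x y : 0 <= x -> x <= y -> Psi_inv Psi x <= Psi_inv Psi y.
Proof.
move=> x0 xy; have y0 := le_trans x0 xy; rewrite leNgt; apply/negP => h.
by have := Psi_lt (Psi_inv_ge0 y0) h; rewrite !PsiK//; lra.
Qed.

(** [Psi] is continuous only relative to the half-line; precomposing with the absolute value gives
    continuity on all of [R], agreeing with [Psi] on the moduli to which it is applied. *)
Lemma continuous_Psi_norm : continuous (fun x => Psi `|x|).
Proof.
move=> x; case: OPsi => /subspace_continuousP c _ _ _ _.
have /c cx : [set` `[0%R, +oo[] `|x| by rewrite /= in_itv/= normr_ge0.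
apply: (@cvg_comp _ _ _ (@Num.norm R R) Psi _ _ _ _ cx) => P /= hP.
have : \forall y \near x, [set` `[0%R, +oo[] `|y| -> P `|y|.
  exact: (@norm_continuous R R x _ hP).
by apply: filterS => y; apply; rewrite /= in_itv/= normr_ge0.
Qed.

End OrliczFunctions.

(** * Borel sets and continuous functions on the plane *)

Section PlaneMeasurability.
Context {R : realType}.

(** Measurability on [R * R] refers to the product sigma-algebra. An open set belongs to it as a
    countable union of boxes with rational centre and radius. *)
Lemma open_measurable_plane (U : set (R * R)) : open U -> measurable U.
Proof.
move=> oU.
pose box (q p s : rat) : set (R * R) :=
  (ball (ratr q : R) (ratr s)) `*` (ball (ratr p : R) (ratr s)).
pose B q p s := if pselect (box q p s `<=` U) then box q p s else set0.
have -> : U = \bigcup_q \bigcup_p \bigcup_s B q p s.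
  apply/seteqP; split=> [z Uz|z [q _ [p _ [s _]]]]; last first.
    by rewrite /B; case: pselect => // h; exact: h.
  have /nbhs_ballP[r/= r0 rU] := oU _ Uz.
  have [s] := @rat_in_itvoo R 0 (r / 2) (divr_gt0 r0 (ltr0Sn _ _)).
  rewrite in_itv/= => /andP[s0 sr].
  have s1 : z.1 - ratr s < z.1 + ratr s by lra.
  have s2 : z.2 - ratr s < z.2 + ratr s by lra.
  have [q] := rat_in_itvoo s1.
  rewrite in_itv/= => /andP[q1 q2].
  have [p] := rat_in_itvoo s2.
  rewrite in_itv/= => /andP[p1 p2].
  exists q => //; exists p => //; exists s => //; rewrite /B; case: pselect => [h|[]]; last first.
    move=> w [/=]; rewrite /ball/= !ltr_norml => /andP[? ?] /andP[? ?].
    apply: rU; split => /=; rewrite /ball/= ltr_norml; apply/andP; split; lra.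
  by split; rewrite /ball/= ltr_norml; apply/andP; split; lra.
apply: bigcupT_measurable_rat => q; apply: bigcupT_measurable_rat => p.
apply: bigcupT_measurable_rat => s; rewrite /B; case: (pselect _) => h; last exact: measurable0.
by apply: measurableX; exact: measurable_ball.
Qed.

Lemma continuous_measurable_plane (D : set (R * R)) (h : R * R -> R) : open D ->
  (forall z, D z -> {for z, continuous h}) -> measurable_fun D h.
Proof.
move=> oD ch; have mD := open_measurable_plane oD.
apply: (measurability _ (RGenOpens.measurableE R)).
move=> _ [_ [a [b ->] <-]]; apply: open_measurable_plane.
rewrite openE => z [Dz hz]; apply: filterI; first exact: oD.
apply: (ch z Dz); apply: open_nbhs_nbhs; split => //; exact: interval_open.
Qed.

Lemma disk_measurable : measurable (@disk R).
Proof. exact: open_measurable_plane open_disk. Qed.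

End PlaneMeasurability.

(** * The growth bound for functions in the Bergman-Orlicz space *)

Section PointwiseEstimate.
Context {R : realType}.
Implicit Types (f : R * R -> R * R) (z v w : R * R).
Notation mu := (@lebesgue_measure R).
Notation area := ((@lebesgue_measure R) \x (@lebesgue_measure R))%E.

(** If [M] exceeded the bound throughout [[l, u]], its integral would be at least [2 B]. Used to
    find good lines among the slices of a double integral. *)
Lemma small_value (M : R -> \bar R) (l u B : R) : l < u -> 0 < B ->
  measurable_fun setT M -> (forall x, 0 <= M x)%E -> (\int[mu]_x M x <= B%:E)%E ->
  exists2 c, l <= c <= u & (M c <= (2 * B / (u - l))%:E)%E.
Proof.
move=> lu B0 mM M0 hM; apply: contrapT => hN.
have h c : `[l, u]%classic c -> ((2 * B / (u - l))%:E <= M c)%E.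
  rewrite /= in_itv/= => hc; rewrite leNgt; apply/negP => hlt; apply: hN.
  by exists c => //; exact: ltW.
have ul : 0 < u - l by rewrite subr_gt0.
have : ((2 * B)%:E <= \int[mu]_x M x)%E.
  apply: (@le_trans _ _ (\int[mu]_(x in `[l, u]) M x)%E); last first.
    exact: ge0_subset_integral.
  apply: (@le_trans _ _ (\int[mu]_(x in `[l, u]) (cst (2 * B / (u - l))%:E x))%E).
    rewrite integral_cst//= lebesgue_measure_itv/= lte_fin lu -EFinD -EFinM lee_fin.
    by rewrite mulfVK// lt0r_neq0.
  apply: ge0_le_integral => //.
  - by move=> x _; rewrite lee_fin divr_ge0// ?mulr_ge0// ltW.
  - by apply: measurable_funTS.
move=> /le_trans/(_ hM); rewrite lee_fin; lra.
Qed.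

Lemma square_measurable z r : measurable [set w | in_square z r w].
Proof.
have -> : [set w | in_square z r w] =
  `[z.1 - r, z.1 + r]%classic `*` `[z.2 - r, z.2 + r]%classic.
  by apply/seteqP; split => w /=; rewrite !in_itv/= => /in_squareP.
by apply: measurableX; exact: measurable_itv.
Qed.

Lemma itv_sides_sub (t q a b x : R) : t - 3 * q <= a <= t - q ->
  t + q <= b <= t + 3 * q -> a <= x <= b -> t - 3 * q <= x <= t + 3 * q.
Proof. by move=> /andP[? ?] /andP[? ?] /andP[? ?]; apply/andP; split; lra. Qed.

Lemma itv_sides_end (t q a b : R) : 0 < q -> t - 3 * q <= a <= t - q ->
  t + q <= b <= t + 3 * q -> (t - 3 * q <= a <= t + 3 * q) /\ (t - 3 * q <= b <= t + 3 * q).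
Proof. by move=> q0 /andP[? ?] /andP[? ?]; split; apply/andP; split; lra. Qed.

Lemma cauchy_rect_bound f a b c d z q m : 0 < q ->
  z.1 - 3 * q <= a <= z.1 - q -> z.1 + q <= b <= z.1 + 3 * q ->
  z.2 - 3 * q <= c <= z.2 - q -> z.2 + q <= d <= z.2 + 3 * q ->
  (forall w, in_square z (3 * q) w -> cdiff f w) ->
  \int[mu]_(x in `[a, b]) cabs (f (x, c)) <= m -> \int[mu]_(x in `[a, b]) cabs (f (x, d)) <= m ->
  \int[mu]_(y in `[c, d]) cabs (f (a, y)) <= m -> \int[mu]_(y in `[c, d]) cabs (f (b, y)) <= m ->
  q * cabs (f z) <= 9 * m.
Proof.
move=> q0 ha hb hc hd df h1 h2 h3 h4.
have dfr x y : a <= x <= b -> c <= y <= d -> cdiff f (x, y).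
  move=> hx hy; apply: df; apply/in_squareP.
  by split; [exact: itv_sides_sub ha hb hx|exact: itv_sides_sub hc hd hy].
have cf : cts_rect a b c d f by move=> x y hx hy; apply: cdiff_continuous; exact: dfr.
have dz : cdiff f z.
  by apply: df; split; rewrite subrr normr0 mulr_ge0// ltW.
have := @cauchy_rect _ f [::] a b c d z q q0 ha hb hc hd cf
  (fun x y hx hy _ => dfr x y hx hy) dz.
clear -h1 h2 h3 h4; move: h1 h2 h3 h4 (cabs (f z)).
set P1 := Rintegral _ _ _; set P2 := Rintegral _ _ _.
set P3 := Rintegral _ _ _; set P4 := Rintegral _ _ _.
move: P1 P2 P3 P4 => P1 P2 P3 P4 h1 h2 h3 h4 t h; lra.
Qed.

(** With [r = 3 q], each side of the rectangle is chosen by Fubini in a band at distance between [q]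
    and [3 q] from the centre. The bands have width [2 q], so some line carries a slice integral of
    at most [B / q]. The Cauchy inequality then gives [q |f z| <= 9 B / q], and
    [9 / q^2 = 81 / r^2]. *)
Lemma square_mean f z (r B : R) : 0 < r -> 0 < B ->
  (forall w, in_square z r w -> cdiff f w) ->
  measurable_fun [set w | in_square z r w] (fun w => cabs (f w)) ->
  (\int[area]_(w in [set w | in_square z r w]) (cabs (f w))%:E <= B%:E)%E ->
  cabs (f z) <= 81 * B / r ^+ 2.
Proof.
move=> r0 B0 df mf.
have [q q0 rq] : exists2 q, 0 < q & r = 3 * q by exists (r / 3); lra.
subst r; set S := [set w | _]; have mS : measurable S := square_measurable z (3 * q).
rewrite integral_mkcond; set g := (_ \_ S).
have mg : measurable_fun setT g.
  by apply/(measurable_restrictT _ _).1 => //; apply/measurable_EFinP.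
have g0 w : (0 <= g w)%E by apply: erestrict_ge0 => v _; rewrite lee_fin cabs_ge0.
have gS w : S w -> g w = (cabs (f w))%:E by move=> Sw; rewrite /g patchE mem_set.
have sqE (x y : R) : z.1 - 3 * q <= x <= z.1 + 3 * q ->
   z.2 - 3 * q <= y <= z.2 + 3 * q -> S (x, y).
  by move=> hx hy; apply/in_squareP.
have ex (x y : R) : z.2 - 3 * q <= y <= z.2 + 3 * q -> z.1 - 3 * q <= x <= z.1 + 3 * q ->
   {for (x, y), continuous f}.
  by move=> hx hy; apply: cdiff_continuous; apply: df; exact: sqE.
move=> hI.
have hG := hI; rewrite fubini_tonelli2// in hG.
have hF := hI; rewrite fubini_tonelli1// in hF.
have mG := measurable_fun_fubini_tonelli_G (m1 := mu) g mg g0.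
have mF := measurable_fun_fubini_tonelli_F (m2 := mu) g mg g0.
have G0 y : (0 <= fubini_G mu g y)%E by apply: integral_ge0 => x _; exact: g0.
have F0 x : (0 <= fubini_F mu g x)%E by apply: integral_ge0 => y _; exact: g0.
have [lo hi] : (forall t : R, t - 3 * q < t - q) /\ (forall t : R, t + q < t + 3 * q).
  by clear -q0; split => t; lra.
have [c hc Mc] := small_value (lo z.2) B0 mG G0 hG.
have [d hd Md] := small_value (hi z.2) B0 mG G0 hG.
have [a ha Ma] := small_value (lo z.1) B0 mF F0 hF.
have [b hb Mb] := small_value (hi z.1) B0 mF F0 hF.
have qn0 : q != 0 by rewrite lt0r_neq0.
have El (t : R) : 2 * B / (t - q - (t - 3 * q)) = B / q.
  by rewrite (_ : t - q - (t - 3 * q) = 2 * q); [field|ring].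
have Eh (t : R) : 2 * B / (t + 3 * q - (t + q)) = B / q.
  by rewrite (_ : t + 3 * q - (t + q) = 2 * q); [field|ring].
rewrite El in Mc; rewrite El in Ma; rewrite Eh in Md; rewrite Eh in Mb.
have Iy y : z.2 - 3 * q <= y <= z.2 + 3 * q -> (fubini_G mu g y <= (B / q)%:E)%E ->
    \int[mu]_(x in `[a, b]) cabs (f (x, y)) <= B / q.
  move=> hy hM.
  have ci : cts_on a b (fun x => cabs (f (x, y))).
    by apply: cts_cabs_x => x hx; apply: ex => //; exact: itv_sides_sub ha hb hx.
  rewrite -lee_fin /Rintegral fineK; last first.
    by apply: integrable_fin_num => //; exact: cts_integrable.
  apply: le_trans hM.
  rewrite [leLHS](_ : _ = \int[mu]_(x in `[a, b]) g (x, y))%E; last first.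
    apply: eq_integral => x; rewrite inE /= in_itv/= => hx; rewrite gS//.
    by apply: sqE => //; exact: itv_sides_sub ha hb hx.
  apply: ge0_subset_integral => //.
  exact: (measurable_fun_pair1 y mg).
have Ix x : z.1 - 3 * q <= x <= z.1 + 3 * q -> (fubini_F mu g x <= (B / q)%:E)%E ->
    \int[mu]_(y in `[c, d]) cabs (f (x, y)) <= B / q.
  move=> hx hM.
  have ci : cts_on c d (fun y => cabs (f (x, y))).
    by apply: cts_cabs_y => y hy; apply: ex => //; exact: itv_sides_sub hc hd hy.
  rewrite -lee_fin /Rintegral fineK; last first.
    by apply: integrable_fin_num => //; exact: cts_integrable.
  apply: le_trans hM.
  rewrite [leLHS](_ : _ = \int[mu]_(y in `[c, d]) g (x, y))%E; last first.
    apply: eq_integral => y; rewrite inE /= in_itv/= => hy; rewrite gS//.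
    by apply: sqE => //; exact: itv_sides_sub hc hd hy.
  apply: ge0_subset_integral => //.
  exact: (measurable_fun_pair2 x mg).
have [ha' hb'] := itv_sides_end q0 ha hb.
have [hc' hd'] := itv_sides_end q0 hc hd.
have := cauchy_rect_bound q0 ha hb hc hd df (Iy _ hc' Mc) (Iy _ hd' Md) (Ix _ ha' Ma) (Ix _ hb' Mb).
have -> : 81 * B / (3 * q) ^+ 2 = (9 * (B / q)) / q by field.
by rewrite ler_pdivlMr// mulrC.
Qed.

Lemma square_in_disk z r w : disk z -> r <= (1 - cabs z) / 4 -> in_square z r w ->
  cabs w <= (1 + cabs z) / 2 /\ disk w.
Proof.
rewrite /disk /= => Dz hr [h1 h2].
have : cabs w <= cabs z + cabs (w - z) by rewrite -{1}(subrK z w) addrC cabsD.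
have := cabs_le_sum (w - z) => /= h3 h4.
by split; lra.
Qed.

Section Orlicz.
Variable Psi : R -> R.
Hypothesis OPsi : orlicz Psi.

Lemma measurable_modular f C : (forall z, disk z -> {for z, continuous f}) -> 0 < C ->
  measurable_fun (@disk R) (fun w => (Psi (cabs (f w) / C))%:E).
Proof.
move=> cf C0; apply/measurable_EFinP; apply: continuous_measurable_plane.
  exact: open_disk.
move=> z Dz.
have -> : (fun w => Psi (cabs (f w) / C)) = (fun w => (fun x => Psi `|x|) (cabs (f w) / C)).
  by apply/funext => w; rewrite ger0_norm// divr_ge0 ?cabs_ge0// ltW.
apply: (@continuous_comp _ _ R (fun w => cabs (f w) / C) (fun x => Psi `|x|)).
  apply: (@cvgM R); last exact: cvg_cst.
  by apply: (@continuous_comp _ _ R f (@cabs R)); [exact: cf|exact: continuous_cabs].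
exact: continuous_Psi_norm.
Qed.

(* Replaces Jensen's inequality by the chord bound [Psi_tangent]. *)
Theorem modular_pointwise f C z : holomorphic_disk f -> 0 < C ->
  (modular Psi f C <= 1)%E -> disk z ->
  cabs (f z) <= 6480 * C * Psi_inv Psi (((1 - cabs z) ^+ 2)^-1).
Proof.
move=> /holomorphic_diskP df C0 hm Dz.
have cf w : disk w -> {for w, continuous f} by move=> /df; exact: cdiff_continuous.
set dl := 1 - cabs z; have dl0 : 0 < dl by rewrite subr_gt0.
set X := Psi_inv Psi _.
have y0 : 0 < (dl ^+ 2)^-1 by rewrite invr_gt0 exprn_gt0.
have X0 : 0 < X by exact: Psi_inv_gt0.
have PX : Psi X = (dl ^+ 2)^-1 by rewrite PsiK// ltW.
pose r := dl / 4; have r0 : 0 < r by rewrite divr_gt0.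
have sub w : in_square z r w -> disk w by move=> /(square_in_disk Dz (lexx _))[].
pose S := [set w | in_square z r w].
have mS : measurable S := square_measurable z r.
have pi0 : 0 < pi :> R := pi_gt0 R.
have hm' : (\int[area]_(w in @disk R) (Psi (cabs (f w) / C))%:E <= pi%:E)%E.
  move: hm; rewrite /modular /area_lebesgue => hm.
  by rewrite -[leRHS]mule1 -lee_pdivrMl.
have m1 := measurable_modular cf C0.
have mPS : measurable_fun S (fun w => (Psi (cabs (f w) / C))%:E).
  by apply: measurable_funS m1 => //; exact: disk_measurable.
have P0 w : (0 <= (Psi (cabs (f w) / C))%:E)%E.
  by rewrite lee_fin (Psi_ge0 OPsi)// divr_ge0 ?cabs_ge0// ltW.
have mfS : measurable_fun S (fun w => cabs (f w)).
  apply: measurable_funS (disk_measurable) _ _ => //.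
  apply: continuous_measurable_plane; first exact: open_disk.
  move=> w Dw; apply: (@continuous_comp _ _ R f (@cabs R)); [exact: cf|exact: continuous_cabs].
have aS : area S = ((dl / 2) ^+ 2)%:E.
  have -> : S = `[z.1 - r, z.1 + r]%classic `*` `[z.2 - r, z.2 + r]%classic.
    by apply/seteqP; split => w /=; rewrite /S /= !in_itv/= => /in_squareP.
  transitivity (mu `[(z.1 - r)%R, (z.1 + r)%R]%classic * mu `[(z.2 - r)%R, (z.2 + r)%R]%classic)%E.
    by apply: product_measure1E; exact: measurable_itv.
  have lt (t : R) : t - r < t + r by clear -r0; lra.
  have eq (t : R) : t + r - (t - r) = dl / 2 by rewrite /r; field.
  by rewrite !lebesgue_measure_itv/= !lte_fin !lt -!EFinD !eq -EFinM expr2.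
(* The square has area [dl^2 / 4] and [Psi X = dl^-2], so both terms of the chord bound are
   multiples of [C X dl^2], with total factor [1/4 + pi < 5]. Then [81 * 5 / (1/4)^2 = 6480]. *)
have bound : (\int[area]_(w in S) (cabs (f w))%:E <= (5 * C * X * dl ^+ 2)%:E)%E.
  apply: (@le_trans _ _ (\int[area]_(w in S) ((C * X)%:E + (C * X / Psi X)%:E * (Psi (cabs (f w) / C))%:E))%E).
    apply: ge0_le_integral => //.
    - by move=> w _; rewrite lee_fin cabs_ge0.
    - exact/measurable_EFinP.
    - by apply: emeasurable_funD => //; apply: emeasurable_funM.
    - move=> w _; rewrite -EFinM -EFinD lee_fin.
      have := Psi_tangent OPsi X0 (divr_ge0 (cabs_ge0 (f w)) (ltW C0)).
      rewrite ler_pdivrMr// => /le_trans; apply; rewrite le_eqVlt; apply/orP; left.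
      by apply/eqP; ring.
  rewrite ge0_integralD//; last 3 first.
  - by move=> w _; rewrite lee_fin mulr_ge0 ?ltW.
  - by move=> w _; rewrite mule_ge0// lee_fin PX divr_ge0// ?mulr_ge0 ?ltW.
  - by apply: emeasurable_funM.
  rewrite [X in (X + _)%E](_ : _ = ((C * X)%:E * ((dl / 2) ^+ 2)%:E)%E); last first.
    by rewrite integral_cst//; congr (_ * _)%E; exact: aS.
  rewrite ge0_integralZl//; last 1 first.
  - by rewrite lee_fin PX divr_ge0// ?mulr_ge0 ?ltW.
  apply: (@le_trans _ _ ((C * X)%:E * ((dl / 2) ^+ 2)%:E + (C * X / Psi X)%:E * pi%:E)%E).
    apply: leeD => //; apply: lee_wpmul2l.
      by rewrite lee_fin PX divr_ge0// ?mulr_ge0 ?ltW.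
    apply: le_trans hm'; apply: ge0_subset_integral => //.
    exact: disk_measurable.
  rewrite -!EFinM -EFinD lee_fin PX invrK.
  have : C * X * dl ^+ 2 * (4^-1 + pi) <= C * X * dl ^+ 2 * 5.
    apply: ler_wpM2l; first by rewrite !mulr_ge0 ?sqr_ge0 ?ltW.
    by have := @pihalf_lt2 R; lra.
  have -> : (dl / 2) ^+ 2 = dl ^+ 2 / 4 by field.
  by lra.
have B0 : 0 < 5 * C * X * dl ^+ 2 by rewrite !mulr_gt0// exprn_gt0.
have := square_mean r0 B0 (fun w hw => df w (sub w hw)) mfS bound.
move=> /le_trans; apply; rewrite le_eqVlt; apply/orP; left; apply/eqP.
by rewrite /r; field; rewrite lt0r_neq0.
Qed.

End Orlicz.
End PointwiseEstimate.

(** * Montel's theorem by limits along an ultrafilter *)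

Section Montel.
Context {R : realType}.
Implicit Types (f g : R * R -> R * R) (z v w : R * R).

(** Compactness provides a cluster point. An ultrafilter contains each set or its complement, so a
    cluster point is already a limit. *)
Lemma ultra_bounded (U : set_system nat) (x : nat -> R) M : UltraFilter U ->
  (forall n, `|x n| <= M) -> exists l, forall e, 0 < e -> U [set n | `|x n - l| < e].
Proof.
move=> UU xM.
have FF : ProperFilter (x @ U) by apply: fmap_proper_filter; exact: ultra_proper.
have [|l [_ cl]] := @segment_compact R (- M) M (x @ U) FF.
  by rewrite /fmap; apply: (@filterE _ U) => n /=; rewrite in_itv/= -ler_norml xM.
exists l => e e0; have [//|UC] := in_ultra_setVsetC [set n | `|x n - l| < e] UU.
have [y [/= h1 h2]] := cl (~` [set y | `|y - l| < e]) (ball l e) UC (nbhsx_ballx l e e0).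
by exfalso; apply: h1; rewrite distrC.
Qed.

Lemma ultra_cbounded (U : set_system nat) (x : nat -> R * R) M : UltraFilter U ->
  (forall n, cabs (x n) <= M) -> exists l, forall e, 0 < e -> U [set n | cabs (x n - l) < e].
Proof.
move=> UU xM.
have [|l1 h1] := @ultra_bounded U (fun n => (x n).1) M UU.
  by move=> n; apply: le_trans (xM n); exact: ler_cabs1.
have [|l2 h2] := @ultra_bounded U (fun n => (x n).2) M UU.
  by move=> n; apply: le_trans (xM n); exact: ler_cabs2.
exists (l1, l2) => e e0; have e2 : 0 < e / 2 by lra.
apply: filterS (filterI (h1 _ e2) (h2 _ e2)) => n [/= h3 h4].
by apply: le_lt_trans (cabs_le_sum _) _ => /=; lra.
Qed.

(** An enumeration of the rational points of the plane; the value 0 at numbers that encode no pair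
    is harmless, since only density matters. *)
Definition rat_point (k : nat) : R * R :=
  if unpickle k is Some (p, q) then (ratr (p : rat), ratr (q : rat)) else 0.

Lemma rat_point_dense z e : 0 < e -> exists k, cabs (rat_point k - z) < e.
Proof.
move=> e0.
have h (t : R) : t - e / 2 < t + e / 2 by clear -e0; lra.
have [p] := rat_in_itvoo (h z.1); rewrite in_itv/= => /andP[p1 p2].
have [q] := rat_in_itvoo (h z.2); rewrite in_itv/= => /andP[q1 q2].
exists (pickle (p, q)); rewrite /rat_point pickleK.
apply: le_lt_trans (cabs_le_sum _) _ => /=.
have : `|ratr p - z.1| < e / 2 by rewrite ltr_norml; apply/andP; split; lra.
have : `|ratr q - z.2| < e / 2 by rewrite ltr_norml; apply/andP; split; lra.
by lra.
Qed.

Lemma diagonal_subsequence (B : nat -> set nat) :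
  (forall n s, exists2 k, (s < k)%N & B n k) ->
  exists sigma : nat -> nat, (forall n, (sigma n < sigma n.+1)%N) /\ forall n, B n (sigma n).
Proof.
move=> hB; have [ch hch] := choice (fun ns : nat * nat =>
   let: ex_intro2 k a b := hB ns.1 ns.2 in
   ex_intro (fun k => (ns.2 < k)%N /\ B ns.1 k) k (conj a b)).
pose sigma := fix s n := if n is m.+1 then ch (m.+1, s m) else ch (0%N, 0%N).
exists sigma; split => [n|[|n]] /=.
- by have [] := hch (n.+1, sigma n).
- by have [] := hch (0%N, 0%N).
- by have [] := hch (n.+1, sigma n).
Qed.

Lemma cabs3 (x y t : R * R) : cabs (x + y + t) <= cabs x + cabs y + cabs t.
Proof. by apply: le_trans (cabsD _ _) _; rewrite lerD2r cabsD. Qed.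

(** Along one ultrafilter finer than [\oo] the limits exist at all points at once, which defines [g]
    before any subsequence is chosen. The Taylor estimate has constants independent of [n], so it
    passes to [g] and yields holomorphy. The subsequence is picked by closeness to [g] at rational
    points; a Lipschitz bound near each point does the rest. *)
Theorem montel (u : nat -> R * R -> R * R) (m : R -> R) :
  (forall n, holomorphic_disk (u n)) ->
  (forall n z t, cabs z <= t -> t < 1 -> cabs (u n z) <= m t) ->
  exists (sigma : nat -> nat) g, [/\ forall n, (sigma n < sigma n.+1)%N,
    holomorphic_disk g,
    forall z, disk z -> forall e, 0 < e -> exists N : nat, forall n, (N <= n)%N ->
      cabs (u (sigma n) z - g z) < e &
    forall z, disk z -> cabs (g z) <= m (cabs z)].
Proof.
move=> hu um.
have du n z : disk z -> cdiff (u n) z by move: z; apply/holomorphic_diskP.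
have [U [UU oU]] := @ultraFilterLemma nat \oo _.
(* The square of half-side [r z] around [z] stays within modulus [(1 + |z|) / 2], where [M z] bounds
   every [u n]. *)
pose r z : R := (1 - cabs z) / 4.
pose M z : R := m ((1 + cabs z) / 2).
have r0 z : disk z -> 0 < r z by rewrite /disk /= /r => Dz; lra.
have T1 z : disk z -> (1 + cabs z) / 2 < 1 by rewrite /disk /= => Dz; lra.
have M0 z : disk z -> 0 <= M z.
  move=> Dz; apply: le_trans (cabs_ge0 (u 0%N z)) _; apply: um; last exact: T1.
  by move: Dz; rewrite /disk /= => Dz; lra.
have [K [K0 tay]] : exists K : R * R -> R, (forall z, disk z -> 0 <= K z) /\
    forall n z, exists d, disk z -> cabs d <= 72 * M z / r z /\
     forall w, cabs (w - z) < r z / 8 ->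
      cabs (u n w - u n z - cmul d (w - z)) <= K z * cabs (w - z) ^+ 2.
  exists (fun z => 20736 * M z / r z ^+ 2); split.
    move=> z Dz; apply: divr_ge0; last exact: sqr_ge0.
    by apply: mulr_ge0; [exact: ler0n|exact: M0].
  move=> n z; have [Dz|nD] := pselect (disk z); last by exists 0.
  have [d h1 h2] := @taylor_estimate _ (u n) z (r z) (M z) (r0 z Dz)
    (fun v hv => du n v (square_in_disk Dz (lexx _) hv).2)
    (fun v hv => um n v _ (square_in_disk Dz (lexx _) hv).1 (T1 z Dz)).
  by exists d => _; split; [exact: h1|exact: h2].
have gex z : exists l, disk z -> forall e, 0 < e -> U [set n | cabs (u n z - l) < e].
  have [Dz|nD] := pselect (disk z); last by exists 0.
  have [l hl] := @ultra_cbounded U (fun n => u n z) (m (cabs z)) UU (fun n => um n z _ (lexx _) Dz).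
  by exists l.
have [g hg] := choice gex.
have near_disk z w : disk z -> cabs (w - z) < r z / 8 -> disk w.
  move=> Dz wz; have := r0 z Dz => rz.
  apply: (square_in_disk Dz (lexx _) _).2; apply: cabs_in_square.
  rewrite -/(r z); clear -wz rz; lra.
have gm z : disk z -> cabs (g z) <= m (cabs z).
  move=> Dz; apply/ler_addgt0Pr => e e0.
  have [n hn] := @filter_ex _ U _ _ (hg z Dz e e0).
  have := um n z _ (lexx _) Dz; have := cabs_sub (g z) (u n z).
  by move: hn; rewrite /= cabsBC; clear; lra.
(* The linear coefficients are bounded too, hence converge along the ultrafilter. The three errors
   sum to [e' + e' + e' * a = e]. *)
have gtay z : disk z -> exists2 d, cabs d <= 72 * M z / r z + 1 &
   forall w, cabs (w - z) < r z / 8 ->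
    cabs (g w - g z - cmul d (w - z)) <= K z * cabs (w - z) ^+ 2.
  move=> Dz; have [dn hdn] := choice (fun n => tay n z).
  have [d hd] := @ultra_cbounded U dn (72 * M z / r z) UU (fun n => (hdn n Dz).1).
  exists d.
    have [n /= hn] := @filter_ex _ U _ _ (hd 1 ltr01).
    have := (hdn n Dz).1; have := cabs_sub d (dn n); rewrite cabsBC.
    by move: hn; clear; lra.
  move=> w wz; apply/ler_addgt0Pr => e e0; have Dw := near_disk z w Dz wz.
  set a := cabs (w - z); have a0 : 0 <= a := cabs_ge0 _.
  pose e' := e / (2 + a).
  have e'0 : 0 < e' by rewrite divr_gt0//; clear -a0; lra.
  have [n /= [h1 [h2 h3]]] := @filter_ex _ U _ _
    (filterI (hg w Dw e' e'0) (filterI (hg z Dz e' e'0) (hd e' e'0))).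
  have h4 := (hdn n Dz).2 w wz.
  have -> : g w - g z - cmul d (w - z) = (u n w - u n z - cmul (dn n) (w - z)) +
     (- (u n w - g w) + (u n z - g z)) + cmul (dn n - d) (w - z).
    rewrite cmulBl; move: (cmul _ _) (cmul _ _) => A1 A2.
    move: (u n w) (u n z) (g w) (g z) => -[a1 a2] [b1 b2] [c1 c2] [d1 d2].
    by case: A1 => ? ?; case: A2 => ? ?; congr pair => /=; ring.
  apply: le_trans (cabs3 _ _ _) _.
  have h5 : cabs (- (u n w - g w) + (u n z - g z)) <= e' + e'.
    by apply: le_trans (cabsD _ _) _; rewrite cabsN lerD// ltW.
  have h6 : cabs (cmul (dn n - d) (w - z)) <= e' * a.
    by rewrite cabsM ler_wpM2r// ltW.
  have h7 : e' * (2 + a) = e by rewrite /e' mulfVK// lt0r_neq0//; clear -a0; lra.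
  rewrite -addrA; apply: lerD; first exact: h4.
  by clear -h5 h6 h7; lra.
have hgol : holomorphic_disk g.
  move=> z Dz; have [d _ hd] := gtay z Dz; exists d => e e0.
  pose del := Num.min (r z / 8) (e / (K z + 1)).
  have K1 : 0 < K z + 1 by have := K0 z Dz; clear; lra.
  exists del; split; first by rewrite lt_min; apply/andP; split; apply: divr_gt0 => //; exact: r0.
  move=> k; rewrite lt_min => /andP[kr ke] _.
  have := hd (z + k); rewrite (addrC z) addrK => /(_ kr).
  rewrite caddE caddE csubE (addrC z) opprD addrA => /le_trans; apply.
  rewrite expr2 mulrA ler_wpM2r ?cabs_ge0//.
  have : cabs k * (K z + 1) <= e by rewrite -ler_pdivlMr// ltW.
  by have := cabs_ge0 k; clear; lra.
(* Indices at which [u k] is within [1 / (n + 1)] of [g] at the first [n] rational points: a finite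
   intersection of members of the ultrafilter, hence a member with arbitrarily large elements. *)
pose B n := [set k | forall i, (i < n)%N -> disk (rat_point i) ->
  cabs (u k (rat_point i) - g (rat_point i)) < n.+1%:R^-1].
have UB n : U (B n).
  have : forall j, U [set k | forall i, (i < j)%N -> disk (rat_point i) ->
    cabs (u k (rat_point i) - g (rat_point i)) < n.+1%:R^-1].
    elim=> [|j IH]; first exact: filterE.
    have [Dj|nD] := pselect (disk (rat_point j)).
      have := hg _ Dj n.+1%:R^-1; rewrite invr_gt0 ltr0n => /(_ isT) hj.
      apply: filterS (filterI IH hj) => k [/= h1 h2] i; rewrite ltnS leq_eqVlt => /orP[/eqP ->//|].
      exact: h1.
    apply: filterS IH => k /= h1 i; rewrite ltnS leq_eqVlt => /orP[/eqP -> /nD//|]; exact: h1.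
  exact.
have [sigma [smono hs]] : exists sigma : nat -> nat,
    (forall n, (sigma n < sigma n.+1)%N) /\ forall n, B n (sigma n).
  apply: diagonal_subsequence => n s.
  have Us : U [set k | (s < k)%N] by apply: oU; exists s.+1.
  by have [k /= [h1 h2]] := @filter_ex _ U _ _ (filterI (UB n) Us); exists k.
exists sigma, g; split => // z Dz e e0.
(* A Lipschitz constant at [z] common to [g] and all [u n]; the summand 1 is the slack in the bound
   on the coefficient of [g]. *)
pose L := 72 * M z / r z + 1 + K z.
have L0 : 0 <= L.
  rewrite /L; have := K0 z Dz; have : 0 <= 72 * M z / r z.
    apply: divr_ge0; last exact/ltW/r0.
    by apply: mulr_ge0; [exact: ler0n|exact: M0].
  by clear; lra.
have equi f d : cabs d <= 72 * M z / r z + 1 -> (forall w, cabs (w - z) < r z / 8 ->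
    cabs (f w - f z - cmul d (w - z)) <= K z * cabs (w - z) ^+ 2) ->
    forall w, cabs (w - z) < r z / 8 -> cabs (f w - f z) <= L * cabs (w - z).
  move=> hd hf w wz; have := hf w wz; have Kz := K0 z Dz.
  have a1 : cabs (w - z) <= 1.
    apply: le_trans (ltW wz) _; rewrite /r; have := cabs_ge0 z; clear; lra.
  have := cabs_ge0 (w - z) => a0.
  have := cabs_sub (f w - f z) (cmul d (w - z)); rewrite cabsM => h1 h2.
  have h3 : cabs d * cabs (w - z) <= (72 * M z / r z + 1) * cabs (w - z) by rewrite ler_wpM2r.
  have h4 : K z * cabs (w - z) ^+ 2 <= K z * cabs (w - z).
    by rewrite ler_wpM2l// expr2 ler_piMr.
  by rewrite /L mulrDl; clear -h1 h2 h3 h4; lra.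
pose del := Num.min (r z / 8) (e / (3 * (L + 1))).
have L1 : 0 < 3 * (L + 1) by clear -L0; lra.
have del0 : 0 < del by rewrite lt_min; apply/andP; split; apply: divr_gt0 => //; exact: r0.
have [k hk] := rat_point_dense z del0.
set w := rat_point k in hk.
have wr : cabs (w - z) < r z / 8 by move: hk; rewrite lt_min => /andP[].
have we : L * cabs (w - z) <= e / 3.
  have : cabs (w - z) * (3 * (L + 1)) <= e.
    by rewrite -ler_pdivlMr//; move: hk; rewrite lt_min => /andP[_ /ltW].
  by have := cabs_ge0 (w - z); clear; lra.
have Dw := near_disk z w Dz wr.
have e3 : 0 < e / 3 by clear -e0; lra.
have [N hN] : exists N : nat, (N.+1%:R)^-1 < e / 3.
  exists (Num.Def.archi_bound (3 / e)); rewrite -[ltRHS]invrK ltf_pV2 ?posrE ?invr_gt0//.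
  rewrite invf_div; apply: lt_trans (archi_boundP _) _; first by rewrite divr_ge0// ltW.
  by rewrite ltr_nat.
(* [k < n] puts the rational point [w] among those controlled by [B n], and [n >= N] makes that
   control finer than [e / 3]. *)
exists (maxn N k.+1) => n; rewrite geq_max => /andP[Nn kn].
have h1 : cabs (u (sigma n) w - g w) < e / 3.
  apply: lt_trans (hs n k kn Dw) _; apply: le_lt_trans hN.
  by rewrite lef_pV2 ?posrE// ler_nat ltnS.
have h2 : cabs (u (sigma n) w - u (sigma n) z) <= L * cabs (w - z).
  have [d hd] := tay (sigma n) z; have [hd1 hd2] := hd Dz.
  apply: (equi (u (sigma n)) d _ hd2 w wr); apply: le_trans hd1 _; rewrite lerDl; exact: ler01.
have h3 : cabs (g w - g z) <= L * cabs (w - z).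
  by have [d hd1 hd2] := gtay z Dz; exact: (equi g d hd1 hd2 w wr).
have -> : u (sigma n) z - g z = - (u (sigma n) w - u (sigma n) z) +
  (u (sigma n) w - g w) + (g w - g z).
  by rewrite opprB !addrA !subrK.
apply: le_lt_trans (cabs3 _ _ _) _; rewrite cabsN.
by clear -h1 h2 h3 we; lra.
Qed.
End Montel.

(** * Integrability of [(1 - |z|)^(-1/2)] over the disk *)

Section DiskIntegrals.
Context {R : realType}.
Implicit Types (z w : R * R) (a b c x y s : R).
Notation mu := (@lebesgue_measure R).
Notation area := ((@lebesgue_measure R) \x (@lebesgue_measure R))%E.

Lemma FTC_segment (F f : R -> R) a b : a < b ->
  (forall x, a <= x <= b -> is_derive x 1 F (f x)) ->
  (forall x, a <= x <= b -> {for x, continuous f}) ->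
  (\int[mu]_(x in `[a, b]) (f x)%:E = (F b - F a)%:E)%E.
Proof.
move=> ab dF cf.
have cF x : a <= x <= b -> {for x, continuous F}.
  by move=> /dF h; apply: differentiable_continuous; apply/derivable1_diffP; case: h.
have oc x : x \in `]a, b[ -> a <= x <= b.
  by rewrite in_itv/= => /andP[/ltW -> /ltW ->].
rewrite (continuous_FTC2 ab (F := F)) //.
- by apply: continuous_in_subspaceT => x; rewrite inE/= in_itv/= => /cf.
- split; first by move=> x /oc/dF[].
  + by apply: cvg_at_right_filter; apply: cF; rewrite lexx ltW.
  + by apply: cvg_at_left_filter; apply: cF; rewrite lexx ltW.
- by move=> x /oc/dF h; rewrite derive1E; case: h.
Qed.

(** The derivative of [2 * asin (y / c)]; for [c > 0] it equals [2 / sqrt (c^2 - y^2)]. *)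
Definition arc_density c y : R := 2 * ((Num.sqrt (1 - (y / c) ^+ 2))^-1 * c^-1).

Lemma ratio_lt1 s c y : 0 <= s -> s < c -> - s <= y <= s -> -1 < y / c < 1.
Proof.
move=> s0 sc /andP[y1 y2]; have c0 : 0 < c by exact: le_lt_trans sc.
by rewrite ltr_pdivlMr// ltr_pdivrMr//; apply/andP; split; lra.
Qed.

Lemma one_minus_sqr_gt0 x : -1 < x < 1 -> 0 < 1 - x ^+ 2.
Proof.
move=> /andP[x1 x2]; rewrite (_ : 1 - x ^+ 2 = (1 - x) * (1 + x)); last by ring.
by apply: mulr_gt0; lra.
Qed.

Lemma continuous_arc_density c y : -1 < y / c < 1 -> {for y, continuous (arc_density c)}.
Proof.
move=> hy; apply: (@cvgM R); first exact: cvg_cst.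
apply: (@cvgM R); last exact: cvg_cst.
apply: (@cvgV R); first by rewrite lt0r_neq0// sqrtr_gt0 one_minus_sqr_gt0.
apply: (@continuous_comp _ _ _ (fun y => 1 - (y / c) ^+ 2) (@Num.sqrt R)).
  apply: (@cvgB R R); first exact: cvg_cst.
  by apply: (@cvgM R); apply: (@cvgM R); [exact: cvg_id|exact: cvg_cst|exact: cvg_id|exact: cvg_cst].
exact: sqrt_continuous.
Qed.

(** The two arcsines differ by less than [pi], and [2 * pi < 8]. *)
Lemma integral_arc_density s c : 0 < s -> s < c ->
  (\int[mu]_(y in `[(- s)%R, s]) (arc_density c y)%:E <= 8%:E)%E.
Proof.
move=> s0 sc; have c0 : 0 < c by exact: lt_trans sc.
have ss : - s < s by lra.
have ss1 : - s <= s <= s by rewrite lexx andbT ltW.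
have ss2 : - s <= - s <= s by rewrite lexx ltW.
have r1 y := @ratio_lt1 s c y (ltW s0) sc.
have dF y : - s <= y <= s -> is_derive y 1 (fun y => 2 * asin (y / c)) (arc_density c y).
  move=> /r1 hy.
  have d1 : is_derive y 1 (fun y : R => y / c) c^-1.
    have H := is_deriveM (is_derive_id y (1 : R)) (is_derive_cst c^-1 y (1 : R)).
    by apply: (is_derive_eq H); rewrite scaler0 add0r /GRing.scale/= mulr1.
  have d2 : is_derive (y / c) 1 asin (Num.sqrt (1 - (y / c) ^+ 2))^-1.
    exact: is_derive1_asin.
  have d3 := @is_derive1_comp _ asin (fun y => y / c) y _ _ d2 d1.
  exact: (@is_deriveZ _ _ _ (asin \o (fun y => y / c)) 2 y 1 _ d3).
have cf y : - s <= y <= s -> {for y, continuous (arc_density c)}.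
  move=> /r1 hy; exact: continuous_arc_density.
rewrite (FTC_segment ss dF cf) lee_fin.
have /andP[h1 h2] := r1 _ ss1; have /andP[h3 h4] := r1 _ ss2.
have := @asin_ltpi2 R (s / c); rewrite (ltW h1) h2 => /(_ isT).
have := @asin_gtNpi2 R (- s / c); rewrite h3 (ltW h4) => /(_ isT).
by have := @pihalf_lt2 R; clear; lra.
Qed.

(** The shift [e > 0] removes the singularity on the circle; the case [e = 0] is the weight of
    interest. *)
Definition boundary_weight (e : R) z : R := (Num.sqrt (1 - cabs z + e))^-1.

(** With [t = |(x, y)|] and [c^2 = 1 - x^2 + 2 e], one has [c^2 - y^2 = 1 - t^2 + 2 e <= 2 (1 - t +
    e)], using [1 - t^2 <= 2 (1 - t)]. The weight is thus below a density with an elementary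
    primitive on each vertical chord. *)
Lemma boundary_weight_le e x y : 0 < e -> x ^+ 2 + y ^+ 2 < 1 ->
  boundary_weight e (x, y) <= arc_density (Num.sqrt (1 - x ^+ 2 + 2 * e)) y.
Proof.
move=> e0 xy; set c := Num.sqrt _; set t := cabs (x, y).
have t2 : t ^+ 2 = x ^+ 2 + y ^+ 2 by rewrite cabs_sqr.
have t0 : 0 <= t := cabs_ge0 _.
have t1 : t < 1 by rewrite -(ltr_pXn2r (n := 2))// ?nnegrE// t2 expr1n.
have y0 := sqr_ge0 y; have x0 := sqr_ge0 x.
have c20 : 0 < 1 - x ^+ 2 + 2 * e by lra.
have c0 : 0 < c by rewrite sqrtr_gt0.
have c2 : c ^+ 2 = 1 - x ^+ 2 + 2 * e by rewrite sqr_sqrtr// ltW.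
have q0 : 0 < 1 - (y / c) ^+ 2.
  by rewrite expr_div_n subr_gt0 ltr_pdivrMr ?exprn_gt0// c2; lra.
have E : arc_density c y = 2 * (Num.sqrt (c ^+ 2 - y ^+ 2))^-1.
  rewrite /arc_density -invfM; congr (_ * _^-1).
  rewrite -{2}(ger0_norm (ltW c0)) -sqrtr_sqr -sqrtrM ?(ltW q0)//.
  by congr Num.sqrt; field; rewrite lt0r_neq0.
rewrite E /boundary_weight -/t.
have a0 : 0 < 1 - t + e by lra.
have b0 : 0 < c ^+ 2 - y ^+ 2 by rewrite c2; lra.
rewrite -[leLHS]mul1r ler_pdivrMr ?sqrtr_gt0// mulrAC ler_pdivlMr ?sqrtr_gt0// mul1r.
have -> : (2 : R) = Num.sqrt (2 ^+ 2) by rewrite sqrtr_sqr ger0_norm.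
rewrite -sqrtrM ?sqr_ge0// ler_sqrt ?mulr_ge0 ?sqr_ge0 ?(ltW a0)//.
have : 0 <= (1 - t) * (1 - t) by apply: mulr_ge0; lra.
by rewrite c2; lra.
Qed.

Lemma continuous_boundary_weight e z : 0 <= e -> disk z -> {for z, continuous (boundary_weight e)}.
Proof.
rewrite /disk /= => e0 z1; apply: (@cvgV R); first by rewrite lt0r_neq0// sqrtr_gt0; lra.
apply: (@continuous_comp _ _ _ (fun z => 1 - cabs z + e) (@Num.sqrt R)); last exact: sqrt_continuous.
apply: (@cvgD R R); last exact: cvg_cst.
by apply: (@cvgB R R); [exact: cvg_cst|exact: continuous_cabs].
Qed.

Lemma measurable_boundary_weight e : 0 <= e ->
  measurable_fun (@disk R) (fun z => (boundary_weight e z)%:E).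
Proof.
move=> e0; apply/measurable_EFinP; apply: continuous_measurable_plane; first exact: open_disk.
by move=> z; exact: continuous_boundary_weight.
Qed.

Lemma in_disk x y : disk (x, y) <-> x ^+ 2 + y ^+ 2 < 1.
Proof.
rewrite -(@cabs_sqr _ (x, y)) /disk /= -{2}(expr1n _ 2).
by rewrite ltr_pXn2r// ?nnegrE ?cabs_ge0.
Qed.

Lemma integral_boundary_weight_pos e : 0 < e ->
  (\int[area]_(z in @disk R) (boundary_weight e z)%:E <= 16%:E)%E.
Proof.
move=> e0; rewrite integral_mkcond; set g := (_ \_ _).
have mg : measurable_fun setT g.
  apply/(measurable_restrictT _ _).1; first exact: disk_measurable.
  by apply: measurable_boundary_weight; exact: ltW.
have g0 w : (0 <= g w)%E by apply: erestrict_ge0 => v _; rewrite lee_fin invr_ge0 sqrtr_ge0.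
rewrite fubini_tonelli1//.
have inner x : (fubini_F mu g x <= (cst 8%:E \_ `[(-1)%R, 1%R]) x)%E.
  rewrite /fubini_F patchE; case: ifPn => [_|xN]; last first.
    rewrite integral0_eq// => y _; rewrite /g patchE; case: ifPn => // /set_mem/in_disk xy.
    exfalso; move: xN; rewrite notin_setE /= in_itv/=; apply.
    have : x ^+ 2 <= 1 by have := sqr_ge0 y; lra.
    by rewrite -{1}(expr1n R 2) -[leLHS]real_normK ?num_real// ler_pXn2r ?nnegrE// ler_norml.
  have [x1|x1] := ltP (x ^+ 2) 1; last first.
    rewrite integral0_eq; first by rewrite lee_fin.
    move=> y _; rewrite /g patchE; case: ifPn => // /set_mem/in_disk xy.
    by exfalso; have := sqr_ge0 y; lra.
  (* [s] is half the chord. Because [e > 0], [s < c], so the density is continuous up to the ends of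
     the chord. Slices of at most 8 over [x] in [[-1, 1]] give 16. *)
  pose s := Num.sqrt (1 - x ^+ 2); pose c := Num.sqrt (1 - x ^+ 2 + 2 * e).
  have s0 : 0 < s by rewrite sqrtr_gt0; lra.
  have sc : s < c by rewrite ltr_sqrt; lra.
  apply: le_trans (integral_arc_density s0 sc).
  rewrite [leRHS]integral_mkcond.
  have ad0 y : - s <= y <= s -> 0 <= arc_density c y.
    by move=> _; rewrite /arc_density !mulr_ge0// invr_ge0 sqrtr_ge0.
  apply: ge0_le_integral => //.
  - exact: (measurable_fun_pair2 x mg).
  - apply/(measurable_restrictT _ _).1 => //; apply/measurable_EFinP.
    apply: subspace_continuous_measurable_fun => //.
    apply: continuous_in_subspaceT => y; rewrite inE/= in_itv/= => hy.
    exact: (continuous_arc_density (ratio_lt1 (ltW s0) sc hy)).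
  - move=> y _; rewrite /g !patchE; case: ifPn => [/set_mem/in_disk xy|_]; last first.
      by case: ifPn => // /set_mem/=; rewrite in_itv/= lee_fin => /ad0.
    have ys : - s <= y <= s.
      rewrite -ler_norml -(ler_pXn2r (n := 2))// ?nnegrE ?(ltW s0)//.
      by rewrite real_normK ?num_real// sqr_sqrtr; lra.
    by rewrite mem_set /= ?in_itv//= lee_fin; exact: boundary_weight_le.
apply: (@le_trans _ _ (\int[mu]_x (cst 8%:E \_ `[(-1)%R, 1%R]) x)%E).
  apply: ge0_le_integral => //.
  - by move=> x _; apply: integral_ge0.
  - exact: measurable_fun_fubini_tonelli_F.
  - by apply/(measurable_restrictT _ _).1.
rewrite -integral_mkcond integral_cst//= lebesgue_measure_itv/= lte_fin.
have -> : (-1 : R) < 1 by lra.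
by rewrite -EFinD -EFinM lee_fin; lra.
Qed.

(** Monotone convergence along [e = 1 / (n + 1)], the bound 16 not depending on [e]. *)
Theorem integral_boundary_weight :
  (\int[area]_(z in @disk R) (boundary_weight 0 z)%:E <= 16%:E)%E.
Proof.
pose g n z := (boundary_weight n.+1%:R^-1 z)%:E.
have n0 n : 0 < n.+1%:R^-1 :> R by rewrite invr_gt0 ltr0n.
have mono z : disk z -> nondecreasing_seq (g ^~ z).
  rewrite /disk /= => Dz n k nk; rewrite lee_fin /boundary_weight.
  have := n0 n; have := n0 k => h1 h2.
  have p1 : 0 < 1 - cabs z + n.+1%:R^-1 by rewrite addr_gt0// subr_gt0.
  have p2 : 0 < 1 - cabs z + k.+1%:R^-1 by rewrite addr_gt0// subr_gt0.
  rewrite lef_pV2 ?posrE ?sqrtr_gt0// ler_sqrt ?(ltW p1)//.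
  by rewrite lerD2l lef_pV2 ?posrE ?ltr0n// ler_nat.
have glim z : disk z -> limn (g ^~ z) = (boundary_weight 0 z)%:E.
  rewrite /disk /= => Dz; apply/cvg_lim => //; apply: cvg_EFin; first exact: nearW.
  apply: (@cvgV R); first by rewrite lt0r_neq0// sqrtr_gt0; lra.
  apply: (@cvg_comp _ _ _ (fun n : nat => 1 - cabs z + n.+1%:R^-1) (@Num.sqrt R) _ (nbhs (1 - cabs z + 0))).
    by apply: (@cvgD R R); [exact: cvg_cst|exact: cvg_harmonic].
  exact: sqrt_continuous.
rewrite [leLHS](_ : _ = \int[area]_(z in @disk R) limn (g ^~ z))%E; last first.
  by apply: eq_integral => z /set_mem Dz; rewrite glim.
rewrite monotone_convergence//; last 3 first.
- exact: disk_measurable.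
- by move=> n; apply: measurable_boundary_weight; exact/ltW.
- by move=> n z _; rewrite lee_fin invr_ge0 sqrtr_ge0.
apply: lime_le.
  apply: ereal_nondecreasing_is_cvgn => n k nk; apply: ge0_le_integral.
  - exact: disk_measurable.
  - by move=> z _; rewrite lee_fin invr_ge0 sqrtr_ge0.
  - by apply: measurable_boundary_weight; exact/ltW.
  - by apply: measurable_boundary_weight; exact/ltW.
  - by move=> z Dz; exact: mono.
by apply: nearW => n; exact: integral_boundary_weight_pos.
Qed.
End DiskIntegrals.

(** * From the ratio condition and [Delta2] to compactness *)

Section Sufficiency.
Context {R : realType} (Psi : R -> R).
Hypothesis OPsi : orlicz Psi.
Implicit Types (f g phi : R * R -> R * R) (a z w : R * R) (C c : R).
Notation mu := (@lebesgue_measure R).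
Notation area := ((@lebesgue_measure R) \x (@lebesgue_measure R))%E.

Lemma BPsi_norm_le f C : 0 < C -> (modular Psi f C <= 1)%E -> BPsi_norm Psi f <= C.
Proof. by move=> C0 hC; apply: ge_inf => //; exists 0 => t [/ltW]. Qed.

Lemma BPsi_norm_ge0 f : 0 <= BPsi_norm Psi f.
Proof.
rewrite /BPsi_norm; have [->|/set0P ne] := eqVneq [set C | 0 < C /\ (modular Psi f C <= 1)%E] set0.
  by rewrite inf0.
by apply: lb_le_inf => // t [/ltW].
Qed.

(** The existence hypothesis matters: since [inf set0 = 0], a function with no admissible constant
    would also have small norm. *)
Lemma BPsi_norm_lt f c : (exists C, 0 < C /\ (modular Psi f C <= 1)%E) ->
  BPsi_norm Psi f < c -> exists C, [/\ 0 < C, C < c & (modular Psi f C <= 1)%E].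
Proof. by move=> [C hC] /inf_lt[|t [t0 ht] tc]; [exists C|exists t]. Qed.

Definition growth a : R := Psi_inv Psi (((1 - cabs a) ^+ 2)^-1).

Lemma growth_mono a z : cabs a <= cabs z -> disk z -> growth a <= growth z.
Proof.
rewrite /disk /= => az z1; apply: (Psi_inv_le OPsi); first by rewrite invr_ge0 sqr_ge0.
rewrite lef_pV2 ?posrE ?exprn_gt0 ?subr_gt0//; last exact: le_lt_trans z1.
by rewrite ler_pXn2r ?nnegrE ?lerB// ?subr_ge0 ltW//; exact: le_lt_trans z1.
Qed.

Lemma growth_gt0 a : disk a -> 0 < growth a.
Proof. by rewrite /disk /= => a1; apply: (Psi_inv_gt0 OPsi); rewrite invr_gt0 exprn_gt0// subr_gt0. Qed.

Lemma norm_pointwise f c z : in_BPsi Psi f -> BPsi_norm Psi f < c -> disk z ->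
  cabs (f z) <= 6480 * c * growth z.
Proof.
move=> [hf ex] /(BPsi_norm_lt ex)[C [C0 Cc hC]] Dz.
apply: le_trans (modular_pointwise OPsi hf C0 hC Dz) _.
apply: ler_wpM2r; first exact/ltW/growth_gt0.
by apply: ler_wpM2l; [exact: ler0n|exact: ltW].
Qed.

Lemma area_disk_lty : (area (@disk R) < +oo)%E.
Proof.
apply: (@le_lt_trans _ _ (area (`[(-1)%R, 1%R]%classic `*` `[(-1)%R, 1%R]%classic))).
  apply: le_measure; rewrite ?inE; [exact: disk_measurable|by apply: measurableX|].
  move=> z; rewrite /disk /= !in_itv/= -!ler_norml => z1.
  by split; apply: le_trans (ltW z1); [exact: ler_cabs1|exact: ler_cabs2].
rewrite [ltLHS](_ : _ = (mu `[(-1)%R, 1%R]%classic * mu `[(-1)%R, 1%R]%classic)%E); last first.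
  by apply: product_measure1E; exact: measurable_itv.
by rewrite !lebesgue_measure_itv/= lte_fin; case: ifP => _; rewrite ?mule0// -EFinD -EFinM ltry.
Qed.

Lemma integrable_weight A : area.-integrable (@disk R) (fun z => (A + boundary_weight 0 z)%:E).
Proof.
have -> : (fun z => (A + boundary_weight 0 z)%:E) = (cst A%:E \+ (EFin \o boundary_weight 0))%E by [].
have mD := @disk_measurable R.
apply: integrableD => //.
  apply/integrableP; split; first exact: measurable_cst.
  rewrite [ltLHS](_ : _ = (`|A|%:E * area (@disk R))%E); last by rewrite integral_cst.
  by apply: lte_mul_pinfty => //; exact: area_disk_lty.
apply/integrableP; split; first by apply: measurable_boundary_weight.
rewrite (@le_lt_trans _ _ 16%:E) ?ltry//; apply: le_trans (@integral_boundary_weight R).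
rewrite le_eqVlt; apply/orP; left; apply/eqP; apply: eq_integral => z _ /=.
by rewrite ger0_norm// invr_ge0 sqrtr_ge0.
Qed.

Lemma Psi_small x e : 0 < e -> 0 <= x -> x <= 1 -> x * Psi 1 < e -> Psi x < e.
Proof.
move=> e0 x0 x1; apply: le_lt_trans.
by have := @Psi_scale _ _ OPsi 1 x ler01; rewrite mulr1 x0 x1 => /(_ isT).
Qed.

(** Dominated convergence with the integrable majorant [A + (1 - |a|)^(-1/2)]. The scale [c n] may
    vary, which serves both membership of a single function and convergence at a fixed scale. *)
Lemma modular_dominated (h : nat -> R * R -> R * R) (c : nat -> R) A :
  (forall n z, disk z -> {for z, continuous (h n)}) -> (forall n, 0 < c n) ->
  (forall n a, disk a -> Psi (cabs (h n a) / c n) <= A + boundary_weight 0 a) ->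
  (forall a, disk a -> forall e, 0 < e -> exists N : nat, forall n, (N <= n)%N ->
     cabs (h n a) / c n < e) ->
  exists N : nat, forall n, (N <= n)%N -> (modular Psi (h n) (c n) <= 1)%E.
Proof.
move=> ch c0 dom cvg0.
have q0 n a : 0 <= cabs (h n a) / c n by rewrite divr_ge0 ?cabs_ge0// ltW.
have mD := @disk_measurable R.
have H1 : {ae area, forall a, disk a -> (Psi (cabs (h n a) / c n))%:E @[n --> \oo] --> (cst 0%E a : \bar R)}.
  apply/aeW => a Da; apply/fine_cvgP; split; first exact: nearW.
  apply/cvgrPdist_lt => e e0.
  pose d := Num.min 1 (e / (Psi 1 + 1)).
  have P1 : 0 < Psi 1 + 1 by rewrite ltr_wpDl// (Psi_ge0 OPsi).
  have d0 : 0 < d by rewrite lt_min ltr01 divr_gt0.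
  have [N hN] := cvg0 a Da d d0.
  exists N => // n /= Nn; rewrite sub0r normrN ger0_norm ?(Psi_ge0 OPsi)//.
  have := hN n Nn; rewrite lt_min => /andP[/ltW h1 h2].
  apply: Psi_small => //; move: h2; rewrite ltr_pdivlMr//; apply: le_lt_trans.
  by rewrite ler_wpM2l// lerDl.
have H2 : {ae area, forall a n, disk a ->
    (`|(Psi (cabs (h n a) / c n))%:E| <= (A + boundary_weight 0 a)%:E)%E}.
  apply/aeW => a n Da /=; rewrite lee_fin ger0_norm ?(Psi_ge0 OPsi)//; exact: dom.
have [_ _] := @dominated_convergence _ _ _ area (@disk R) mD
  (fun n a => (Psi (cabs (h n a) / c n))%:E) (cst 0%E) (fun z => (A + boundary_weight 0 z)%:E)
  (fun n => measurable_modular OPsi (ch n) (c0 n)) (measurable_cst _) H1 (integrable_weight A) H2.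
rewrite integral0 => hc.
have pi0 : 0 < pi :> R := pi_gt0 R.
(* The modular carries the factor [1 / pi], so integrals tending to 0 need only drop below [pi]. *)
have : nbhs (0 : \bar R)%E [set x | (x < pi%:E)%E].
  by apply: open_nbhs_nbhs; split; [exact: open_ereal_lt_ereal|rewrite /= lte_fin].
move=> /hc[N _ hN]; exists N => n /hN /= hn.
by rewrite /modular /area_lebesgue lee_pdivrMl// mule1 ltW.
Qed.

(** The continuous function [1 / (1 - |phi a|)] is bounded on the compact disk of radius [r], and a
    bound on it keeps [|phi a|] away from 1. *)
Lemma map_disk_compact phi r : (forall z, disk z -> {for z, continuous phi}) ->
  (forall z, disk z -> disk (phi z)) -> r < 1 ->
  exists2 rho, rho < 1 & forall a, cabs a <= r -> cabs (phi a) <= rho.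
Proof.
move=> cphi dphi r1.
pose K := [set a : R * R | cabs a <= r].
have cK : compact K.
  have cB := compact_setX (@segment_compact R (-1) 1) (@segment_compact R (-1) 1).
  have cl : closed K.
    have -> : K = @cabs R @^-1` [set x | x <= r] by [].
    by apply: closed_comp => [x _|]; [exact: continuous_cabs|exact: closed_le].
  apply: (subclosed_compact cl cB) => z; rewrite /K /= !in_itv/= -!ler_norml => z1.
    have z2 : cabs z <= 1 by apply: le_trans z1 (ltW r1).
    by split; apply: le_trans z2; [exact: ler_cabs1|exact: ler_cabs2].
have KD z : K z -> disk z by rewrite /K /disk /= => /le_lt_trans; apply.
pose q a := (1 - cabs (phi a))^-1.
have p0 a : disk a -> 0 < 1 - cabs (phi a) by move=> /dphi; rewrite /disk /= subr_gt0.
have cq : {within K, continuous q}.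
  apply: continuous_in_subspaceT => a /set_mem /KD Da.
  apply: (@cvgV R); first by rewrite lt0r_neq0// p0.
  apply: (@cvgB R R); first exact: cvg_cst.
  by apply: (@continuous_comp _ _ R phi (@cabs R)); [exact: cphi|exact: continuous_cabs].
have /compact_bounded[M [_ hM]] := continuous_compact cq cK.
pose M1 := Num.max (M + 1) 1.
have M11 : 1 <= M1 by rewrite le_max lexx orbT.
have M10 : 0 < M1 by exact: lt_le_trans ltr01 M11.
exists (1 - M1^-1); first by rewrite gtrBl invr_gt0.
move=> a aK; have Da := KD a aK.
have : `|q a| <= M1.
  by apply: hM; [rewrite /M1 lt_max ltrDl ltr01|exists a].
have pa := p0 a Da.
rewrite ger0_norm; last by rewrite invr_ge0 ltW.
move=> h; have : M1^-1 <= 1 - cabs (phi a).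
  by rewrite -[leRHS]invrK lef_pV2 ?posrE ?invr_gt0.
by clear; lra.
Qed.

(** With [t = growth a / al^2] above the threshold, [Psi t ^ 4 <= Psi (al t) ^ 2 <= Psi (al^2 t) =
    (1 - |a|)^-2]. A single application would leave the non-integrable [(1 - |a|)^-1]. Below the
    threshold [Psi] is bounded by a constant. *)
Lemma Delta2_growth : Delta2 Psi -> exists2 al, 1 < al & exists2 A, 0 <= A &
  forall a, disk a -> Psi (growth a / al ^+ 2) <= A + boundary_weight 0 a.
Proof.
move=> [al [al1 [x0 hD]]]; exists al => //.
pose X := Num.max x0 0.
have X0 : 0 <= X by rewrite le_max lexx orbT.
have Xx : x0 <= X by rewrite le_max lexx.
exists (Psi X); first exact: (Psi_ge0 OPsi).
move=> a Da; have g0 := growth_gt0 Da.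
have al0 : 0 < al by exact: lt_trans ltr01 al1.
set t := growth a / al ^+ 2.
have t0 : 0 < t by rewrite divr_gt0// exprn_gt0.
have w0 : 0 <= boundary_weight 0 a by rewrite invr_ge0 sqrtr_ge0.
have [tX|Xt] := leP t X.
  apply: le_trans (_ : Psi X <= _); last by rewrite lerDl.
  exact: (Psi_le OPsi (ltW t0) tX).
apply: le_trans (_ : _ <= boundary_weight 0 a) _; last first.
  by rewrite lerDr (Psi_ge0 OPsi).
have tat : t <= al * t by rewrite ler_peMl// ltW.
have h1 := hD t (le_trans Xx (ltW Xt)).
have h2 := hD (al * t) (le_trans Xx (le_trans (ltW Xt) tat)).
have E : al * (al * t) = growth a by rewrite /t; field; rewrite lt0r_neq0.
have d0 : 0 < 1 - cabs a by rewrite subr_gt0.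
have PE : Psi (growth a) = ((1 - cabs a) ^+ 2)^-1.
  by rewrite /growth (PsiK OPsi)// invr_ge0 sqr_ge0.
rewrite E PE in h2.
have w4 : boundary_weight 0 a ^+ 4 = ((1 - cabs a) ^+ 2)^-1.
  rewrite /boundary_weight addr0 exprVn; congr (_^-1).
  by rewrite (exprM _ 2 2) sqr_sqrtr// ltW.
have P0 := Psi_ge0 OPsi (ltW t0).
rewrite -(ler_pXn2r (n := 4))// ?nnegrE// w4; apply: le_trans h2.
rewrite (exprM _ 2 2) ler_pXn2r ?nnegrE ?sqr_ge0// (Psi_ge0 OPsi)// mulr_ge0// ltW//.
Qed.

Theorem Delta2_ratio_compact phi : holomorphic_disk phi ->
  (forall z, disk z -> disk (phi z)) -> Delta2 Psi -> ratio_cond Psi phi ->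
  comp_compact Psi phi.
Proof.
move=> /holomorphic_diskP hphi dphi /Delta2_growth[al al1 [A A0 hal]] ratio u hu.
have cphi z : disk z -> {for z, continuous phi}.
  by move=> /hphi; exact: cdiff_continuous.
have al20 : 0 < al ^+ 2 by rewrite exprn_gt0// (lt_trans ltr01 al1).
(* Near the circle the ratio condition with [1 / (lam * al^2)] puts [lam * growth (phi a)] below
   [growth a / al^2]; on the remaining compact disk it is bounded. *)
have dom lam : 0 < lam -> exists2 A', 0 <= A' & forall a, disk a ->
    Psi (lam * growth (phi a)) <= A' + boundary_weight 0 a.
  move=> lam0; have e0 : 0 < (lam * al ^+ 2)^-1 by rewrite invr_gt0 mulr_gt0.
  have [r [r1 hr]] := ratio _ e0.
  have [rho rho1 hrho] := map_disk_compact cphi dphi r1.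
  (* [growth] depends only on the modulus, so a point of the real axis represents it; the maximum is
     there because [rho] is not known to be nonnegative. *)
  pose B := growth (Num.max rho 0, 0).
  have cB : cabs (Num.max rho 0, 0) = Num.max rho 0.
    by rewrite /cabs /= expr0n/= addr0 sqrtr_sqr ger0_norm// le_max lexx orbT.
  have DB : disk (Num.max rho 0, 0) by rewrite /disk /= cB gt_max rho1 ltr01.
  have PB : 0 <= Psi (lam * B) by apply: (Psi_ge0 OPsi); rewrite mulr_ge0// ltW// growth_gt0.
  exists (Psi (lam * B) + A); first exact: addr_ge0.
  move=> a Da; have w0 : 0 <= boundary_weight 0 a by rewrite invr_ge0 sqrtr_ge0.
  have gphi := growth_gt0 (dphi a Da).
  have [ar|ra] := leP (cabs a) r.
    apply: le_trans (_ : Psi (lam * B) <= _); last by rewrite -addrA lerDl addr_ge0.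
    apply: (Psi_le OPsi); first by rewrite mulr_ge0// ltW.
    rewrite ler_wpM2l ?(ltW lam0)//; apply: growth_mono => //; rewrite cB.
    by rewrite le_max hrho.
  have := hr a Da ra; rewrite -/(growth a) -/(growth (phi a)) => h.
  apply: le_trans (_ : Psi (growth a / al ^+ 2) <= _); last first.
    by apply: le_trans (hal a Da) _; rewrite lerD2r lerDr.
  apply: (Psi_le OPsi); first by rewrite mulr_ge0// ltW.
  have la0 : 0 < lam * al ^+ 2 by exact: mulr_gt0.
  move: h => /ltW; rewrite ler_pdivrMr ?growth_gt0// ler_pdivlMl//.
  by rewrite ler_pdivlMr// mulrAC.
have [M M0 hM] : exists2 M : R, 0 < M & forall n z, disk z -> cabs (u n z) <= M * growth z.
  (* The norms are at most 1 while [norm_pointwise] asks for a strict bound; 2 is a convenient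
     one. *)
  exists (6480 * 2); first by apply: mulr_gt0; rewrite ltr0n.
  move=> n z Dz; have [h1 h2] := hu n; apply: norm_pointwise => //.
  by apply: le_lt_trans h2 _; rewrite ltr1n.
have hol n : holomorphic_disk (u n) by have [[]] := hu n.
pose m t := M * growth (t, 0).
have growthE z t : cabs z <= t -> t < 1 -> growth z <= growth (t, 0).
  move=> zt t1; have t0 : 0 <= t by apply: le_trans zt; exact: cabs_ge0.
  have ct : cabs (t, 0) = t by rewrite /cabs /= expr0n/= addr0 sqrtr_sqr ger0_norm.
  by apply: growth_mono; rewrite /disk /= ct.
have [|sigma [g [smono hg gcvg gm]]] := @montel _ u m hol.
  move=> n z t zt t1; have Dz : disk z by exact: le_lt_trans zt t1.
  apply: le_trans (hM n z Dz) _; rewrite ler_wpM2l ?(ltW M0)//; exact: growthE.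
have gM z : disk z -> cabs (g z) <= M * growth z.
  move=> Dz; apply: le_trans (gm z Dz) _; rewrite /m ler_wpM2l ?(ltW M0)//.
  have cz : cabs (cabs z, 0) = cabs z.
    by rewrite {1}/cabs /= expr0n/= addr0 sqrtr_sqr ger0_norm// cabs_ge0.
  by apply: growth_mono => //; rewrite cz.
have dg z : disk z -> cdiff g z by move: z; apply/holomorphic_diskP.
have dgphi z : disk z -> cdiff (g \o phi) z.
  by move=> Dz; apply: cdiff_comp; [exact: hphi|exact/dg/dphi].
have duphi n z : disk z -> cdiff (u n \o phi) z.
  move=> Dz; apply: cdiff_comp; [exact: hphi|].
  by have /holomorphic_diskP := hol n; apply; exact: dphi.
have Psi_dom (t lam : R) a : disk a -> 0 <= t -> t <= lam * growth (phi a) ->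
    Psi t <= Psi (lam * growth (phi a)) by move=> Da t0 tl; exact: (Psi_le OPsi).
exists sigma, (g \o phi); split; [exact: smono|split].
  split; first by apply/holomorphic_diskP.
  have [A' A'0 hA'] := dom M M0.
  (* A constant sequence with scales [n + 1]: some large scale is admissible, so [g \o phi] lies in
     the space. *)
  have [||||N hN] := @modular_dominated (fun=> g \o phi) (fun n => n.+1%:R) A'.
  - by move=> n z Dz; apply: cdiff_continuous; exact: dgphi.
  - by move=> n; rewrite ltr0n.
  - move=> n a Da; apply: le_trans (hA' a Da); apply: Psi_dom => //.
      by rewrite divr_ge0 ?cabs_ge0.
    apply: le_trans (gM _ (dphi a Da)); rewrite ler_pdivrMr ?ltr0n//=.
    by rewrite ler_peMr ?cabs_ge0// ler1n.
  - move=> a Da e e0; exists (Num.Def.archi_bound (cabs (g (phi a)) / e)) => n Nn /=.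
    rewrite ltr_pdivrMr ?ltr0n// mulrC -ltr_pdivrMr//.
    apply: lt_le_trans (archi_boundP _) _; first by rewrite divr_ge0 ?cabs_ge0// ltW.
    by rewrite ler_nat ltnW// ltnS.
  by exists N.+1%:R; split; [rewrite ltr0n|exact: hN].
apply/cvgrPdist_le => e e0.
(* Both [u (sigma n) \o phi] and [g \o phi] are at most [M * growth (phi a)], so their difference at
   scale [e] is at most [2 M / e] times the growth. *)
have lam0 : 0 < 2 * M / e by rewrite divr_gt0// mulr_gt0.
have [A' A'0 hA'] := dom _ lam0.
have [||||N hN] := @modular_dominated
   (fun n z => Defs.csub (u (sigma n) (phi z)) ((g \o phi) z)) (fun=> e) A'.
- move=> n z Dz; apply: cdiff_continuous; apply: cdiffB; [exact: duphi|exact: dgphi].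
- by [].
- move=> n a Da; apply: le_trans (hA' a Da); apply: Psi_dom => //.
    by rewrite divr_ge0 ?cabs_ge0// ltW.
  rewrite ler_pdivrMr// csubE.
  have -> : 2 * M / e * growth (phi a) * e = M * growth (phi a) + M * growth (phi a).
    by field; rewrite lt0r_neq0.
  apply: le_trans (cabsD _ _) _; rewrite cabsN; apply: lerD; first exact/hM/dphi.
  exact/gM/dphi.
- move=> a Da e' e'0; have [|N hN] := gcvg _ (dphi a Da) (e' * e); first exact: mulr_gt0.
  by exists N => n /hN; rewrite csubE ltr_pdivrMr.
exists N => // n /= /hN hn; rewrite sub0r normrN ger0_norm ?BPsi_norm_ge0//.
exact: BPsi_norm_le.
Qed.

End Sufficiency.

(** * The kernels [1 - conj b z] and their Lorentzian majorants *)

Section TestFunctions.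
Context {R : realType}.
Implicit Types (a b z w : R * R) (d x y : R).
Notation mu := (@lebesgue_measure R).
Notation area := ((@lebesgue_measure R) \x (@lebesgue_measure R))%E.

Definition cconj b : R * R := (b.1, - b.2).

Lemma cabs_conj b : cabs (cconj b) = cabs b.
Proof. by rewrite /cabs /cconj /= sqrrN. Qed.

Definition kernel_den b z : R * R := (1, 0) - cmul (cconj b) z.

Lemma cabs1 : cabs ((1, 0) : R * R) = 1.
Proof. by rewrite /cabs/= expr1n expr0n/= addr0 sqrtr1. Qed.

Lemma cabs_real x : 0 <= x -> cabs (x, 0) = x.
Proof. by move=> x0; rewrite /cabs /= expr0n/= addr0 sqrtr_sqr ger0_norm. Qed.

Lemma kernel_den_ge b z : disk b -> disk z ->
  1 - cabs b <= cabs (kernel_den b z) /\ 1 - cabs z <= cabs (kernel_den b z).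
Proof.
rewrite /disk /= => b1 z1; have := cabs_sub (1, 0) (cmul (cconj b) z).
rewrite -/(kernel_den b z) cabs1 cabsM cabs_conj.
have h1 : cabs b * cabs z <= cabs b by rewrite ler_piMr ?cabs_ge0// ltW.
have h2 : cabs b * cabs z <= cabs z by rewrite ler_piMl ?cabs_ge0// ltW.
by move=> h; clear -h h1 h2; split; lra.
Qed.

Lemma kernel_den_sqr b z : cabs (kernel_den b z) ^+ 2 =
  cabs (z - b) ^+ 2 + (1 - cabs b ^+ 2) * (1 - cabs z ^+ 2).
Proof. by rewrite !cabs_sqr /kernel_den /cmul /cconj /=; ring. Qed.

Definition lorentz (p d x : R) : R := (1 + ((x - p) / d) ^+ 2)^-1.

Lemma lorentz_ge0 p d x : 0 <= lorentz p d x.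
Proof. by rewrite invr_ge0 addr_ge0 ?ler01 ?sqr_ge0. Qed.

(** The fourth power allows one factor [|1 - conj b z|^2] per coordinate: each of [d^2 + s^2] and
    [d^2 + t^2] is at most twice it. The majorant is then a product, which Fubini integrates by two
    arctangents. *)
Lemma kernel_den_lorentz b z : disk b -> disk z ->
  (1 - cabs b) ^+ 4 / cabs (kernel_den b z) ^+ 4 <=
  4 * (lorentz b.1 (1 - cabs b) z.1 * lorentz b.2 (1 - cabs b) z.2).
Proof.
move=> Db Dz; have [k1 k2] := kernel_den_ge Db Dz.
set d := 1 - cabs b in k1 *.
have d0 : 0 < d by rewrite subr_gt0.
set k := cabs (kernel_den b z) in k1 *.
have k0 : 0 < k by exact: lt_le_trans k1.
have k2' : cabs (z - b) ^+ 2 <= k ^+ 2.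
  rewrite kernel_den_sqr lerDl mulr_ge0// subr_ge0 -[leRHS](expr1n _ 2).
    by rewrite ler_pXn2r ?nnegrE ?cabs_ge0// ltW.
  by rewrite ler_pXn2r ?nnegrE ?cabs_ge0// ltW.
have k3 : d ^+ 2 <= k ^+ 2 by rewrite ler_pXn2r ?nnegrE// ltW.
rewrite cabs_sqr /= in k2'.
set s := z.1 - b.1 in k2' *; set t := z.2 - b.2 in k2' *.
have s2 := sqr_ge0 s; have t2 := sqr_ge0 t; have d2 := sqr_ge0 d.
rewrite /lorentz -/s -/t !expr_div_n -invfM.
have dn0 : d ^+ 2 != 0 by rewrite sqrf_eq0 lt0r_neq0.
have E : (1 + s ^+ 2 / d ^+ 2) * (1 + t ^+ 2 / d ^+ 2) =
    (d ^+ 2 + s ^+ 2) * (d ^+ 2 + t ^+ 2) / d ^+ 4 by field; rewrite lt0r_neq0.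
have dp : 0 < d ^+ 2 by rewrite exprn_gt0.
have P0 : 0 < (d ^+ 2 + s ^+ 2) * (d ^+ 2 + t ^+ 2) by rewrite mulr_gt0// ltr_wpDr.
rewrite E invf_div ler_pdivrMr ?exprn_gt0//.
set P := (_ * (d ^+ 2 + _)) in P0 *.
rewrite (_ : 4 * (d ^+ 4 / P) * k ^+ 4 = d ^+ 4 * ((4 * k ^+ 4) / P)); last by ring.
rewrite ler_peMr ?exprn_ge0 ?(ltW d0)// ler_pdivlMr// mul1r {P0 E} /P {P}.
have kp : 0 <= k ^+ 2 := sqr_ge0 k.
have -> : k ^+ 4 = k ^+ 2 * k ^+ 2 by rewrite -exprD.
clear -k2' k3 s2 t2 d2 kp; move: (k ^+ 2) (s ^+ 2) (t ^+ 2) (d ^+ 2) k2' k3 s2 t2 d2 kp.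
move=> K S T D h1 h2 S0 T0 D0 K0.
apply: le_trans (_ : (K + K) * (K + K) <= _); last by rewrite le_eqVlt; apply/orP; left; apply/eqP; ring.
by apply: ler_pM; lra.
Qed.

Lemma continuous_lorentz p d x : {for x, continuous (lorentz p d)}.
Proof.
have c1 : {for x, continuous (fun x : R => (x - p) / d)}.
  apply: (@cvgM R); last exact: cvg_cst.
  by apply: (@cvgB R R); [exact: cvg_id|exact: cvg_cst].
apply: (@cvgV R); first by rewrite lt0r_neq0// ltr_wpDr ?sqr_ge0.
by apply: (@cvgD R R); [exact: cvg_cst|apply: (@cvgM R)].
Qed.

Lemma integral_lorentz p d : 0 < d ->
  (\int[mu]_(x in `[(-1)%R, 1%R]) (lorentz p d x)%:E <= (pi * d)%:E)%E.
Proof.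
move=> d0; have h11 : -1 < 1 :> R by clear; lra.
have dF x : -1 <= x <= 1 -> is_derive x 1 (fun x => d * atan ((x - p) / d)) (lorentz p d x).
  move=> _.
  have h1 := is_deriveB (is_derive_id x (1 : R)) (is_derive_cst p x (1 : R)).
  have h2 := is_deriveM h1 (is_derive_cst d^-1 x (1 : R)).
  have d1 : is_derive x 1 (fun x : R => (x - p) / d) d^-1.
    by apply: (is_derive_eq h2); rewrite scaler0 add0r subr0 /GRing.scale/= mulr1.
  have d2 := @is_derive1_comp _ (@atan R) (fun x => (x - p) / d) x _ _
    (is_derive1_atan ((x - p) / d)) d1.
  apply: (is_derive_eq (@is_deriveZ _ _ _ (@atan R \o (fun x => (x - p) / d)) d x 1 _ d2)).
  by rewrite /GRing.scale/= mulrCA mulfV ?mulr1// lt0r_neq0.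
have cf x : -1 <= x <= 1 -> {for x, continuous (lorentz p d)} by move=> _; exact: continuous_lorentz.
rewrite (FTC_segment h11 dF cf) lee_fin -mulrBr mulrC ler_wpM2r ?(ltW d0)//.
have := @atan_ltpi2 R ((1 - p) / d); have := @atan_gtNpi2 R ((-1 - p) / d).
by clear; lra.
Qed.

Lemma measurable_lorentz p d : measurable_fun setT (lorentz p d).
Proof. by apply: continuous_measurable_fun => x; exact: continuous_lorentz. Qed.

Lemma integral_lorentz_disk p q d : 0 < d ->
  (\int[area]_(z in @disk R) (lorentz p d z.1 * lorentz q d z.2)%:E <= (pi ^+ 2 * d ^+ 2)%:E)%E.
Proof.
move=> d0.
pose P (t : R) := (fun x => (lorentz t d x)%:E) \_ `[(-1)%R, 1%R].
have mP t : measurable_fun setT (P t).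
  apply/(measurable_restrictT _ _).1 => //; apply/measurable_EFinP.
  by apply: measurable_funTS; exact: measurable_lorentz.
have P0 t x : (0 <= P t x)%E by apply: erestrict_ge0 => y _; rewrite lee_fin lorentz_ge0.
have mPP : measurable_fun setT (fun z : R * R => (P p z.1 * P q z.2)%E).
  apply: emeasurable_funM; first exact: (measurableT_comp (mP p) measurable_fst).
  exact: (measurableT_comp (mP q) measurable_snd).
have PP0 z : (0 <= P p z.1 * P q z.2)%E by rewrite mule_ge0.
apply: (@le_trans _ _ (\int[area]_z (P p z.1 * P q z.2))%E).
  apply: (@le_trans _ _ (\int[area]_(z in @disk R) (P p z.1 * P q z.2))%E); last first.
    by apply: ge0_subset_integral => //; exact: disk_measurable.
  rewrite le_eqVlt; apply/orP; left; apply/eqP; apply: eq_integral => z /set_mem Dz.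
  have [z1 z2] := (ler_cabs1 z, ler_cabs2 z).
  rewrite /P !patchE !mem_set//= in_itv/= -ler_norml.
    by apply: le_trans z2 _; exact: ltW.
  by apply: le_trans z1 _; exact: ltW.
have IP t : (\int[mu]_x P t x <= (pi * d)%:E)%E.
  by rewrite -integral_mkcond; exact: integral_lorentz.
have IP0 t : (0 <= \int[mu]_x P t x)%E by apply: integral_ge0.
rewrite fubini_tonelli1//= /fubini_F.
rewrite [leLHS](_ : _ = \int[mu]_x (P p x * \int[mu]_y P q y))%E; last first.
  apply: eq_integral => x _.
  exact: (@ge0_integralZl _ _ _ mu setT measurableT (P q) (mP q) (P p x) (fun y _ => P0 q y) (P0 p x)).
rewrite (@ge0_integralZr _ _ _ mu setT measurableT (P p) (mP p) (\int[mu]_y P q y)%E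
  (fun x _ => P0 p x) (IP0 q)).
apply: (@le_trans _ _ ((pi * d)%:E * (pi * d)%:E)%E); first exact: lee_pmul.
by rewrite -EFinM lee_fin le_eqVlt; apply/orP; left; apply/eqP; ring.
Qed.
End TestFunctions.

(** * From compactness to the ratio condition *)

Section Necessity.
Context {R : realType} (Psi : R -> R).
Hypothesis OPsi : orlicz Psi.
Implicit Types (f g phi : R * R -> R * R) (a b z w : R * R) (c y M : R).
Notation area := ((@lebesgue_measure R) \x (@lebesgue_measure R))%E.

Definition test_fun b c z : R * R :=
  let k := cinv (kernel_den b z) in cmul (c, 0) (cmul (cmul k k) (cmul k k)).

Lemma kernel_den_neq0 b z : disk b -> disk z -> kernel_den b z <> 0.
Proof.
move=> Db Dz k0; have [+ _] := kernel_den_ge Db Dz; rewrite k0 cabs0.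
by move: Db; rewrite /disk /=; clear -OPsi; lra.
Qed.

Lemma cabs_test_fun b c z : 0 <= c -> disk b -> disk z ->
  cabs (test_fun b c z) = c / cabs (kernel_den b z) ^+ 4.
Proof.
move=> c0 Db Dz; rewrite /test_fun !cabsM cabs_real// cabsV; last exact: kernel_den_neq0.
by rewrite -exprVn; congr (_ * _); ring.
Qed.

Lemma holomorphic_test_fun b c : disk b -> holomorphic_disk (test_fun b c).
Proof.
move=> Db; apply/holomorphic_diskP => z Dz.
have dk : cdiff (fun z => cinv (kernel_den b z)) z.
  apply: cdiffV; first exact: kernel_den_neq0.
  apply: cdiffB; first exact: cdiff_cst.
  by apply: cdiffM; [exact: cdiff_cst|exact: cdiff_id].
apply: cdiffM; first exact: cdiff_cst.
by apply: cdiffM; exact: cdiffM.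
Qed.

(** For fixed [b] the function is bounded, because [|1 - conj b z| >= 1 - |b|]; this boundedness
    feeds [bounded_sub_modular]. *)
Lemma test_fun_le b c z : 0 <= c -> disk b -> disk z ->
  cabs (test_fun b (c * (1 - cabs b) ^+ 4) z) <= c.
Proof.
move=> c0 Db Dz; have d0 : 0 < 1 - cabs b by rewrite subr_gt0.
have [k1 _] := kernel_den_ge Db Dz.
rewrite cabs_test_fun//; last by rewrite mulr_ge0// exprn_ge0// ltW.
rewrite ler_pdivrMr; last by rewrite exprn_gt0// (lt_le_trans d0).
by rewrite ler_wpM2l// ler_pXn2r ?nnegrE ?cabs_ge0// ltW.
Qed.

(** Write the modulus as [h / (4 pi)] times [Y = growth b] with [h <= 1]. Convexity takes the factor
    out of [Psi], leaving [h / (4 pi d^2)]; as [h] is at most 4 times a Lorentzian product of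
    integral at most [pi^2 d^2], the integral is at most [pi]. This is the origin of [4 * pi]. *)
Lemma modular_test_fun b : disk b ->
  (modular Psi (test_fun b (growth Psi b / (4 * pi) * (1 - cabs b) ^+ 4)) 1 <= 1)%E.
Proof.
move=> Db; set d := 1 - cabs b; have d0 : 0 < d by rewrite subr_gt0.
set Y := growth Psi b; have Y0 : 0 < Y by exact: growth_gt0.
have PY : Psi Y = (d ^+ 2)^-1 by rewrite /Y /growth (PsiK OPsi)// invr_ge0 sqr_ge0.
have pi0 : 0 < pi :> R := pi_gt0 R.
have pi1 : 1 <= 4 * pi :> R by have := @pi_ge2 R; clear -OPsi; lra.
set c := Y / (4 * pi); have c0 : 0 <= c by rewrite divr_ge0 ?mulr_ge0 ?ltW.
set u := test_fun b _.
have bound z : disk z -> Psi (cabs (u z) / 1) <=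
    (pi * d ^+ 2)^-1 * (lorentz b.1 d z.1 * lorentz b.2 d z.2).
  move=> Dz; have [k1 _] := kernel_den_ge Db Dz.
  set k := cabs (kernel_den b z) in k1.
  have k0 : 0 < k by exact: lt_le_trans k1.
  pose h := d ^+ 4 / k ^+ 4.
  have h0 : 0 <= h by rewrite divr_ge0// exprn_ge0// ltW.
  have h1 : h <= 1.
    by rewrite ler_pdivrMr ?exprn_gt0// mul1r ler_pXn2r ?nnegrE// ltW.
  have E : cabs (u z) / 1 = h / (4 * pi) * Y.
    rewrite divr1 /u cabs_test_fun// -/k; last by rewrite mulr_ge0// exprn_ge0// ltW.
    by rewrite /c /h; move: (pi : R) pi0 => p p0; field; rewrite !lt0r_neq0.
  have hp : 0 <= h / (4 * pi) <= 1.
    apply/andP; split; first by rewrite divr_ge0// mulr_ge0// ltW.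
    rewrite ler_pdivrMr ?mulr_gt0// mul1r.
    exact: le_trans h1 pi1.
  rewrite E; apply: le_trans (Psi_scale OPsi (ltW Y0) hp) _; rewrite PY.
  have -> : h / (4 * pi) / d ^+ 2 = (pi * d ^+ 2)^-1 * (h / 4).
    by move: (pi : R) pi0 => p p0; field; rewrite !lt0r_neq0.
  rewrite ler_wpM2l//; first by rewrite invr_ge0 mulr_ge0 ?sqr_ge0 ?ltW.
  by rewrite ler_pdivrMr// mulrC; exact: kernel_den_lorentz.
rewrite /modular /area_lebesgue lee_pdivrMl// mule1.
have hu z : disk z -> {for z, continuous u}.
  by move=> Dz; apply: cdiff_continuous; move: z Dz; apply/holomorphic_diskP/holomorphic_test_fun.
have mb : measurable_fun (@disk R) (fun z => (lorentz b.1 d z.1 * lorentz b.2 d z.2)%:E).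
  apply/measurable_EFinP; apply: measurable_funTS; apply: measurable_funM.
    exact: (measurableT_comp (measurable_lorentz b.1 d) measurable_fst).
  exact: (measurableT_comp (measurable_lorentz b.2 d) measurable_snd).
apply: (@le_trans _ _ (\int[area]_(z in @disk R) ((pi * d ^+ 2)^-1%:E * (lorentz b.1 d z.1 * lorentz b.2 d z.2)%:E))%E).
  apply: ge0_le_integral.
  - exact: disk_measurable.
  - by move=> z Dz; rewrite lee_fin (Psi_ge0 OPsi)// divr_ge0 ?cabs_ge0.
  - exact: measurable_modular.
  - exact: emeasurable_funM.
  - by move=> z Dz; rewrite -EFinM lee_fin; exact: bound.
have b0 (z : R * R) : (0 <= (lorentz b.1 d z.1 * lorentz b.2 d z.2)%:E)%E.
  by rewrite lee_fin mulr_ge0// lorentz_ge0.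
have e0 : (0 <= ((pi * d ^+ 2)^-1)%:E)%E by rewrite lee_fin invr_ge0 mulr_ge0 ?sqr_ge0 ?ltW.
rewrite (@ge0_integralZl _ _ _ area (@disk R) (@disk_measurable R) _ mb _ (fun z _ => b0 z) e0).
apply: (@le_trans _ _ ((pi * d ^+ 2)^-1%:E * (pi ^+ 2 * d ^+ 2)%:E)%E).
  by apply: lee_wpmul2l => //; exact: integral_lorentz_disk.
rewrite -EFinM lee_fin le_eqVlt; apply/orP; left; apply/eqP.
by move: (pi : R) pi0 => p p0; field; rewrite !lt0r_neq0.
Qed.

(** Supplies the admissible constant without which a small [BPsi_norm] of the difference says
    nothing. Midpoint convexity splits the modular into half of a bounded part and half of the
    modular of [g], each contributing at most [pi / 2] to the integral. *)
Lemma bounded_sub_modular f g M : (forall z, disk z -> {for z, continuous f}) ->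
  (forall z, disk z -> cabs (f z) <= M) -> in_BPsi Psi g ->
  exists C, 0 < C /\ (modular Psi (fun z => Defs.csub (f z) (g z)) C <= 1)%E.
Proof.
move=> cf fM [/holomorphic_diskP dg [Cg [Cg0 hg]]].
have cg z : disk z -> {for z, continuous g} by move=> /dg; exact: cdiff_continuous.
have cfg z : disk z -> {for z, continuous (fun z => Defs.csub (f z) (g z))}.
  move=> Dz; rewrite (_ : (fun z => _) = (fun z => f z + (fun w => - g w) z))//.
  exact: (continuous_cadd (cf z Dz) (continuous_copp (cg z Dz))).
have pi0 : 0 < pi :> R := pi_gt0 R.
have D0 : disk (0 : R * R) by rewrite /disk /= cabs0.
have M0 : 0 <= M by apply: le_trans (fM _ D0); exact: cabs_ge0.
pose al := fine (area (@disk R)).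
have al0 : 0 <= al by apply: fine_ge0; exact: measure_ge0.
have alE : area (@disk R) = al%:E.
  by rewrite /al fineK// ge0_fin_numE; [exact: area_disk_lty|exact: measure_ge0].
have P1 : 0 <= Psi 1 by exact: (Psi_ge0 OPsi).
pose q := Psi 1 * al / pi.
have q0 : 0 <= q by rewrite divr_ge0 ?(ltW pi0)// mulr_ge0.
have qE : q * pi = Psi 1 * al by rewrite /q mulfVK// lt0r_neq0.
(* [C >= 2 * Cg] serves the part of [g]; for the bounded part [t = 2 M / C] satisfies [t <= 1] and
   [t * q <= 1], so [Psi t * al <= t * Psi 1 * al = t * q * pi <= pi]. *)
pose C := 2 * Cg + 2 * M * (1 + q) + 1.
have Mq : 0 <= M * q by rewrite mulr_ge0.
have C0 : 0 < C by rewrite /C; clear -OPsi Cg0 M0 Mq; lra.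
have CCg : 2 * Cg <= C by rewrite /C; clear -OPsi Cg0 M0 Mq; lra.
pose t := 2 * M / C.
have t0 : 0 <= t by rewrite divr_ge0 ?mulr_ge0// ltW.
have t1 : t <= 1 by rewrite ler_pdivrMr// mul1r /C; clear -OPsi Cg0 M0 Mq; lra.
have tP : Psi t * al <= pi.
  have h1 : Psi t <= t * Psi 1.
    by have := @Psi_scale _ _ OPsi 1 t ler01; rewrite mulr1 t0 t1 => /(_ isT).
  apply: le_trans (ler_wpM2r al0 h1) _; rewrite -mulrA -qE mulrA ger_pMl//.
  rewrite /t mulrAC ler_pdivrMr// mul1r /C; clear -OPsi Cg0 M0 Mq; lra.
exists C; split=> //.
have bound z : disk z -> Psi (cabs (Defs.csub (f z) (g z)) / C) <=
   Psi t / 2 + 2^-1 * Psi (cabs (g z) / Cg).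
  move=> Dz; have g0 : 0 <= cabs (g z) / Cg by rewrite divr_ge0 ?cabs_ge0// ltW.
  apply: le_trans (_ : Psi ((t + cabs (g z) / Cg) / 2) <= _); last first.
    by have := Psi_mid OPsi t0 g0; clear -OPsi; lra.
  apply: (Psi_le OPsi); first by rewrite divr_ge0 ?cabs_ge0// ltW.
  rewrite ler_pdivrMr// csubE; apply: le_trans (cabsD _ _) _; rewrite cabsN.
  have -> : (t + cabs (g z) / Cg) / 2 * C = M + cabs (g z) * (C / (2 * Cg)).
    by rewrite /t; field; rewrite !lt0r_neq0.
  apply: lerD; first exact: fM.
  by rewrite ler_peMr ?cabs_ge0// ler_pdivlMr ?mulr_gt0// mul1r.
have mg := measurable_modular OPsi cg Cg0.
have Pg0 z : (0 <= (Psi (cabs (g z) / Cg))%:E)%E.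
  by rewrite lee_fin (Psi_ge0 OPsi)// divr_ge0 ?cabs_ge0// ltW.
have mD := @disk_measurable R.
have half0 : (0 <= (2^-1 : R)%:E)%E by rewrite lee_fin invr_ge0.
move: hg; rewrite /modular /area_lebesgue !lee_pdivrMl// !mule1 => hg.
apply: (@le_trans _ _ (\int[area]_(z in @disk R) ((Psi t / 2)%:E + 2^-1%:E * (Psi (cabs (g z) / Cg))%:E))%E).
  apply: ge0_le_integral.
  - exact: mD.
  - by move=> z Dz; rewrite lee_fin (Psi_ge0 OPsi)// divr_ge0 ?cabs_ge0// ltW.
  - exact: (measurable_modular OPsi cfg C0).
  - apply: emeasurable_funD; first exact: measurable_cst.
    by apply: emeasurable_funM; [exact: measurable_cst|exact: mg].
  - by move=> z Dz; rewrite -EFinM -EFinD lee_fin; exact: bound.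
rewrite ge0_integralD//; last 3 first.
- by move=> z _; rewrite lee_fin divr_ge0// (Psi_ge0 OPsi).
- by move=> z _; rewrite mule_ge0.
- exact: emeasurable_funM.
rewrite [X in (X + _)%E](_ : _ = ((Psi t / 2)%:E * al%:E)%E); last first.
  by rewrite integral_cst//; congr (_ * _)%E; exact: alE.
rewrite (@ge0_integralZl _ _ _ area (@disk R) mD _ mg _ (fun z _ => Pg0 z) half0).
apply: (@le_trans _ _ ((Psi t / 2)%:E * al%:E + 2^-1%:E * pi%:E)%E).
  by apply: leeD => //; apply: lee_wpmul2l.
by rewrite -!EFinM -EFinD lee_fin; clear -OPsi tP; lra.
Qed.

Theorem compact_ratio phi : holomorphic_disk phi -> (forall z, disk z -> disk (phi z)) ->
  comp_compact Psi phi -> ratio_cond Psi phi.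
Proof.
move=> /holomorphic_diskP hphi dphi cpt e e0; apply: contrapT => hN.
have pi0 : 0 < pi :> R := pi_gt0 R.
have n0 (n : nat) : 0 < n.+1%:R :> R by rewrite ltr0n.
(* The failing ratio condition is tested at the radii [1 - 1 / (n + 1)]. *)
have hex (n : nat) : exists a, [/\ disk a, 1 - n.+1%:R^-1 < cabs a &
    e * growth Psi a <= growth Psi (phi a)].
  apply: contrapT => hne; apply: hN; exists (1 - n.+1%:R^-1); split.
    by rewrite gtrBl invr_gt0.
  move=> a Da ra; rewrite ltNge; apply/negP => h; apply: hne; exists a; split => //.
  by rewrite -ler_pdivlMr// growth_gt0.
have [a ha] := choice hex.
have Da n : disk (a n) by have [] := ha n.
pose b n := phi (a n); have Db n : disk (b n) by exact/dphi/Da.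
pose d n := 1 - cabs (b n).
have d0 n : 0 < d n by rewrite subr_gt0; exact: Db.
pose y n := growth Psi (b n).
have y0 n : 0 < y n by exact: (growth_gt0 OPsi).
have Py n : Psi (y n) = (d n ^+ 2)^-1 by rewrite (PsiK OPsi)// invr_ge0 sqr_ge0.
have t0 n : 0 < growth Psi (a n) by exact: (growth_gt0 OPsi).
have tlarge T : exists N : nat, forall n, (N <= n)%N -> T <= growth Psi (a n).
  exists (Num.Def.archi_bound (`|Psi T| + 1)) => n Nn; rewrite leNgt; apply/negP => tT.
  have := Psi_lt OPsi (ltW (t0 n)) tT; rewrite (PsiK OPsi) ?invr_ge0 ?sqr_ge0//.
  have [_ + _] := ha n; have := Da n; rewrite /disk /=.
  set s := cabs (a n) => s1 s2.
  have s0 : 0 < 1 - s by rewrite subr_gt0.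
  have h1 : n.+1%:R < (1 - s)^-1.
    by rewrite -[ltLHS]invrK ltf_pV2 ?posrE ?invr_gt0// ltrBlDr addrC -ltrBlDr.
  have h2 : `|Psi T| + 1 < n.+1%:R.
    apply: lt_le_trans (archi_boundP _) _; first by rewrite addr_ge0.
    by rewrite ler_nat ltnW.
  have h3 : 1 < (1 - s)^-1.
    by apply: le_lt_trans h1; rewrite ler1n.
  have h4 : (1 - s)^-1 <= ((1 - s) ^+ 2)^-1.
    by rewrite -exprVn expr2 ler_peMl ?(ltW h3)// invr_ge0 ltW.
  by have := ler_norm (Psi T); move: h1 h2 h4; clear -OPsi; lra.
have [x0 x00 hx0] := Psi_superlinear OPsi.
(* That [|phi (a n)|] tends to 1 is derived, not assumed: [y n >= e * growth (a n)] forces [y n] to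
   infinity, and [Psi (y n) = d n ^-2] then forces [d n] to 0. *)
have ylarge Y : exists N : nat, forall n, (N <= n)%N -> Y <= y n.
  have [N hY] := tlarge (Y / e); exists N => n /hY; rewrite ler_pdivrMr// mulrC => h.
  by apply: le_trans h _; have [] := ha n.
(* Superlinearity gives [y n <= Psi (y n) = d n ^-2] for large [n]. *)
have yd : exists N : nat, forall n, (N <= n)%N -> y n * d n ^+ 2 <= 1.
  have [N hY] := ylarge x0; exists N => n /hY/hx0.
  by rewrite Py -[leRHS]mul1r ler_pdivlMr// exprn_gt0.
have dsmall eta : 0 < eta -> exists N : nat, forall n, (N <= n)%N -> d n ^+ 2 <= eta.
  move=> eta0; have [N1 h1] := yd; have [N2 h2] := ylarge eta^-1.
  exists (maxn N1 N2) => n; rewrite geq_max => /andP[/h1 g1 /h2 g2].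
  have dd : 0 <= d n ^+ 2 := sqr_ge0 _.
  have : eta^-1 * d n ^+ 2 <= 1 by apply: le_trans g1; rewrite ler_wpM2r.
  by rewrite mulrC ler_pdivrMr// mul1r.
pose c n := y n / (4 * pi).
have c0 n : 0 < c n by rewrite divr_gt0// mulr_gt0.
have cy n : c n <= y n.
  rewrite ler_pdivrMr ?mulr_gt0// ler_peMr ?(ltW (y0 n))//.
  by have := @pi_ge2 R; clear -OPsi; lra.
have cd0 n : 0 <= c n * d n ^+ 4 by rewrite mulr_ge0 ?exprn_ge0// ltW.
pose u n := test_fun (b n) (c n * d n ^+ 4).
have hu n : holomorphic_disk (u n) by exact: holomorphic_test_fun.
have uB n : in_BPsi Psi (u n) /\ BPsi_norm Psi (u n) <= 1.
  have hm := modular_test_fun (Db n); split; first by split => //; exists 1; split.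
  exact: BPsi_norm_le.
have [sigma [g [smono [gB]]]] := cpt u uB.
move=> /cvgrPdist_lt ncvg.
pose v n z := Defs.csub (u (sigma n) (phi z)) (g z).
have du n z : disk z -> cdiff (u n \o phi) z.
  move=> Dz; apply: cdiff_comp; first exact: hphi.
  by have /holomorphic_diskP := hu n; apply; exact: dphi.
have dg z : disk z -> cdiff g z.
  by have [/holomorphic_diskP h _] := gB; exact: h.
have vB n : in_BPsi Psi (v n).
  split; first by apply/holomorphic_diskP => z Dz; apply: cdiffB; [exact: du|exact: dg].
  have cu z : disk z -> {for z, continuous (u (sigma n) \o phi)}.
    by move=> Dz; apply: cdiff_continuous; exact: du.
  have bu z : disk z -> cabs ((u (sigma n) \o phi) z) <= c (sigma n).
    by move=> Dz; apply: test_fun_le; [exact: ltW|exact: Db|exact: dphi].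
  exact: (bounded_sub_modular cu bu gB).
have [K K0 hK] : exists2 K : R, 0 < K & forall f C z, in_BPsi Psi f ->
    BPsi_norm Psi f < C -> disk z -> cabs (f z) <= K * C * growth Psi z.
  exists 6480; first by rewrite ltr0n.
  move=> f C z h1 h2 h3; exact: (norm_pointwise OPsi h1 h2 h3).
have vsmall eta : 0 < eta -> exists N : nat, forall n, (N <= n)%N ->
    forall z, disk z -> cabs (v n z) <= K * eta * growth Psi z.
  move=> eta0; have [N _ hN'] := ncvg _ eta0; exists N => n /hN' /=.
  rewrite sub0r normrN ger0_norm ?BPsi_norm_ge0// => hn z Dz.
  exact: hK (vB n) hn Dz.
have sge (n : nat) : (n <= sigma n)%N.
  by elim: n => // n IH; apply: leq_ltn_trans IH (smono n).
(* Since [c n * d n ^ 2 <= y n * d n ^ 2 <= 1], the value at [w] is at most [d n ^ 2 / (1 - |w|)^4],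
   which tends to 0. *)
have usmall w eta : disk w -> 0 < eta -> exists N : nat, forall n, (N <= n)%N -> cabs (u n w) <= eta.
  move=> Dw eta0; have w0 : 0 < (1 - cabs w) ^+ 4 by rewrite exprn_gt0// subr_gt0.
  have [N1 h1] := yd; have [|N2 h2] := dsmall (eta * (1 - cabs w) ^+ 4); first exact: mulr_gt0.
  exists (maxn N1 N2) => n; rewrite geq_max => /andP[/h1 g1 /h2 g2].
  have [_ k2] := kernel_den_ge (Db n) Dw.
  have w1 : 0 < 1 - cabs w by rewrite subr_gt0.
  rewrite /u cabs_test_fun// ler_pdivrMr; last by rewrite exprn_gt0// (lt_le_trans w1).
  apply: le_trans (_ : d n ^+ 2 <= _).
    have -> : c n * d n ^+ 4 = (c n * d n ^+ 2) * d n ^+ 2 by rewrite -mulrA -exprD.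
    rewrite ler_piMl ?sqr_ge0//; apply: le_trans g1; rewrite ler_wpM2r ?sqr_ge0//.
  apply: le_trans g2 _; rewrite ler_wpM2l ?(ltW eta0)//.
  by rewrite ler_pXn2r ?nnegrE ?cabs_ge0// ltW.
(* Norm convergence implies pointwise convergence through the growth bound, while the test functions
   vanish in the limit at the fixed point [phi z]. *)
have g0 z : disk z -> cabs (g z) = 0.
  move=> Dz; apply/eqP; rewrite eq_le cabs_ge0 andbT; apply/ler_addgt0Pr => eps eps0.
  rewrite add0r; have e2 : 0 < eps / 2 by rewrite divr_gt0.
  have gz := growth_gt0 OPsi Dz.
  have [|N1 h1] := vsmall (eps / 2 / (K * growth Psi z)); first by rewrite divr_gt0// mulr_gt0.
  have [N2 h2] := usmall _ _ (dphi z Dz) e2.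
  have := h1 (maxn N1 N2) (leq_maxl _ _) z Dz.
  have := h2 (sigma (maxn N1 N2)) (leq_trans (leq_maxr _ _) (sge _)).
  have -> : K * (eps / 2 / (K * growth Psi z)) * growth Psi z = eps / 2.
    by field; rewrite !lt0r_neq0.
  rewrite /v csubE => h3 h4; have := cabs_sub (g z) (u (sigma (maxn N1 N2)) (phi z)).
  by rewrite cabsBC; move: h3 h4; clear -OPsi; lra.
(* At [a k] the growth bound gives at most [e * growth (a k) / (128 pi) <= y k / (128 pi)], while
   the kernel at its own centre is at least [c k / 16 = y k / (64 pi)]. *)
pose eta := e / (128 * pi * K).
have eta0 : 0 < eta by rewrite divr_gt0// !mulr_gt0.
have [N hNv] := vsmall eta eta0.
pose k := sigma N.
have := hNv N (leqnn N) (a k) (Da k).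
have -> : v N (a k) = u k (b k).
  by rewrite /v csubE (cabs_eq0 (g0 _ (Da k))) subr0.
rewrite /u cabs_test_fun//.
(* At the centre the denominator has modulus [1 - |b|^2 <= 2 (1 - |b|)]; its fourth power produces
   the 16. *)
have kE : cabs (kernel_den (b k) (b k)) <= 2 * d k.
  rewrite -(ler_pXn2r (n := 2))// ?nnegrE ?cabs_ge0 ?mulr_ge0 ?(ltW (d0 k))//.
  rewrite kernel_den_sqr subrr cabs0 expr0n/= add0r -expr2.
  have := d0 k; have := cabs_ge0 (b k); rewrite /d; move: (cabs (b k)) => s s0 s1.
  rewrite ler_pXn2r ?nnegrE//; last 2 first.
  - have -> : 1 - s ^+ 2 = (1 - s) * (1 + s) by ring.
    by rewrite mulr_ge0 ?(ltW s1)// addr_ge0.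
  - by rewrite mulr_ge0// ltW.
  have -> : 1 - s ^+ 2 = (1 + s) * (1 - s) by ring.
  by rewrite ler_wpM2r ?(ltW s1)//; move: s1; clear -OPsi; lra.
have kp : 0 < cabs (kernel_den (b k) (b k)).
  by apply: cabs_gt0; exact: kernel_den_neq0.
rewrite leNgt => /negP; apply.
have ek : e * growth Psi (a k) <= y k by have [] := ha k.
apply: lt_le_trans (_ : c k / 16 <= _).
  rewrite /eta /c.
  have -> : K * (e / (128 * pi * K)) * growth Psi (a k) = (e * growth Psi (a k)) / (128 * pi).
    by move: (pi : R) pi0 => p p0; field; rewrite !lt0r_neq0.
  have -> : y k / (4 * pi) / 16 = 2 * y k / (128 * pi).
    by move: (pi : R) pi0 => p p0; field; rewrite lt0r_neq0.
  rewrite ltr_pM2r ?invr_gt0 ?mulr_gt0//; move: ek (y0 k); clear -OPsi; lra.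
rewrite ler_pdivlMr ?exprn_gt0//.
have k4 : cabs (kernel_den (b k) (b k)) ^+ 4 <= (2 * d k) ^+ 4.
  by rewrite ler_pXn2r ?nnegrE ?mulr_ge0 ?cabs_ge0// ltW.
apply: le_trans (ler_wpM2l _ k4) _; first by rewrite divr_ge0// ltW.
by rewrite le_eqVlt; apply/orP; left; apply/eqP; field.
Qed.

End Necessity.

Theorem mainTheorem19 (R : realType) (Psi : R -> R) (phi : R * R -> R * R) :
  orlicz Psi -> holomorphic_disk phi -> (forall z, disk z -> disk (phi z)) ->
  (comp_compact Psi phi -> ratio_cond Psi phi) /\
  (Delta2 Psi -> ratio_cond Psi phi -> comp_compact Psi phi).
Proof.
by move=> OPsi hphi dphi; split; [exact: compact_ratio|exact: Delta2_ratio_compact].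
Qed.
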